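(* Let $m,a,\alpha,\beta,\gamma>0$. Consider the closed-loop system $$\begin{cases} u_{tt}(x,t)=u_{xx}(x,t), & x\in(0,1),\ t>0,\\ u(0,t)=0,\quad u_x(1,t)+mu_{tt}(1,t)=-\alpha\widehat{u}_t(1,t)-a\widehat{u}_{xt}(1,t), & t\ge0,\\ \widehat{u}_{tt}(x,t)=\widehat{u}_{xx}(x,t), & x\in(0,1),\ t>0,\\ \widehat{u}_x(0,t)=\gamma\widehat{u}_t(0,t)+\beta\widehat{u}(0,t)+u_x(0,t), & t\ge0,\\ \widehat{u}_x(1,t)+m\widehat{u}_{tt}(1,t)=-\alpha\widehat{u}_t(1,t)-a\widehat{u}_{xt}(1,t), & t\ge0. \end{cases}$$ For every initial value $\big(u(\cdot,0),u_t(\cdot,0),mu_t(1,0)+a\widehat{u}_x(1,0),\widehat{u}(\cdot,0),\widehat{u}_t(\cdot,0),m\widehat{u}_t(1,0)+a\widehat{u}_x(1,0)\big)\in\mathcal{H}_1$ there exists a unique solution of this system such that $$\big(u(\cdot,t),u_t(\cdot,t),mu_t(1,t)+a\widehat{u}_x(1,t),\widehat{u}(\cdot,t),\widehat{u}_t(\cdot,t),m\widehat{u}_t(1,t)+a\widehat{u}_x(1,t)\big)\in C(0,\infty;\mathcal{H}_1),$$ and it satisfies, for all $t\ge0$, $$\int_0^1\big(|u_t(x,t)|^2+|u_x(x,t)|^2+|\widehat{u}_t(x,t)|^2+|\widehat{u}_x(x,t)|^2\big)dx+\frac1m|mu_t(1,t)+a\widehat{u}_x(1,t)|^2+\frac{1}{m+a\alpha}|m\widehat{u}_t(1,t)+a\widehat{u}_x(1,t)|^2+\beta|\widehat{u}(0,t)|^2\le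 M_1e^{-\gamma_1t},$$ where $M_1$ and $\gamma_1$ are two positive constants ($M_1$ may depend on the initial value).
   Context: All functions are complex-valued; $m,a,\alpha,\beta,\gamma$ are positive real constants. $H^1_E(0,1)=\{f\in H^1(0,1):f(0)=0\}$. The state space is $\mathcal{H}_1=\big(H^1_E(0,1)\times L^2(0,1)\times\mathbb{C}\big)\times\big(H^1(0,1)\times L^2(0,1)\times\mathbb{C}\big)$ with norm $$\|(f,g,\eta,\phi,\psi,h)\|^2=\int_0^1\big[|f'|^2+|g|^2+|\phi'|^2+|\psi|^2\big]dx+\frac1m|\eta|^2+\beta|\phi(0)|^2+\frac1{m+a\alpha}|h|^2 .$$ Solutions are understood in the mild (semigroup) sense: with state $Z=(f,g,\eta,\phi,\psi,h)=\big(u,u_t,mu_t(1)+a\widehat{u}_x(1),\widehat{u},\widehat{u}_t,m\widehat{u}_t(1)+a\widehat{u}_x(1)\big)$, the system is the evolution equation $\dot Z=\mathcal{L}Z$ on $\mathcal{H}_1$, where $\mathcal{L}(f,g,\eta,\phi,\psi,h)=(g,f'',-f'(1)-\alpha\psi(1),\psi,\phi'',-\phi'(1)-\alpha\psi(1))$ on the domain of all $(f,g,\eta,\phi,\psi,h)$ with $f\in H^2(0,1)\cap H^1_E(0,1)$, $g\in H^1_E(0,1)$, $\phi\in H^2(0,1)$, $\psi\in H^1(0,1)$, $\phi'(0)=\gamma\psi(0)+\beta\phi(0)+f'(0)$, $\eta=mg(1)+a\phi'(1)$, $h=m\psi(1)+a\phi'(1)$. For mild solutions the expressions $mu_t(1,t)+a\widehat{u}_x(1,t)$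 and $m\widehat{u}_t(1,t)+a\widehat{u}_x(1,t)$ denote the third and sixth components of the state. Here $C(0,\infty;X)$ denotes continuous functions of $t\in[0,\infty)$ with values in $X$. *)

(* Defs.v *)
From mathcomp Require Import all_boot all_order all_algebra.
From mathcomp Require Import complex.
From mathcomp Require Import all_classical all_reals all_analysis.

Set Implicit Arguments.
Unset Strict Implicit.
Unset Printing Implicit Defensive.

Import Order.TTheory GRing.Theory Num.Theory.
Import numFieldNormedType.Exports.

Local Open Scope classical_set_scope.
Local Open Scope ring_scope.

Section FunctionSpaces.
Variable R : realType.
Local Notation C := R[i].
Local Notation mu := (@lebesgue_measure R).

Definition I01 : set R := `]0, 1[.

(* |z|^2, as an element of R *)
Definition sqmod (z : C) : R := complex.Re z ^+ 2 + complex.Im z ^+ 2.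

Definition cintegral (D : set R) (f : R -> C) : C :=
  ((\int[mu]_(x in D) complex.Re (f x)) +i*
   (\int[mu]_(x in D) complex.Im (f x)))%C.

(* Functions on (0,1) or [0,1] are encoded as total functions on R whose
   values outside the interval are never used; membership in L^2(0,1) is a
   property of representatives. *)
Definition L2 : set (R -> C) := [set f |
  [/\ measurable_fun I01 (fun x : R => complex.Re (f x)),
      measurable_fun I01 (fun x : R => complex.Im (f x)) &
      (\int[mu]_(x in I01) (sqmod (f x))%:E < +oo)%E]].

(* real test functions, C^1 with compact support in (0,1) *)
Definition C1c : set (R -> R) := [set w : R -> R |
  [/\ forall x : R, derivable w x 1,
      continuous (derive1 w) &
      exists c d : R, [/\ 0 < c, d < 1 &
        forall x, ~ (c <= x <= d) -> w x = 0]]].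

Definition has_wderiv (f f1 : R -> C) : Prop :=
  L2 f1 /\ forall w, C1c w ->
    cintegral I01 (fun x => f x * (derive1 w x)%:C%C) =
    - cintegral I01 (fun x => f1 x * (w x)%:C%C).

(* An element of H^1(0,1) is represented by its representative continuous on
   [0,1], so that the boundary values f 0 and f 1 are meaningful. *)
Definition H1 : set (R -> C) := [set f |
  [/\ L2 f,
      {within `[0, 1], continuous (fun x : R => complex.Re (f x))},
      {within `[0, 1], continuous (fun x : R => complex.Im (f x))} &
      exists f1, has_wderiv f f1]].

Definition H1E : set (R -> C) := [set f | H1 f /\ f 0 = 0].

(* f is in H^2(0,1), f1 is the continuous representative of f' and f2 is a
   representative of f'' *)
Definition H2_derivs (f f1 f2 : R -> C) : Prop :=
  [/\ H1 f, has_wderiv f f1, H1 f1 & has_wderiv f1 f2].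

(* a representative of f' (unique up to a null set); junk 0 if there is none *)
Definition wderiv (f : R -> C) : R -> C :=
  xget (fun=> 0) [set f1 | has_wderiv f f1].

End FunctionSpaces.

(* The linear operations on states are those of the product of function
   spaces: pointwise and componentwise. *)
Notation state R :=
  ((R -> R[i]) * (R -> R[i]) * R[i] * (R -> R[i]) * (R -> R[i]) * R[i])%type.

Section Evolution.
Variable R : realType.
Local Notation mu := (@lebesgue_measure R).
Local Notation stateR := (state R).

Definition calH1 : set stateR := [set Z |
  let '(f, g, eta, phi, psi, h) := Z in
  [/\ H1E f, L2 g, H1 phi & L2 psi]].

(* equality of the elements of calH1 represented by Z and Z' *)
Definition Heq (Z Z' : stateR) : Prop :=
  let '(f, g, eta, phi, psi, h) := Z in
  let '(f', g', eta', phi', psi', h') := Z' in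
  [/\ forall x, 0 <= x <= 1 -> f x = f' x,
      {ae mu, forall x, 0 < x < 1 -> g x = g' x} &
      eta = eta'] /\
  [/\ forall x, 0 <= x <= 1 -> phi x = phi' x,
      {ae mu, forall x, 0 < x < 1 -> psi x = psi' x} &
      h = h'].

Variables m a alpha beta gamma : R.

Definition normsq (Z : stateR) : R :=
  let '(f, g, eta, phi, psi, h) := Z in
  \int[mu]_(x in @I01 R) (sqmod (wderiv f x) + sqmod (g x) +
                           sqmod (wderiv phi x) + sqmod (psi x))
  + m^-1 * sqmod eta + beta * sqmod (phi 0) + (m + a * alpha)^-1 * sqmod h.

Definition Hnorm (Z : stateR) : R := Num.sqrt (normsq Z).

(* graph of the operator: Z is in its domain and W represents its value at Z *)
Definition opL (Z W : stateR) : Prop :=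
  let '(f, g, eta, phi, psi, h) := Z in
  exists f1 f2 phi1 phi2 : R -> R[i],
  [/\ H2_derivs f f1 f2, H1E f, H1E g, H2_derivs phi phi1 phi2 & H1 psi] /\
  [/\ phi1 0 = gamma%:C%C * psi 0 + beta%:C%C * phi 0 + f1 0,
      eta = m%:C%C * g 1 + a%:C%C * phi1 1 &
      h = m%:C%C * psi 1 + a%:C%C * phi1 1] /\
  W = (g, f2, - f1 1 - alpha%:C%C * psi 1,
       psi, phi2, - phi1 1 - alpha%:C%C * psi 1).

(* Y represents the Riemann integral over [0,t] of Z, for the norm of calH1 *)
Definition is_Hintegral (Z : R -> stateR) (t : R) (Y : stateR) : Prop :=
  calH1 Y /\
  forall eps : R, 0 < eps -> exists2 delta : R, 0 < delta &
    forall (n : nat) (s xi : nat -> R), s 0%N = 0 -> s n = t ->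
      (forall i, (i < n)%N ->
         s i <= xi i <= s i.+1 /\ s i.+1 - s i < delta) ->
      Hnorm (\sum_(i < n) (s i.+1 - s i)%:C%C *: Z (xi i) - Y) < eps.

(* Z belongs to C([0,oo); calH1) *)
Definition Hcontinuous (Z : R -> stateR) : Prop :=
  forall t, 0 <= t ->
    calH1 (Z t) /\
    Hnorm (Z s - Z t) @[s --> within `[0, +oo[ (nbhs t)] --> (0 : R).

(* Mild solutions on [0,oo) of Z' = L Z: Z is continuous and, for t >= 0,
   the integral of Z over [0,t] is in the domain of L and
   Z t = Z 0 + L (int_0^t Z). *)
Definition mild_solution (Z : R -> stateR) : Prop :=
  Hcontinuous Z /\
  forall t, 0 <= t -> exists Y W : stateR,
    [/\ is_Hintegral Z t Y, opL Y W & Heq (Z t) (Z 0 + W)].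

End Evolution.

(* Main.v *)
Require Import Defs.
From mathcomp Require Import all_boot all_order all_algebra.
From mathcomp Require Import complex.
From mathcomp Require Import all_classical all_reals all_analysis.
From mathcomp Require Import measurable_realfun.
From mathcomp Require Import ring lra.
Import Order.TTheory GRing.Theory Num.Theory.
Import numFieldNormedType.Exports.
Local Open Scope classical_set_scope.
Local Open Scope ring_scope.
Set Implicit Arguments.
Unset Strict Implicit.
Unset Printing Implicit Defensive.

(** The error phi - f between the observer and the rod obeys a wave equation of
    its own, which does not see f, and then acts on the rod through its end
    values.  In characteristic coordinates each of the two wave equations
    becomes two waves crossing (0,1) at unit speed.  Orienting all four from 0
    to 1, the whole system consists of four transported profiles w, reinjected
    at 0 as a linear combination of the values leaving at 1 and of three
    scalars z, which solve scalar linear equations driven by the outgoing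
    values.  The scalars are h, h - eta (which is m times the velocity of the
    error at 1) and phi(0).  Real and imaginary parts decouple because the
    coefficients are real, so everything below is done for real profiles and
    scalars ([system_op], [opL_system], [realize_op]).

    Decay and uniqueness.  There is a bilinear form b, equivalent to the norm
    of the state space, such that b (L Y) Y <= - lam * b Y Y on the domain of
    the generator L ([lyapunov_form]).  It is the integral of the products of
    the profiles against affine weights r - s * x, plus diagonal terms in the
    scalars: the slope s yields decay inside (0,1), and r and the diagonal
    terms are chosen such that the boundary terms left over form a negative
    quadratic form.  Such a diagonal form cannot see that a constant error
    decays, whence a further product of phi(0) with [mean_mode].  The error
    part is multiplied by a large constant, so that its decay dominates its
    action on the rod.  Since mild solutions are only integrated solutions,
    the differential inequality is applied not to Z but to the increments
    Y (t + h) - Y t of its time integral, which lie in the domain and are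
    differentiable for the norm of b, and then h tends to 0 ([mild_decay]).
    Uniqueness is this decay applied to the difference of two solutions.

    Existence.  A transported profile is w j (x, t) = om j (t - x) for a signal
    om j defined from time -1 on, so that the system is a system of delay
    equations with delay 1 for om and z, solved by iterating over unit time
    steps ([signal], [scalars]).  The resulting path of states is continuous
    because translations are continuous in L2, its Riemann sums converge, and
    its time integral lies in the domain of L because the integral of
    om j (r - x) over r in [0, t] is a primitive in x ([orbit_op]).

    The passage between the weak derivatives in the definition of the state
    space and honest primitives is the lemma of du Bois-Reymond. *)

(** * Square integrable functions *)
Section SquareIntegrable.
Variable R : realType.
Local Notation mu := (@lebesgue_measure R).
Implicit Types (D : set R) (f g : R -> R).

Definition integ D f := mu.-integrable D (EFin \o f).

Definition sqint D f :=
  measurable_fun D f /\ (\int[mu]_(x in D) (f x ^+ 2)%:E < +oo)%E.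

Lemma ae_sub (P Q : R -> Prop) : (forall x, P x -> Q x) ->
  {ae mu, forall x, P x} -> {ae mu, forall x, Q x}.
Proof. by move=> PQ; apply: filterS PQ; exact: (ae_filter_ringOfSetsType mu). Qed.

Lemma ae_sub2 (P Q S : R -> Prop) : (forall x, P x -> Q x -> S x) ->
  {ae mu, forall x, P x} -> {ae mu, forall x, Q x} -> {ae mu, forall x, S x}.
Proof. by move=> PQS; apply: filterS2 PQS; exact: (ae_filter_ringOfSetsType mu). Qed.

Lemma integP D f : measurable_fun D f -> (\int[mu]_(x in D) `|f x|%:E < +oo)%E -> integ D f.
Proof.
move=> mf fi; apply/integrableP; split; first exact/measurable_EFinP.
by under eq_integral do rewrite /= .
Qed.

Lemma integ_meas D f : integ D f -> measurable_fun D f.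
Proof. by move=> /measurable_int/measurable_EFinP. Qed.

Lemma integ_le D f g : measurable D -> measurable_fun D f -> integ D g ->
  (forall x, D x -> `|f x| <= g x) -> integ D f.
Proof.
move=> mD mf ig fg; apply: (@le_integrable _ _ _ mu D mD _ _ _ _ ig); first exact/measurable_EFinP.
move=> x Dx /=; rewrite lee_fin (le_trans (fg x Dx))// ler_norm//.
Qed.

Lemma integD D f g : measurable D -> integ D f -> integ D g ->
  integ D (fun x => f x + g x).
Proof. by move=> mD intf intg; exact: (@integrableD _ _ _ mu D mD _ _ intf intg). Qed.

Lemma integB D f g : measurable D -> integ D f -> integ D g ->
  integ D (fun x => f x - g x).
Proof. by move=> mD intf intg; exact: (@integrableB _ _ _ mu D mD _ _ intf intg). Qed.

Lemma integZ D r f : measurable D -> integ D f -> integ D (fun x => r * f x).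
Proof. by move=> mD intf; exact: (@integrableZl _ _ _ mu D mD r _ intf). Qed.

Lemma integS D D' f : measurable D -> measurable D' -> D' `<=` D ->
  integ D f -> integ D' f.
Proof. by move=> mD mD' DD'; exact: integrableS. Qed.

Lemma integ_sum D (I : Type) (s : seq I) (f : I -> R -> R) :
  measurable D -> (forall i, integ D (f i)) ->
  integ D (fun x => \sum_(i <- s) f i x).
Proof.
move=> mD fi; rewrite /integ.
rewrite (_ : _ \o _ = fun x => (\sum_(i <- s) (EFin \o f i) x)%E).
  by apply: (@integrable_sum _ _ _ mu D mD) => i _; exact: fi.
by apply/funext => x /=; rewrite sumEFin.
Qed.

Lemma Rintegral_sum D (I : Type) (s : seq I) (f : I -> R -> R) :
  measurable D -> (forall i, integ D (f i)) ->
  \int[mu]_(x in D) (\sum_(i <- s) f i x) = \sum_(i <- s) \int[mu]_(x in D) f i x.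
Proof.
move=> mD fi; elim: s => [|i s IH].
  rewrite big_nil; under eq_Rintegral do rewrite big_nil.
  by rewrite Rintegral_cst ?mul0r.
rewrite big_cons -IH -RintegralD//; last 2 first.
  exact: fi. exact: integ_sum.
by apply: eq_Rintegral => x _; rewrite big_cons.
Qed.

Lemma ae_eq_Rintegral D f g : measurable D -> measurable_fun D f ->
  measurable_fun D g -> {ae mu, forall x, D x -> f x = g x} ->
  \int[mu]_(x in D) f x = \int[mu]_(x in D) g x.
Proof.
move=> mD mf mg fg; congr fine.
apply: (@ae_eq_integral _ _ _ mu D (EFin \o g) (EFin \o f) mD).
- exact/measurable_EFinP.
- exact/measurable_EFinP.
by apply: ae_sub fg => x /= h Dx; congr EFin; exact: h.
Qed.

Lemma sqint_sqr D f : measurable D -> sqint D f -> integ D (fun x => f x ^+ 2).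
Proof.
move=> mD [mf fi]; apply: integP; first exact: measurable_funX.
by under eq_integral do rewrite ger0_norm ?sqr_ge0//.
Qed.

Lemma sqintP D f : measurable D -> measurable_fun D f ->
  integ D (fun x => f x ^+ 2) -> sqint D f.
Proof.
move=> mD mf /integrableP[_ fi]; split => //; apply: le_lt_trans fi.
by under [leRHS]eq_integral do rewrite /= ger0_norm ?sqr_ge0//.
Qed.

Lemma sqintM D f g : measurable D -> sqint D f -> sqint D g ->
  integ D (fun x => f x * g x).
Proof.
move=> mD hf hg.
apply: (@integ_le _ _ (fun x => f x ^+ 2 + g x ^+ 2)) => //.
- by apply: measurable_funM; [case: hf|case: hg].
- by apply: integD => //; apply: sqint_sqr.
- move=> x _; rewrite ler_norml; apply/andP; split; nra.
Qed.

Lemma sqint_cst D r : measurable D -> (mu D < +oo)%E -> sqint D (fun=> r).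
Proof.
move=> mD Doo; split; first exact: measurable_cst.
have /fineK muD : mu D \is a fin_num by rewrite ge0_fin_numE.
rewrite (_ : integral _ _ _ = ((r ^+ 2) * fine (mu D))%:E) ?ltry// EFinM.
apply: eq_trans (@integral_cst _ _ _ mu D mD (r ^+ 2)%:E) _.
exact: (congr1 (fun y => (r ^+ 2)%:E * y)%E (esym muD)).
Qed.

Lemma sqint_integ D f : measurable D -> (mu D < +oo)%E -> sqint D f -> integ D f.
Proof.
move=> mD Doo hf; have := sqintM mD hf (sqint_cst 1 mD Doo).
by rewrite /integ; under eq_fun do rewrite mulr1.
Qed.

Lemma sqintZ D r f : measurable D -> sqint D f -> sqint D (fun x => r * f x).
Proof.
move=> mD hf; apply: sqintP => //.
  by apply: measurable_funM => //; case: hf.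
have := @integZ D (r ^+ 2) _ mD (sqint_sqr mD hf).
by rewrite /integ; congr mu.-integrable; apply/funext => x /=; congr EFin; ring.
Qed.

Lemma sqintD D f g : measurable D -> sqint D f -> sqint D g ->
  sqint D (fun x => f x + g x).
Proof.
move=> mD hf hg; apply: sqintP => //.
  by apply: measurable_funD => //; [case: hf|case: hg].
have i1 := integD mD (sqint_sqr mD hf) (sqint_sqr mD hg).
have := integD mD i1 (integZ 2 mD (sqintM mD hf hg)).
by rewrite /integ; congr mu.-integrable; apply/funext => x /=; congr EFin; ring.
Qed.

Lemma sqintB D f g : measurable D -> sqint D f -> sqint D g ->
  sqint D (fun x => f x - g x).
Proof.
move=> mD hf hg; have := sqintD mD hf (sqintZ (-1) mD hg).
by congr sqint; apply/funext => x; rewrite mulN1r.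
Qed.

Lemma sqint_sum D (I : Type) (s : seq I) (f : I -> R -> R) :
  measurable D -> (mu D < +oo)%E -> (forall i, sqint D (f i)) ->
  sqint D (fun x => \sum_(i <- s) f i x).
Proof.
move=> mD Doo fi; elim: s => [|i s IH].
  have := sqint_cst 0 mD Doo.
  by congr sqint; apply/funext => x; rewrite big_nil.
have := sqintD mD (fi i) IH.
by congr sqint; apply/funext => x; rewrite big_cons.
Qed.

Lemma sqintS D D' f : measurable D -> measurable D' -> D' `<=` D ->
  sqint D f -> sqint D' f.
Proof.
move=> mD mD' DD' hf; apply: sqintP => //.
  by apply: measurable_funS DD' _ => //; case: hf.
by apply: integS DD' _ => //; exact: sqint_sqr.
Qed.

Lemma sqint_ae D f g : measurable D -> measurable_fun D g ->
  {ae mu, forall x, D x -> f x = g x} -> sqint D f -> sqint D g.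
Proof.
move=> mD mg fg [mf fi]; split => //.
rewrite -(@ae_eq_integral _ _ _ mu D (fun x => (g x ^+ 2)%:E) (fun x => (f x ^+ 2)%:E) mD)//.
- exact/measurable_EFinP/measurable_funX.
- exact/measurable_EFinP/measurable_funX.
by apply: ae_sub fg => x /= h Dx; congr (_ ^+ _)%:E; exact: h.
Qed.

Lemma sqint_bounded_mul D f g C : measurable D -> sqint D f ->
  measurable_fun D g -> (forall x, D x -> `|g x| <= C) ->
  sqint D (fun x => g x * f x).
Proof.
move=> mD hf mg gC; apply: sqintP => //.
  by apply: measurable_funM => //; case: hf.
apply: (@integ_le _ _ (fun x => C ^+ 2 * f x ^+ 2)) => //.
- by apply: measurable_funX; apply: measurable_funM => //; case: hf.
- by apply: integZ => //; exact: sqint_sqr.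
- move=> x Dx; rewrite ger0_norm ?sqr_ge0// exprMn ler_wpM2r ?sqr_ge0//.
  by rewrite -real_normK ?num_real// lerXn2r ?nnegrE ?(le_trans _ (gC x Dx)) ?gC.
Qed.

Lemma Rintegral_sqr_eq0 D f : measurable D -> sqint D f ->
  \int[mu]_(x in D) f x ^+ 2 = 0 -> {ae mu, forall x, D x -> f x = 0}.
Proof.
move=> mD hf h0.
have h1 : (\int[mu]_(x in D) `|(f x ^+ 2)%:E| = 0)%E.
  under eq_integral do rewrite gee0_abs ?lee_fin ?sqr_ge0//.
  have /fineK <- : (\int[mu]_(x in D) (f x ^+ 2)%:E \is a fin_num)%E.
    exact: integrable_fin_num (sqint_sqr mD hf).
  by congr EFin.
have mf2 : measurable_fun D (fun x => (f x ^+ 2)%:E).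
  by apply/measurable_EFinP/measurable_funX; case: hf.
have := (ae_eq_integral_abs mu mD mf2).1 h1.
apply: ae_sub => x /= h Dx; have := h Dx => -[] /eqP.
by rewrite sqrf_eq0 => /eqP.
Qed.

(** The integral of (f - c)^2 is nonnegative for all constants c; take for c the
    mean value of f. *)
Lemma sqr_Rintegral_le D f (d : R) : measurable D -> mu D = d%:E -> sqint D f ->
  (\int[mu]_(x in D) f x) ^+ 2 <= d * \int[mu]_(x in D) f x ^+ 2.
Proof.
move=> mD muD hf.
have Doo : (mu D < +oo)%E by rewrite muD ltry.
have d0 : 0 <= d by rewrite -lee_fin -muD.
have i1 := sqint_integ mD Doo hf.
have i2 := sqint_sqr mD hf.
set s := \int[mu]_(x in D) f x; set q := \int[mu]_(x in D) f x ^+ 2.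
have H c : 0 <= q - 2 * c * s + c ^+ 2 * d.
  have : 0 <= \int[mu]_(x in D) (f x - c) ^+ 2.
    by apply: Rintegral_ge0 => x _; exact: sqr_ge0.
  rewrite (_ : \int[mu]_(x in D) _ =
     \int[mu]_(x in D) (f x ^+ 2 + (- 2 * c * f x + c ^+ 2))); last first.
    by apply: eq_Rintegral => x _; ring.
  have i3 : integ D (fun=> c ^+ 2).
    by apply: sqint_integ => //; exact: sqint_cst.
  rewrite RintegralD//; last by apply: integD => //; exact: integZ.
  rewrite RintegralD//; last exact: integZ.
  rewrite RintegralZl// (@Rintegral_cst _ _ _ mu D mD) (_ : fine _ = d) -/s -/q; last exact: (congr1 fine muD).
  by move=> h; nra.
have [d1|d1] := eqVneq d 0.
  rewrite d1 mul0r leNgt; apply/negP => s0.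
  have := H ((q + 1) / s).
  rewrite d1 mulr0 addr0 -!mulrA mulVf ?mulr1; last by rewrite -sqrf_eq0 gt_eqF.
  have q0 : 0 <= q by apply: Rintegral_ge0 => x _; exact: sqr_ge0.
  nra.
have d2 : 0 < d by rewrite lt0r d1.
have := H (s / d).
rewrite (_ : q - _ + _ = (d * q - s ^+ 2) / d); last by field.
by rewrite pmulr_lge0 ?invr_gt0// subr_ge0.
Qed.

End SquareIntegrable.

(** * Reflections, primitives and integration by parts *)
Section Primitives.
Variable R : realType.
Local Notation mu := (@lebesgue_measure R).
Implicit Types (D : set R) (f g F G : R -> R).

Lemma lebesgue_measure_reflect (c : R) (A : set R) : measurable A ->
  pushforward mu (fun x : R => (c - x : measurableTypeR R)) A = mu A.
Proof.
move=> mA; have mr : measurable_fun setT (fun x : R => c - x) by exact: measurable_funB.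
apply/esym; apply: lebesgue_measure_unique => //= X [[a b]] _ <-.
rewrite /pushforward.
rewrite (_ : _ @^-1` _ = [set` `[c - b, c - a[]); last first.
  apply/seteqP; split => x /=; rewrite !in_itv/= => /andP[h1 h2];
  apply/andP; split; lra.
rewrite !lebesgue_measure_itv/= !lte_fin ltrD2l ltrN2.
by case: ifP => // _; congr EFin; ring.
Qed.

Lemma measurable_reflect (c : R) : measurable_fun setT (fun x : R => c - x).
Proof. exact: measurable_funB. Qed.

Lemma ge0_integral_reflectT c (f : R -> \bar R) : measurable_fun setT f ->
  (forall x, 0 <= f x)%E ->
  (\int[mu]_x f (c - x)%R = \int[mu]_x f x)%E.
Proof.
move=> mf f0.
have mr := @measurable_reflect c.
transitivity (\int[pushforward mu (fun x : R => (c - x)%R : measurableTypeR R)]_x f x)%E.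
  by rewrite ge0_integral_pushforward.
apply: eq_measure_integral => //= A mA AS; exact: lebesgue_measure_reflect.
Qed.

Lemma integ_mkcond D f : measurable D -> integ D f <-> integ setT (f \_ D).
Proof. by move=> mD; rewrite /integ integrable_mkcond// restrict_EFin. Qed.

Lemma integ_reflect c D f : measurable D -> integ D f ->
  integ [set x | D (c - x)] (fun x => f (c - x)).
Proof.
move=> mD /(integ_mkcond _ mD) intf; apply/integ_mkcond.
  by rewrite -[X in measurable X]setTI; exact: measurable_reflect.
have mf := integ_meas intf.
rewrite (_ : _ \_ _ = (f \_ D) \o (fun x => c - x)); last first.
  apply/funext => x /=; rewrite !patchE.
  by congr (if _ then _ else _); apply/idP/idP; rewrite !inE.
apply: integP.
  by apply: measurableT_comp => //; exact: measurable_reflect.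
have -> : (\int[mu]_(x in setT) `|((f \_ D) \o (fun x => c - x)) x|%:E
   = \int[mu]_x `|(f \_ D) x|%:E)%E.
  rewrite (@ge0_integral_reflectT c (fun x => `|(f \_ D) x|%:E))//.
  exact/measurable_EFinP/measurableT_comp.
by case/integrableP : intf.
Qed.

Lemma Rintegral_reflect c D f : measurable D -> integ D f ->
  \int[mu]_(x in [set x | D (c - x)]) f (c - x) = \int[mu]_(x in D) f x.
Proof.
move=> mD intf.
have intf' := integ_reflect c mD intf.
have mD' : measurable [set x | D (c - x)].
  by rewrite -[X in measurable X]setTI; exact: measurable_reflect.
rewrite Rintegral_mkcond [RHS]Rintegral_mkcond.
move/(integ_mkcond _ mD) : intf => intf.
move/(integ_mkcond _ mD') : intf'.
rewrite (_ : _ \_ _ = (f \_ D) \o (fun x => c - x)); last first.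
  apply/funext => x /=; rewrite !patchE.
  by congr (if _ then _ else _); apply/idP/idP; rewrite !inE.
move=> intf'.
have mr := @measurable_reflect c.
congr fine.
transitivity (\int[pushforward mu (fun x : R => (c - x)%R : measurableTypeR R)]_x ((f \_ D) x)%:E)%E.
  rewrite integral_pushforward//.
  by apply/measurable_EFinP; exact: (integ_meas intf).
apply: eq_measure_integral => //= A mA AS; exact: lebesgue_measure_reflect.
Qed.

Lemma sqint_reflect c D f : measurable D -> sqint D f ->
  sqint [set x | D (c - x)] (fun x => f (c - x)).
Proof.
move=> mD hf.
have mD' : measurable [set x | D (c - x)].
  by rewrite -[X in measurable X]setTI; exact: measurable_reflect.
apply: sqintP => //.
  apply: (measurable_comp mD) => //; first by move=> _ [x /= Dx <-].
    by case: hf.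
  by apply: measurable_funTS; exact: measurable_reflect.
exact: (integ_reflect c mD (sqint_sqr mD hf)).
Qed.

(** Both sides are the integral of f x * g y over the half plane y <= x. *)
Lemma Fubini_triangle f g : integ setT f -> integ setT g ->
  \int[mu]_x (f x * \int[mu]_(y in `]-oo, x]) g y) =
  \int[mu]_y (g y * \int[mu]_(x in `[y, +oo[) f x).
Proof.
move=> intf intg.
(* Fubini for the product cut off by the indicator of the half plane. *)
pose h (z : R * R) : R := if z.2 <= z.1 then f z.1 * g z.2 else 0.
have mf := integ_meas intf; have mg := integ_meas intg.
have mh : measurable_fun setT h.
  apply: measurable_fun_ifT => //.
    exact: measurable_fun_ler.
  by apply: measurable_funM; exact: measurableT_comp.
have ifn : (\int[mu]_x `|f x|%:E \is a fin_num)%E.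
  by apply: integrable_fin_num => //; exact: integrable_norm.
have ign : (\int[mu]_x `|g x|%:E \is a fin_num)%E.
  by apply: integrable_fin_num => //; exact: integrable_norm.
have ih : (mu \x mu)%E.-integrable setT (EFin \o h).
  apply/integrable12ltyP; first exact/measurable_EFinP.
  apply: (@le_lt_trans _ _ (\int[mu]_x (`|f x|%:E * \int[mu]_y `|g y|%:E))%E); last first.
    rewrite -(fineK ign) ge0_integralZr//; last 2 first.
      exact/measurable_EFinP/measurableT_comp.
      by rewrite lee_fin fine_ge0// integral_ge0.
    by rewrite -(fineK ifn) -EFinM ltry.
  apply: ge0_le_integral => //.
  - by move=> x _; apply: integral_ge0.
  - apply: (@measurable_fun_fubini_tonelli_F _ _ _ _ _ mu (fun z => `|(h z)%:E|)%E) => //.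
    by apply/measurable_EFinP/measurableT_comp.
  - apply: emeasurable_funM => //; exact/measurable_EFinP/measurableT_comp.
  - move=> x _; rewrite -ge0_integralZl//; last first.
      exact/measurable_EFinP/measurableT_comp.
    apply: ge0_le_integral => //.
    + apply/measurable_EFinP/measurableT_comp => //.
      exact: measurableT_comp mh _.
    + by apply: emeasurable_funM => //; exact/measurable_EFinP/measurableT_comp.
    + by move=> y _; rewrite lee_fin /h/=; case: ifP => _; rewrite ?normrM// normr0.
have := @Fubini _ _ _ _ _ mu mu _ ih.
move=> /(congr1 fine) H.
have i1 x : integ setT (fun y => h (x, y)).
  have := integZ (f x) measurableT ((integ_mkcond g (measurable_itv `]-oo, x])).1 (integS measurableT (measurable_itv _) (@subsetT _ _) intg)).
  congr integ; apply/funext => y; rewrite /h/= patchE mem_setE in_itv/=.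
  by case: ifP => _; rewrite ?mulr0.
have i2 y : integ setT (fun x => h (x, y)).
  have := integZ (g y) measurableT ((integ_mkcond f (measurable_itv `[y, +oo[)).1 (integS measurableT (measurable_itv _) (@subsetT _ _) intf)).
  congr integ; apply/funext => x; rewrite /h/= patchE mem_setE in_itv/= andbT.
  by case: ifP => _; rewrite ?mulr0// mulrC.
transitivity (fine (\int[mu]_x \int[mu]_y (EFin \o h) (x, y))%E).
  congr fine; apply: eq_integral => x _.
  rewrite -[RHS]fineK; last exact: integrable_fin_num (i1 x).
  congr EFin; rewrite Rintegral_mkcond -RintegralZl//; last first.
    apply/(integ_mkcond _ (measurable_itv _)).
    exact: (integS measurableT (measurable_itv _) (@subsetT _ _) intg).
  congr fine; apply: eq_integral => y _ /=; rewrite /h/= patchE mem_setE in_itv/=.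
  by case: ifP => _; rewrite ?mulr0.
rewrite H; congr fine; apply: eq_integral => y _.
rewrite -[LHS]fineK; last exact: integrable_fin_num (i2 y).
congr EFin; rewrite Rintegral_mkcond -RintegralZl//; last first.
  apply/(integ_mkcond _ (measurable_itv _)).
  exact: (integS measurableT (measurable_itv _) (@subsetT _ _) intf).
congr fine; apply: eq_integral => x _ /=; rewrite /h/= patchE mem_setE in_itv/= andbT.
by case: ifP => _; rewrite ?mulr0// mulrC.
Qed.

(** F is absolutely continuous on [a, b] with derivative f, in integrated form. *)
Definition primitive_on (a b : R) f F :=
  forall x, a <= x <= b -> F x = F a + \int[mu]_(y in `[a, x]) f y.

Lemma primitive_continuous a b f F : a <= b -> integ `[a, b] f ->
  primitive_on a b f F -> {within `[a, b], continuous F}.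
Proof.
move=> ab intf Ff.
have H := parameterized_integral_continuous ab intf.
have : {within `[a, b], continuous (fun x => F a + parameterized_integral mu a x f)}.
  by move=> x; apply: cvgD; [exact: cvg_cst|exact: H].
apply: subspace_eq_continuous => x; rewrite inE/= in_itv/= => xab.
exact/esym/(Ff x xab).
Qed.

Lemma primitive_measurable a b f F : a <= b -> integ `[a, b] f ->
  primitive_on a b f F -> measurable_fun `[a, b] F.
Proof.
move=> ab intf Ff; apply: subspace_continuous_measurable_fun => //.
exact: primitive_continuous Ff.
Qed.

Lemma primitive_bounded a b f F : a <= b -> integ `[a, b] f ->
  primitive_on a b f F ->
  forall x, a <= x <= b -> `|F x| <= `|F a| + \int[mu]_(y in `[a, b]) `|f y|.
Proof.
move=> ab intf Ff x xab; rewrite (Ff x xab) (le_trans (ler_normD _ _))// lerD2l.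
have sub : `[a, x]%classic `<=` `[a, b]%classic.
  by apply: subset_itvl; rewrite bnd_simp; case/andP: xab.
have ix : integ `[a, x] f by apply: integS sub intf.
apply: le_trans (le_normr_Rintegral _ ix) _ => //.
rewrite /Rintegral fine_le//.
- by apply: integrable_fin_num => //; exact: integrable_norm ix.
- by apply: integrable_fin_num => //; exact: integrable_norm intf.
- apply: ge0_subset_integral => //.
  by apply/measurable_EFinP/measurableT_comp => //; exact: integ_meas intf.
Qed.

Lemma integ_mul_primitive a b f F g : a <= b -> integ `[a, b] f ->
  primitive_on a b f F -> integ `[a, b] g -> integ `[a, b] (fun x => F x * g x).
Proof.
move=> ab intf Ff intg.
apply: (@integ_le _ _ _ (fun x => (`|F a| + \int[mu]_(y in `[a, b]) `|f y|) * `|g x|)) => //.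
- apply: measurable_funM; last exact: integ_meas intg.
  exact: primitive_measurable Ff.
- by apply: integZ => //; exact: integrable_norm intg.
- move=> x; rewrite /= in_itv/= => xab; rewrite normrM ler_wpM2r//.
  exact: primitive_bounded Ff x xab.
Qed.

Lemma Rintegral_itv_cat a b c f : a <= b -> b <= c -> integ `[a, c] f ->
  \int[mu]_(x in `[a, c]) f x =
  \int[mu]_(x in `[a, b]) f x + \int[mu]_(x in `[b, c]) f x.
Proof.
move=> ab bc intf.
have := @Rintegral_itvB R f (BLeft a) (BRight c) b intf.
rewrite !bnd_simp => /(_ ab bc) H.
rewrite -(@Rintegral_itv_obnd_cbnd _ b (BRight c)); last first.
  by apply: integS intf => //; apply: subset_itv; rewrite bnd_simp.
by rewrite -H addrCA subrr addr0.
Qed.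

(** Cutting the square into the triangles below and above the diagonal turns
    the product of the two increments into the sum of the two integrals. *)
Lemma by_parts a b f g F G : a <= b -> integ `[a, b] f -> integ `[a, b] g ->
  primitive_on a b f F -> primitive_on a b g G ->
  \int[mu]_(x in `[a, b]) (F x * g x + G x * f x) = F b * G b - F a * G a.
Proof.
move=> ab intf intg Ff Gg.
have mab : measurable `[a, b] by exact: measurable_itv.
have iFg := integ_mul_primitive ab intf Ff intg.
have iGf := integ_mul_primitive ab intg Gg intf.
have := Fubini_triangle ((integ_mkcond f mab).1 intf) ((integ_mkcond g mab).1 intg).
have -> : \int[mu]_x ((f \_ `[a, b]) x * \int[mu]_(y in `]-oo, x]) (g \_ `[a, b]) y)
   = \int[mu]_(x in `[a, b]) (G x * f x - G a * f x).
  rewrite [RHS]Rintegral_mkcond; apply: eq_Rintegral => x _.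
  rewrite !patchE; case: ifPn => [|_]; last by rewrite mul0r.
  rewrite inE/= in_itv/= => xab.
  rewrite -Rintegral_mkcondr (_ : _ `&` _ = `[a, x]%classic); last first.
    apply/seteqP; split => y /=; rewrite !in_itv/=; first by case=> -> /andP[->].
    move=> /andP[ay yx]; split => //; rewrite ay (le_trans yx)//.
    by case/andP: xab.
  by rewrite (Gg x xab); ring.
have -> : \int[mu]_x ((g \_ `[a, b]) x * \int[mu]_(y in `[x, +oo[) (f \_ `[a, b]) y)
   = \int[mu]_(x in `[a, b]) (F b * g x - F x * g x).
  rewrite [RHS]Rintegral_mkcond; apply: eq_Rintegral => x _.
  rewrite !patchE; case: ifPn => [|_]; last by rewrite mul0r.
  rewrite inE/= in_itv/= => xab.
  rewrite -Rintegral_mkcondr (_ : _ `&` _ = `[x, b]%classic); last first.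
    apply/seteqP; split => y /=; rewrite !in_itv/= ?andbT; first by case=> -> /andP[_ ->].
    move=> /andP[ay yx]; split => //; rewrite yx andbT (le_trans _ ay)//.
    by case/andP: xab.
  case/andP: (xab) => ax xb.
  rewrite (Ff x xab) (Ff b); last by rewrite ab lexx.
  by rewrite (Rintegral_itv_cat ax xb intf); ring.
rewrite RintegralB//; last exact: integZ.
rewrite RintegralB//; last exact: integZ.
rewrite !RintegralZl// => H.
rewrite RintegralD//.
have hF := Ff b; have hG := Gg b; rewrite ab lexx/= in hF hG.
have {}hF := hF isT; have {}hG := hG isT.
move: H hF hG.
move: (\int[mu]_(x in _) (G x * f x)) (\int[mu]_(x in _) (F x * g x)).
move: (\int[mu]_(x in _) (f x)) (\int[mu]_(x in _) (g x)) => If Ig I1 I2 H hF hG.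
rewrite hF in H; rewrite hF hG; lra.
Qed.

Lemma primitive_on_sub a b c f F : c <= b -> primitive_on a b f F ->
  primitive_on a c f F.
Proof. by move=> cb H x /andP[ax xc]; apply: H; rewrite ax (le_trans xc). Qed.

Lemma primitive_onM a b f g F G : a <= b -> integ `[a, b] f -> integ `[a, b] g ->
  primitive_on a b f F -> primitive_on a b g G ->
  primitive_on a b (fun x => F x * g x + G x * f x) (fun x => F x * G x).
Proof.
move=> ab intf intg Ff Gg x xab; case/andP: (xab) => ax xb.
have sub : `[a, x]%classic `<=` `[a, b]%classic by apply: subset_itvl; rewrite bnd_simp.
rewrite (@by_parts a x f g F G)//; first by ring.
- exact: integS sub intf.
- exact: integS sub intg.
- exact: primitive_on_sub Ff.
- exact: primitive_on_sub Gg.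
Qed.

End Primitives.

(** * Continuity of translations in L2 *)
Section Approximation.
Variable R : realType.
Local Notation mu := (@lebesgue_measure R).
Implicit Types (D : set R) (f g : R -> R).

(** Heine, for functions that are continuous relatively to the segment. *)
Lemma unif_continuous_itv (a b : R) g :
  (forall x, a <= x <= b -> forall e : R, 0 < e -> exists2 r : R, 0 < r &
     forall y, a <= y <= b -> `|x - y| < r -> `|g x - g y| < e) ->
  forall e : R, 0 < e -> exists2 r : R, 0 < r &
    forall x y, a <= x <= b -> a <= y <= b -> `|x - y| < r -> `|g x - g y| < e.
Proof.
move=> gc e e0.
have /compact_near_coveringP := @segment_compact R a b.
move=> /(_ R (0^'+) (fun d x => a <= x <= b ->
   forall y, a <= y <= b -> `|x - y| < d -> `|g x - g y| < e) _).
have H : forall x, `[a, b]%classic x -> \forall x' \near x & d \near 0^'+,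
    a <= x' <= b -> forall y, a <= y <= b -> `|x' - y| < d -> `|g x' - g y| < e.
  move=> x; rewrite /= in_itv/= => xab.
  have [r r0 Hr] := gc x xab (e / 2) (divr_gt0 e0 (ltr0n _ 2)).
  have r20 : 0 < r / 2 by rewrite divr_gt0.
  exists (ball x (r / 2), [set d | d < r / 2]) => /=.
    split; first exact: nbhsx_ballx.
    by near=> d; near: d; exact: nbhs_right_lt.
  move=> [x' d]/= [bx' dr] x'ab y yab xyd.
  have h1 : `|x - x'| < r by rewrite (lt_trans bx')// ltr_pdivrMr// ltr_pMr// ltr1n.
  have h2 : `|x - y| < r.
    rewrite [r]splitr (le_lt_trans (ler_distD x' _ _))// ltrD//.
    exact: lt_trans xyd dr.
  have := Hr _ x'ab h1; have := Hr _ yab h2; rewrite !ltr_norml.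
  by move=> /andP[? ?] /andP[? ?]; apply/andP; split; lra.
move=> /(_ H) K.
have : \forall d \near 0^'+, 0 < d /\ (forall x, a <= x <= b -> forall y, a <= y <= b -> `|x - y| < d -> `|g x - g y| < e).
  near=> d; split; first by near: d; exact: nbhs_right_gt.
  move=> x xab; have : `[a, b]%classic `<=` (fun x => a <= x <= b ->
   forall y, a <= y <= b -> `|x - y| < d -> `|g x - g y| < e) by near: d.
  by move=> /(_ x); apply => //; rewrite /= in_itv.
move=> /filter_ex[d [d0 Hd]]; exists d => // x y xab yab; exact: Hd.
Unshelve. all: by end_near. Qed.

Lemma within_continuous_dist (a b : R) g : {within `[a, b], continuous g} ->
  forall x, a <= x <= b -> forall e : R, 0 < e -> exists2 r : R, 0 < r &
     forall y, a <= y <= b -> `|x - y| < r -> `|g x - g y| < e.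
Proof.
move=> gc x xab e e0.
have abx : `[a, b]%classic x by rewrite /= in_itv.
have /subspace_continuousP/(_ x abx)/cvgrPdist_lt/(_ e e0) := gc.
rewrite /within/= => /nbhs_ballP[r /= r0 Hr]; exists r => // y yab xy.
by apply: Hr => //=; rewrite in_itv.
Qed.

Lemma continuous_dist g (x e : R) : continuous g -> 0 < e ->
  exists2 r : R, 0 < r & forall y, `|x - y| < r -> `|g x - g y| < e.
Proof.
move=> gc e0; have := gc x => /cvgrPdist_lt/(_ e e0).
by move=> /nbhs_ballP[r /= r0 Hr]; exists r => // y xy; exact: Hr.
Qed.

(** Truncation to [- n, n]: it turns approximation in L1 into approximation in
    L2, since bounded functions satisfy (u - v)^2 <= 2 n |u - v|. *)
Definition clip (n : R) f (x : R) := Num.max (- n) (Num.min n (f x)).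

Lemma clip_bound n f x : 0 <= n -> `|clip n f x| <= n.
Proof.
by move=> n0; rewrite /clip ler_norml le_max lexx/= ge_max ge_min lexx/= andbT; lra.
Qed.

Lemma clip_id n f x : `|f x| <= n -> clip n f x = f x.
Proof.
rewrite /clip ler_norml => /andP[h1 h2].
by rewrite (min_idPr _)// (max_idPr _).
Qed.

Lemma clamp_lip (a b s t : R) :
  `|Num.max a (Num.min b s) - Num.max a (Num.min b t)| <= `|s - t|.
Proof.
wlog st : s t / s <= t.
  move=> H; case: (leP s t) => [|/ltW] ts; first exact: H.
  by rewrite distrC [leRHS]distrC; exact: H.
have mn : Num.min b s <= Num.min b t /\ Num.min b t - Num.min b s <= t - s.
  by rewrite /Num.min; case: ltP => h1; case: ltP => h2; split; lra.
have mx x y : x <= y -> Num.max a x <= Num.max a y /\ Num.max a y - Num.max a x <= y - x.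
  by clear; move=> xy; rewrite /Num.max; case: ltP => h1; case: ltP => h2; split; lra.
have [h1 h2] := mx _ _ mn.1.
by rewrite distrC [leRHS]distrC !ger0_norm ?subr_ge0// (le_trans h2) ?mn.2.
Qed.

Lemma clip_lip n f g x : `|clip n f x - clip n g x| <= `|f x - g x|.
Proof. exact: clamp_lip. Qed.

Lemma measurable_clip D n f : measurable_fun D f -> measurable_fun D (clip n f).
Proof.
by move=> mf; apply: measurable_maxr => //; exact: measurable_minr.
Qed.

Lemma continuous_clip n g : continuous g -> continuous (clip n g).
Proof.
move=> gc x; rewrite /clip.
apply: (@continuous_max R R (fun=> - n) (fun x => Num.min n (g x))).
  exact: cvg_cst.
by apply: continuous_min; [exact: cvg_cst|exact: gc].
Qed.

Lemma clip_cvg D f : measurable D -> sqint D f ->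
  forall e : R, 0 < e -> exists2 n : R, 0 < n &
    \int[mu]_(x in D) (f x - clip n f x) ^+ 2 < e.
Proof.
move=> mD hf e e0.
have mf : measurable_fun D f by case: hf.
pose f_ (n : nat) x := ((f x - clip n%:R f x) ^+ 2)%:E.
have H : (\int[mu]_(x in D) f_ n x @[n --> \oo] --> \int[mu]_(x in D) (cst 0 x))%E.
  apply: (@dominated_cvg _ _ _ mu D mD f_ (cst 0)%E (fun x => (f x ^+ 2)%:E)) => //.
  - move=> n; apply/measurable_EFinP/measurable_funX/measurable_funB => //.
    exact: measurable_clip.
  - move=> x _; apply: cvg_near_cst; near=> n.
    rewrite /f_ clip_id ?subrr ?expr0n//.
    near: n; exact: nbhs_infty_ger.
  - exact: sqint_sqr.
  - move=> n x _; rewrite gee0_abs ?lee_fin ?sqr_ge0//.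
    have := clip_lip n%:R f (fun=> 0) x.
    have := clip_id (n := n%:R) (f := f) (x := x).
    have := clip_bound f x (ler0n R n).
    have := @clip_id n%:R (fun=> 0) x; rewrite normr0 ler0n => /(_ isT) ->.
    rewrite !subr0 /clip /Num.max /Num.min.
    move: (ler0n R n) => n0.
    case: (ltP n%:R (f x)) => ?; case: (ltP) => ? _ _ _; nra.
rewrite integral0 in H.
move/fine_cvgP: H => [_] /cvgrPdist_lt/(_ e e0) H.
have [n [n0 Hn]] : exists n, (0 < n)%N /\ `|fine 0%E - fine (\int[mu]_(x in D) f_ n x)%E| < e.
  have : \forall n \near \oo, (0 < n)%N /\ `|fine 0%E - fine (\int[mu]_(x in D) f_ n x)%E| < e.
    near=> n; split; near: n => //; exact: nbhs_infty_gt.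
  by move=> /filter_ex[n Hn]; exists n.
exists n%:R; first by rewrite ltr0n.
by apply: le_lt_trans Hn; rewrite sub0r normrN ler_norm.
Unshelve. all: by end_near. Qed.

(** Truncate f, approximate the truncation by continuous functions in L1 and
    truncate these: the quadratic error is controlled by the bound of the
    truncations times the error in L1. *)
Lemma continuous_approx_L2 D f : measurable D -> (mu D < +oo)%E -> sqint D f ->
  forall e : R, 0 < e -> exists g, [/\ continuous g, sqint D g &
    \int[mu]_(x in D) (f x - g x) ^+ 2 < e].
Proof.
move=> mD Doo hf e e0.
have mf : measurable_fun D f by case: hf.
have e40 : 0 < e / 4 by rewrite divr_gt0.
have [n n0 Hn] := clip_cvg mD hf e40.
have n0' := ltW n0.
have mc : measurable_fun D (clip n f) by exact: measurable_clip.
have bnd h : measurable_fun D h -> sqint D (clip n h).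
  move=> mh; have := @sqint_bounded_mul _ D (fun=> 1) (clip n h) n mD (sqint_cst 1 mD Doo) (measurable_clip n mh).
  rewrite (_ : (fun x => clip n h x * 1) = clip n h); last by apply/funext => x; rewrite mulr1.
  by apply => x _; exact: clip_bound.
have hc := bnd _ mf.
have ic := sqint_integ mD Doo hc.
have [g_ [gc gi gcv]] := approximation_continuous_integrable mD Doo ic.
move/fine_cvgP: gcv => [fg] /cvgrPdist_lt/(_ (e / (8 * n))) H.
have e8n : 0 < e / (8 * n) by rewrite divr_gt0// mulr_gt0.
have {}H := H e8n.
have [k [Hk1 Hk]] : exists k, (\int[mu]_(z in D) `|(clip n f z - g_ k z)%:E|)%E \is a fin_num /\
   `|fine 0%E - fine (\int[mu]_(z in D) `|(clip n f z - g_ k z)%:E|)%E| < e / (8 * n).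
  have : \forall k \near \oo, (\int[mu]_(z in D) `|(clip n f z - g_ k z)%:E|)%E \is a fin_num /\
   `|fine 0%E - fine (\int[mu]_(z in D) `|(clip n f z - g_ k z)%:E|)%E| < e / (8 * n).
    by near=> k; split; near: k.
  by move=> /filter_ex[k Hk]; exists k.
have mg : measurable_fun D (g_ k) by exact: integ_meas (gi k).
have hg := bnd _ mg.
exists (clip n (g_ k)); split => //; first exact: continuous_clip.
have i1 := integB mD ic (gi k).
have i2 : integ D (fun x => `|clip n f x - g_ k x|) by exact: (integrable_norm i1).
have i3 := sqint_sqr mD (sqintB mD hf hc).
have i4 : integ D (fun x => 2 * (f x - clip n f x) ^+ 2 + 4 * n * `|clip n f x - g_ k x|).
  by apply: integD => //; exact: integZ.
apply: (@le_lt_trans _ _ (\int[mu]_(x in D) (2 * (f x - clip n f x) ^+ 2 + 4 * n * `|clip n f x - g_ k x|))).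
  apply: le_Rintegral => //.
    exact: sqint_sqr (sqintB mD hf hg).
  move=> x _.
  have h1 := clip_lip n (clip n f) (g_ k) x.
  rewrite (clip_id (clip_bound f x n0')) in h1.
  have h2 := clip_bound f x n0'; have h3 := clip_bound (g_ k) x n0'.
  set u := f x - clip n f x; set v := clip n f x - clip n (g_ k) x.
  rewrite (_ : f x - _ = u + v); last by rewrite /u /v; ring.
  have hv : v ^+ 2 <= 2 * n * `|clip n f x - g_ k x|.
    rewrite -real_normK ?num_real// expr2 ler_pM//.
    by rewrite mulr2n mulrDl mul1r (le_trans (ler_normB _ _))// lerD.
  have := sqr_ge0 (u - v).
  move: hv; move: (`|_ - g_ k x|) => w; nra.
rewrite RintegralD//; [|exact: integZ|exact: integZ].
rewrite !RintegralZl//.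
move: Hk; rewrite sub0r normrN => /(le_lt_trans (ler_norm _)) Hk.
have -> : \int[mu]_(x in D) `|clip n f x - g_ k x| =
  fine (\int[mu]_(z in D) `|(clip n f z - g_ k z)%:E|)%E by [].
have : 4 * n * fine (\int[mu]_(z in D) `|(clip n f z - g_ k z)%:E|)%E < e / 2.
  rewrite -ltr_pdivlMl ?mulr_gt0// (lt_le_trans Hk)// le_eqVlt; apply/orP; left.
  by apply/eqP; field; rewrite gt_eqF.
lra.
Unshelve. all: by end_near. Qed.

Lemma sqint_bounded D f C : measurable D -> (mu D < +oo)%E ->
  measurable_fun D f -> (forall x, D x -> `|f x| <= C) -> sqint D f.
Proof.
move=> mD Doo mf fC.
have := sqint_bounded_mul mD (sqint_cst 1 mD Doo) mf fC.
by congr sqint; apply/funext => x; rewrite mulr1.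
Qed.

Lemma Rintegral_sqrD3 D f g h : measurable D -> sqint D f -> sqint D g ->
  sqint D h -> \int[mu]_(x in D) (f x + g x + h x) ^+ 2 <=
  3 * (\int[mu]_(x in D) f x ^+ 2 + \int[mu]_(x in D) g x ^+ 2 +
       \int[mu]_(x in D) h x ^+ 2).
Proof.
move=> mD hf hg hh.
have i1 := sqint_sqr mD hf; have i2 := sqint_sqr mD hg.
have i3 := sqint_sqr mD hh.
have i12 := integD mD i1 i2; have i123 := integD mD i12 i3.
rewrite -RintegralD// -RintegralD// -RintegralZl//.
apply: le_Rintegral => //.
- exact: (sqint_sqr mD (sqintD mD (sqintD mD hf hg) hh)).
- exact: integZ.
- move=> x _.
  have := sqr_ge0 (f x - g x); have := sqr_ge0 (f x - h x).
  have := sqr_ge0 (g x - h x); nra.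
Qed.

Lemma Rintegral_ge0_sub D D' f : measurable D -> measurable D' -> D' `<=` D ->
  integ D f -> (forall x, 0 <= f x) ->
  \int[mu]_(x in D') f x <= \int[mu]_(x in D) f x.
Proof.
move=> mD mD' sub intf f0.
rewrite /Rintegral fine_le//.
- by apply: integrable_fin_num => //; exact: integS sub intf.
- exact: integrable_fin_num.
- apply: ge0_subset_integral => //.
  by apply/measurable_EFinP; exact: integ_meas intf.
  by move=> x _; rewrite lee_fin.
Qed.

(** Three epsilons: f is close in L2 to a continuous g, whose translates are
    uniformly close because g is uniformly continuous on [-1, T]. *)
Lemma shift_L2_unif_continuous (T : R) f : sqint `[- 1, T] f ->
  forall e : R, 0 < e -> exists2 d : R, 0 < d &
    forall s t, 0 <= s <= T -> 0 <= t <= T -> `|s - t| < d ->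
    \int[mu]_(x in @I01 R) (f (s - x) - f (t - x)) ^+ 2 < e.
Proof.
move=> hf e e0.
have e12 : 0 < e / 12 by rewrite divr_gt0.
have mI : measurable (@I01 R) by exact: measurable_itv.
have mE : measurable `[- 1, T] by exact: measurable_itv.
have muE : (mu `[(- 1)%R, T] < +oo)%E.
  by rewrite /= lebesgue_measure_itv/=; case: ifP => _; rewrite ?ltry.
have muI : mu (@I01 R) = 1%:E.
  by rewrite /I01 lebesgue_measure_itv/= lte_fin ltr01 sube0.
have muIoo : (mu (@I01 R) < +oo)%E by rewrite /= muI ltry.
have [g [gc hg gf]] := continuous_approx_L2 mE muE hf e12.
have e13 : 0 < Num.min 1 (e / 12) by rewrite lt_min ltr01.
have [d d0 Hd] := unif_continuous_itv
   (fun x (_ : - 1 <= x <= T) e' e'0 =>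
     let: ex_intro2 r r0 H := @continuous_dist g x e' gc e'0 in
     ex_intro2 _ _ r r0 (fun y (_ : - 1 <= y <= T) => H y)) e13.
exists d => // s t s0T t0T std.
have sub r : 0 <= r <= T -> forall x, @I01 R x -> - 1 <= r - x <= T.
  move=> /andP[r0 rT] x; rewrite /I01/= in_itv/= => /andP[x0 x1].
  by apply/andP; split; lra.
have hr r k : 0 <= r <= T -> sqint `[- 1, T] k -> sqint (@I01 R) (fun x => k (r - x)).
  move=> rT hk; apply: sqintS (sqint_reflect r mE hk) => //.
    by rewrite -[X in measurable X]setTI; exact: measurable_reflect.
  by move=> x /(sub _ rT); rewrite /= in_itv.
have ir r k : 0 <= r <= T -> sqint `[- 1, T] k ->
    \int[mu]_(x in @I01 R) k (r - x) ^+ 2 <= \int[mu]_(x in `[- 1, T]) k x ^+ 2.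
  move=> rT hk.
  rewrite -(Rintegral_reflect r mE (sqint_sqr mE hk)).
  apply: (@Rintegral_ge0_sub _ _ (fun x => k (r - x) ^+ 2)) => //.
  - by rewrite -[X in measurable X]setTI; exact: measurable_reflect.
  - by move=> x /(sub _ rT); rewrite /= in_itv.
  - exact: (integ_reflect r mE (sqint_sqr mE hk)).
  - by move=> x; exact: sqr_ge0.
have hfg := sqintB mE hf hg.
have hgs := hr _ _ s0T hg; have hgt := hr _ _ t0T hg.
pose k1 x := f (s - x) - g (s - x); pose k2 x := g (s - x) - g (t - x).
pose k3 x := (- 1) * (f (t - x) - g (t - x)).
rewrite (_ : \int[mu]_(x in _) _ = \int[mu]_(x in @I01 R) (k1 x + k2 x + k3 x) ^+ 2); last first.
  by apply: eq_Rintegral => x _; rewrite /k1 /k2 /k3; congr (_ ^+ _); ring.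
have h2 : sqint (@I01 R) k2 by exact: sqintB.
apply: le_lt_trans (@Rintegral_sqrD3 _ k1 k2 k3 mI _ h2 _) _.
- exact: (hr s _ s0T hfg).
- by apply: sqintZ => //; exact: (hr t _ t0T hfg).
have b1 : \int[mu]_(x in @I01 R) k1 x ^+ 2 < e / 12.
  by apply: le_lt_trans gf; exact: (ir s _ s0T hfg).
have b3 : \int[mu]_(x in @I01 R) k3 x ^+ 2 < e / 12.
  apply: le_lt_trans gf; apply: le_trans (ir t _ t0T hfg).
  by rewrite le_eqVlt; apply/orP; left; apply/eqP/eq_Rintegral => x _; rewrite /k3; ring.
have b2 : \int[mu]_(x in @I01 R) k2 x ^+ 2 <= e / 12.
  have -> : e / 12 = \int[mu]_(x in @I01 R) (e / 12).
    by rewrite Rintegral_cst// (_ : fine _ = 1) ?mulr1//; exact: (congr1 fine muI).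
  apply: le_Rintegral => //; first exact: sqint_sqr.
    by apply: sqint_integ => //; exact: sqint_cst.
  move=> x /[dup] /(sub _ s0T) h3 /(sub _ t0T) h4.
  have := Hd _ _ h3 h4; rewrite (_ : s - x - (t - x) = s - t); last by ring.
  move=> /(_ std); rewrite lt_min -/(k2 x) => /andP[c1 c2].
  by rewrite -real_normK ?num_real// expr2 -[leRHS]mul1r ler_pM// ltW.
have sum3 (x y z : R) : x < e / 12 -> y <= e / 12 -> z < e / 12 -> 3 * (x + y + z) < e.
  by move: e0 => {}e0 ? ? ?; lra.
exact: sum3.
Qed.

End Approximation.

(** * Mild solutions and dissipative generators *)
Section RealScalars.
Variables (R : realType) (E : lmodType R[i]).

(** States form a complex vector space, but the time integrals and the energy
    only use real scalars. *)
Definition rscale (r : R) (x : E) : E := r%:C%C *: x.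

Lemma rscaleBr r x y : rscale r (x - y) = rscale r x - rscale r y.
Proof. exact: scalerBr. Qed.

Lemma rscaleA r s x : rscale r (rscale s x) = rscale (r * s) x.
Proof. by rewrite /rscale scalerA rmorphM. Qed.

Lemma rscale1 x : rscale 1 x = x.
Proof. by rewrite /rscale rmorph1 scale1r. Qed.

Lemma rscale0 x : rscale 0 x = 0.
Proof. by rewrite /rscale rmorph0 scale0r. Qed.

Lemma rscaleN1 x : rscale (- 1) x = - x.
Proof. by rewrite /rscale rmorphN rmorph1 scaleN1r. Qed.

Lemma rscale_suml (I : Type) (s : seq I) (F : I -> R) x :
  rscale (\sum_(i <- s) F i) x = \sum_(i <- s) rscale (F i) x.
Proof. by rewrite /rscale rmorph_sum scaler_suml. Qed.

End RealScalars.

Lemma subr4ACA (V : zmodType) (x y z t : V) : x - y - (z - t) = x - z - (y - t).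
Proof. by rewrite !opprB addrACA [RHS]addrACA [- y - z]addrC. Qed.

Section SemiInner.
Variables (R : realType) (E : lmodType R[i]).
Implicit Types (H : set E) (x y z : E) (r : R).

(** A real semi-inner product on the subset H of E.  Elements of E are
    representatives of functions up to null sets, whence the restriction to H
    and the absence of definiteness. *)
Record semi_inner H (b : E -> E -> R) : Prop := SemiInner {
  si_0 : H 0;
  si_HD : forall x y, H x -> H y -> H (x + y);
  si_HZ : forall r x, H x -> H (rscale r x);
  si_sym : forall x y, H x -> H y -> b x y = b y x;
  si_D : forall x y z, H x -> H y -> H z -> b (x + y) z = b x z + b y z;
  si_Z : forall r x z, H x -> H z -> b (rscale r x) z = r * b x z;
  si_ge0 : forall x, H x -> 0 <= b x x }.

Variables (H : set E) (b : E -> E -> R).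
Hypothesis hb : semi_inner H b.

Definition nrm x := Num.sqrt (b x x).

Lemma si_HN x : H x -> H (- x).
Proof. by move=> Hx; rewrite -rscaleN1; exact: si_HZ hb _ _ Hx. Qed.

Lemma si_HB x y : H x -> H y -> H (x - y).
Proof. by move=> Hx Hy; apply: si_HD hb _ _ Hx _; exact: si_HN. Qed.

Lemma si_Hsum (I : Type) (s : seq I) (F : I -> E) : (forall i, H (F i)) ->
  H (\sum_(i <- s) F i).
Proof.
move=> HF; elim: s => [|i s IH]; first by rewrite big_nil; exact: si_0 hb.
by rewrite big_cons; exact: si_HD hb _ _ _ _.
Qed.

Lemma nrm_ge0 x : 0 <= nrm x. Proof. exact: sqrtr_ge0. Qed.

Lemma sqr_nrm x : H x -> nrm x ^+ 2 = b x x.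
Proof. by move=> Hx; rewrite sqr_sqrtr//; exact: si_ge0 hb _ Hx. Qed.

Lemma si_sqrD x y : H x -> H y -> b (x + y) (x + y) = b x x + 2 * b x y + b y y.
Proof.
move=> Hx Hy; have Hxy := si_HD hb Hx Hy.
rewrite (si_D hb)// (si_sym hb Hx Hxy) (si_sym hb Hy Hxy) !(si_D hb)//.
by rewrite (si_sym hb Hy Hx); ring.
Qed.

Lemma cauchy_schwarz x y : H x -> H y -> `|b x y| <= nrm x * nrm y.
Proof.
move=> Hx Hy.
have P r : 0 <= b x x + 2 * r * b x y + r ^+ 2 * b y y.
  have Hry := si_HZ hb r Hy.
  have := si_ge0 hb (si_HD hb Hx Hry).
  rewrite si_sqrD// (si_sym hb Hx Hry) !(si_Z hb)// (si_sym hb Hy Hry) (si_Z hb)//.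
  by rewrite (si_sym hb Hy Hx) !mulrA.
have bx := si_ge0 hb Hx; have by_ := si_ge0 hb Hy.
rewrite -(ler_pXn2r (n := 2))// ?nnegrE ?mulr_ge0 ?nrm_ge0//.
rewrite real_normK ?num_real// exprMn !sqr_nrm//.
have [y0|y0] := eqVneq (b y y) 0.
  rewrite y0 mulr0 leNgt; apply/negP => s0.
  have := P (- (b x x + 1) / (2 * b x y)).
  have n0 : b x y != 0 by rewrite -sqrf_eq0 gt_eqF.
  rewrite y0 mulr0 addr0 (_ : b x x + _ = - 1); last by field.
  by rewrite lerNr oppr0 ler10.
have y1 : 0 < b y y by rewrite lt0r y0.
have := P (- (b x y) / b y y).
rewrite (_ : b x x + _ + _ = (b x x * b y y - b x y ^+ 2) / b y y); last by field.
by rewrite pmulr_lge0 ?invr_gt0// subr_ge0.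
Qed.

Lemma nrmD x y : H x -> H y -> nrm (x + y) <= nrm x + nrm y.
Proof.
move=> Hx Hy; rewrite -(ler_pXn2r (n := 2))// ?nnegrE ?addr_ge0 ?nrm_ge0//.
rewrite sqr_nrm ?si_sqrD//; last exact: si_HD hb _ _ Hx Hy.
rewrite sqrrD !sqr_nrm// lerD2r lerD2l -[leRHS]mulr_natl ler_pM2l//.
by rewrite (le_trans (ler_norm _))// cauchy_schwarz.
Qed.

Lemma nrmZ r x : H x -> nrm (rscale r x) = `|r| * nrm x.
Proof.
move=> Hx; have Hrx := si_HZ hb r Hx.
rewrite /nrm (si_Z hb)// (si_sym hb Hx Hrx) (si_Z hb)// mulrA -expr2.
by rewrite sqrtrM ?sqr_ge0// sqrtr_sqr.
Qed.

Lemma nrmN x : H x -> nrm (- x) = nrm x.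
Proof. by move=> Hx; rewrite -rscaleN1 nrmZ// normrN1 mul1r. Qed.

Lemma nrmB x y : H x -> H y -> nrm (x - y) <= nrm x + nrm y.
Proof.
by move=> Hx Hy; rewrite -(nrmN Hy); apply: nrmD => //; exact: si_HN.
Qed.

Lemma nrm_distC x y : H x -> H y -> nrm (x - y) = nrm (y - x).
Proof. by move=> Hx Hy; rewrite -nrmN ?opprB//; exact: si_HB. Qed.

Lemma nrm0 : nrm 0 = 0.
Proof.
by rewrite -(rscale0 0) nrmZ ?normr0 ?mul0r//; exact: si_0 hb.
Qed.

Lemma nrm_sum (I : Type) (s : seq I) (F : I -> E) : (forall i, H (F i)) ->
  nrm (\sum_(i <- s) F i) <= \sum_(i <- s) nrm (F i).
Proof.
move=> HF; elim: s => [|i s IH]; first by rewrite !big_nil nrm0.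
rewrite !big_cons (le_trans (nrmD _ _)) ?lerD2l//; exact: si_Hsum.
Qed.

Lemma nrm_dist_le x y : H x -> H y -> nrm x <= nrm y + nrm (x - y).
Proof.
move=> Hx Hy; rewrite -{1}(subrK y x) addrC; apply: nrmD => //; exact: si_HB.
Qed.

(** Cauchy-Schwarz: b does not see the vectors of norm 0. *)
Lemma si_null x y z : H x -> H y -> H z -> nrm (x - y) = 0 -> b x z = b y z.
Proof.
move=> Hx Hy Hz xy; rewrite -{1}(subrK y x) (si_D hb)//; last exact: si_HB.
rewrite (_ : b (x - y) z = 0) ?add0r//; apply/eqP.
rewrite -normr_eq0 eq_le normr_ge0 andbT.
by rewrite (le_trans (cauchy_schwarz _ Hz)) ?xy ?mul0r//; exact: si_HB.
Qed.

End SemiInner.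

Section Mild.
Variables (R : realType) (E : lmodType R[i]).
Implicit Types (Z : R -> E) (Y W x : E) (t : R).

Definition tagged_integral (N : E -> R) Z t Y :=
  forall eps : R, 0 < eps -> exists2 delta : R, 0 < delta &
    forall (n : nat) (s xi : nat -> R), s 0%N = 0 -> s n = t ->
      (forall i, (i < n)%N ->
         s i <= xi i <= s i.+1 /\ s i.+1 - s i < delta) ->
      N (\sum_(i < n) (s i.+1 - s i)%:C%C *: Z (xi i) - Y) < eps.

(** Integrated solutions of Z' = Op Z for the seminorm N; the last equation is
    an equality of classes, not of representatives. *)
Record mildsol (H : set E) (N : E -> R) (Op : E -> E -> Prop) Z : Prop := MildSol {
  ms_H : forall t, 0 <= t -> H (Z t);
  ms_cont : forall t, 0 <= t -> forall e : R, 0 < e -> exists2 d : R, 0 < d &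
     forall s, 0 <= s -> `|s - t| < d -> N (Z s - Z t) < e;
  ms_int : forall t, 0 <= t -> exists Y W,
     [/\ H Y, H W, tagged_integral N Z t Y & Op Y W] /\ N (Z t - (Z 0 + W)) = 0 }.

Variables (H : set E) (b : E -> E -> R).
Hypothesis hb : semi_inner H b.
Local Notation N := (nrm b).

(** Refining a partition of [0, t1] by one of [t1, t2] compares the two
    integrals, up to the increment over [t1, t2].  Hence the primitive of a
    continuous path is differentiable. *)
Lemma tagged_integral_increment Z t1 t2 Y1 Y2 x (e : R) :
  (forall t, 0 <= t -> H (Z t)) -> 0 <= t1 -> t1 <= t2 -> H Y1 -> H Y2 -> H x ->
  tagged_integral N Z t1 Y1 -> tagged_integral N Z t2 Y2 ->
  (forall s, t1 <= s <= t2 -> N (Z s - x) <= e) ->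
  N (Y2 - Y1 - rscale (t2 - t1) x) <= (t2 - t1) * e.
Proof.
move=> HZ t10 t12 HY1 HY2 Hx I1 I2 Ze.
apply/ler_addgt0Pr => eta eta0.
have eta2 : 0 < eta / 2 by rewrite divr_gt0.
have [d1 d10 H1] := I1 _ eta2; have [d2 d20 H2] := I2 _ eta2.
pose d := Num.min d1 d2.
have d0 : 0 < d by rewrite lt_min d10.
have t21 : 0 <= t2 - t1 by rewrite subr_ge0.
pose n := (Num.truncn (Num.max t1 (t2 - t1) / d)).+1.
have n0 : 0 < n%:R :> R by rewrite ltr0n.
have small r : 0 <= r -> r <= Num.max t1 (t2 - t1) -> r / n%:R < d.
  move=> r0 rm; rewrite ltr_pdivrMr// mulrC -ltr_pdivrMr//.
  apply: le_lt_trans (truncnS_gt _); rewrite ler_pM2r ?invr_gt0//.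
have s1 : t1 / n%:R < d by apply: small => //; rewrite le_max lexx.
have s2 : (t2 - t1) / n%:R < d by apply: small => //; rewrite le_max lexx orbT.
pose s (i : nat) : R := if (i <= n)%N then t1 / n%:R * i%:R
   else t1 + (t2 - t1) / n%:R * (i - n)%:R.
have sn : s n = t1 by rewrite /s leqnn divfK// gt_eqF.
have s00 : s 0%N = 0 by rewrite /s /= mulr0.
have snk k : s (n + k)%N = t1 + (t2 - t1) / n%:R * k%:R.
  case: k => [|k]; first by rewrite addn0 sn mulr0 addr0.
  by rewrite /s -{2}(addn0 n) leq_add2l ltn0 addKn.
have snn : s (n + n)%N = t2 by rewrite snk divfK ?gt_eqF// subrKC.
have D1 i : (i < n)%N -> s i.+1 - s i = t1 / n%:R.
  by move=> ni; rewrite /s ni (ltnW ni) -natr1; ring.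
have D2 k : s (n + k).+1 - s (n + k)%N = (t2 - t1) / n%:R.
  by rewrite -addnS !snk -natr1; ring.
have tn0 : 0 <= t1 / n%:R by rewrite divr_ge0// ltW.
have tn1 : 0 <= (t2 - t1) / n%:R by rewrite divr_ge0// ltW.
have J1 := H1 n s s s00 sn; have J2 := H2 (n + n)%N s s s00 snn.
have {}J1 : N (\sum_(i < n) (s i.+1 - s i)%:C%C *: Z (s i) - Y1) < eta / 2.
  apply: J1 => i ni; rewrite lexx -subr_ge0 D1//; split => //.
  by rewrite (lt_le_trans s1)// ge_min lexx.
have {}J2 : N (\sum_(i < n + n) (s i.+1 - s i)%:C%C *: Z (s i) - Y2) < eta / 2.
  apply: J2 => i ni; have [ni'|ni'] := ltnP i n.
    rewrite lexx -subr_ge0 D1//; split => //.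
    by rewrite (lt_le_trans s1)// ge_min lexx orbT.
  rewrite -(subnKC ni') lexx -subr_ge0 D2; split => //.
  by rewrite (lt_le_trans s2)// ge_min lexx orbT.
pose S1 := \sum_(i < n) (s i.+1 - s i)%:C%C *: Z (s i).
pose S2 := \sum_(i < n) rscale ((t2 - t1) / n%:R) (Z (s (n + i)%N)).
have ES : \sum_(i < n + n) (s i.+1 - s i)%:C%C *: Z (s i) = S1 + S2.
  rewrite big_split_ord/=; congr (_ + _).
  by apply: eq_bigr => i _; rewrite D2.
have s_ge0 i : 0 <= s i.
  rewrite /s; case: ifP => _; first by rewrite mulr_ge0.
  by rewrite addr_ge0// mulr_ge0.
have HS1 : H S1 by apply: (si_Hsum hb) => i; apply: (si_HZ hb); exact: HZ.
have HS2 : H S2 by apply: (si_Hsum hb) => i; apply: (si_HZ hb); exact: HZ.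
pose S3 := \sum_(i < n) rscale ((t2 - t1) / n%:R) (Z (s (n + i)%N) - x).
have S3E : S3 = S2 - rscale (t2 - t1) x.
  rewrite /S3 /S2; under eq_bigr do rewrite rscaleBr.
  rewrite big_split/= sumrN; congr (_ - _).
  rewrite -rscale_suml sumr_const card_ord; congr rscale.
  by rewrite -[LHS]mulr_natr divfK// gt_eqF.
have HS3 : H S3.
  rewrite S3E; apply: (si_HB hb) => //; exact: si_HZ hb _ _ Hx.
have HX := si_HZ hb (t2 - t1) Hx.
have H1' := si_HB hb HS1 HY1.
have H2' := si_HB hb (si_HD hb HS1 HS2) HY2.
have -> : Y2 - Y1 - rscale (t2 - t1) x = S3 + ((S1 - Y1) - (S1 + S2 - Y2)).
  rewrite S3E (subr4ACA S1) (opprD S1 S2) (addrA S1) subrr add0r opprB.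
  by rewrite addrACA subrr add0r addrC.
apply: le_trans (nrmD hb HS3 (si_HB hb H1' H2')) _; apply: lerD.
  apply: le_trans (nrm_sum hb _ _) _.
    by move=> i; apply: (si_HZ hb); apply: (si_HB hb) => //; exact: HZ.
  apply: (@le_trans _ _ (\sum_(i < n) (t2 - t1) / n%:R * e)); last first.
    by rewrite sumr_const card_ord -[leLHS]mulr_natr mulrAC divfK ?gt_eqF.
  apply: ler_sum => i _; rewrite (nrmZ hb); last first.
    by apply: (si_HB hb) => //; exact: HZ.
  rewrite ger0_norm// ler_wpM2l// Ze// snk lerDl mulr_ge0//=.
  rewrite -lerBrDl -[leRHS](divfK (lt0r_neq0 n0)) ler_wpM2l// ler_nat.
  exact: ltnW.
apply: le_trans (nrmB hb H1' H2') _.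
rewrite [eta]splitr; apply: lerD; apply: ltW => //.
by move: J2; rewrite ES.
Qed.

Lemma mildsolB Op Z Z' :
  (forall Y W Y' W', Op Y W -> Op Y' W' -> Op (Y - Y') (W - W')) ->
  mildsol H N Op Z -> mildsol H N Op Z' -> mildsol H N Op (fun t => Z t - Z' t).
Proof.
move=> OpB mZ mZ'.
have HZ t : 0 <= t -> H (Z t) := ms_H mZ (t := t).
have HZ' t : 0 <= t -> H (Z' t) := ms_H mZ' (t := t).
split.
- by move=> t t0; apply: (si_HB hb); [exact: HZ|exact: HZ'].
- move=> t t0 e e0; have e2 : 0 < e / 2 by rewrite divr_gt0.
  have [d d0 Hd] := ms_cont mZ t0 e2; have [d' d'0 Hd'] := ms_cont mZ' t0 e2.
  exists (Num.min d d') => [|s s0]; first by rewrite lt_min d0.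
  rewrite lt_min => /andP[h1 h2].
  rewrite subr4ACA.
  apply: le_lt_trans (nrmB hb (si_HB hb (HZ _ s0) (HZ _ t0)) (si_HB hb (HZ' _ s0) (HZ' _ t0))) _.
  by rewrite [e]splitr ltrD ?Hd ?Hd'.
- move=> t t0.
  have [Y [W [[HY HW IY OY] N0]]] := ms_int mZ t0.
  have [Y' [W' [[HY' HW' IY' OY'] N0']]] := ms_int mZ' t0.
  exists (Y - Y'), (W - W'); split; [split|].
  + exact: (si_HB hb).
  + exact: (si_HB hb).
  + move=> e e0; have e2 : 0 < e / 2 by rewrite divr_gt0.
    have [d d0 Hd] := IY _ e2; have [d' d'0 Hd'] := IY' _ e2.
    exists (Num.min d d') => [|n s xi s0 st sxi]; first by rewrite lt_min d0.
    have {}Hd := Hd n s xi s0 st; have {}Hd' := Hd' n s xi s0 st.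
    have {}Hd : N (\sum_(i < n) (s i.+1 - s i)%:C%C *: Z (xi i) - Y) < e / 2.
      apply: Hd => i ni; have [h1 h2] := sxi i ni; split => //.
      by rewrite (lt_le_trans h2)// ge_min lexx.
    have {}Hd' : N (\sum_(i < n) (s i.+1 - s i)%:C%C *: Z' (xi i) - Y') < e / 2.
      apply: Hd' => i ni; have [h1 h2] := sxi i ni; split => //.
      by rewrite (lt_le_trans h2)// ge_min lexx orbT.
    under eq_bigr do rewrite scalerBr.
    rewrite big_split/= sumrN subr4ACA.
    have sge0 i : (i <= n)%N -> 0 <= s i.
      elim: i => [|i IH] i_n; first by rewrite s0.
      have [/andP[h1 h2] _] := sxi i i_n.
      by rewrite (le_trans (IH (ltnW i_n)))// (le_trans h1).
    have xige0 (i : 'I_n) : 0 <= xi i.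
      have [/andP[h1 h2] _] := sxi i (ltn_ord i).
      by rewrite (le_trans (sge0 i (ltnW (ltn_ord i)))).
    apply: le_lt_trans (nrmB hb _ _) _.
    * apply: (si_HB hb) => //; apply: (si_Hsum hb) => i; apply: (si_HZ hb).
      exact: HZ.
    * apply: (si_HB hb) => //; apply: (si_Hsum hb) => i; apply: (si_HZ hb).
      exact: HZ'.
    * by rewrite [e]splitr ltrD.
  + exact: OpB.
  + apply/eqP; rewrite eq_le nrm_ge0 andbT.
    rewrite (_ : _ - _ = (Z t - (Z 0 + W)) - (Z' t - (Z' 0 + W'))); last first.
      by rewrite [RHS]subr4ACA; congr (_ - _); rewrite opprD addrACA.
    apply: le_trans (nrmB hb _ _) _.
    * by apply: (si_HB hb); [exact: HZ|apply: (si_HD hb) => //; exact: HZ].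
    * by apply: (si_HB hb); [exact: HZ'|apply: (si_HD hb) => //; exact: HZ'].
    * by rewrite N0 N0' addr0.
Qed.

Section Decay.
Variables (Op : E -> E -> Prop) (lam : R) (Z : R -> E).
Hypothesis OpB : forall Y W Y' W', Op Y W -> Op Y' W' -> Op (Y - Y') (W - W').
Hypothesis OpD : forall Y W, H Y -> H W -> Op Y W -> b W Y <= - lam * b Y Y.
Hypothesis lam0 : 0 <= lam.
Hypothesis mZ : mildsol H N Op Z.

Let HZ t : 0 <= t -> H (Z t) := ms_H mZ (t := t).

Let exYW t : exists YW : E * E, 0 <= t ->
  [/\ H YW.1, H YW.2, tagged_integral N Z t YW.1 & Op YW.1 YW.2] /\
  N (Z t - (Z 0 + YW.2)) = 0.
Proof.
have [t0|t0] := leP 0 t; last by exists (0, 0).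
by have [Y [W h]] := ms_int mZ t0; exists (Y, W).
Qed.

Let Y t := (projT1 (cid (exYW t))).1.
Let W t := (projT1 (cid (exYW t))).2.

Let YWP t : 0 <= t -> [/\ H (Y t), H (W t), tagged_integral N Z t (Y t) & Op (Y t) (W t)] /\
  N (Z t - (Z 0 + W t)) = 0.
Proof. by rewrite /Y /W; case: cid. Qed.

Let HY t : 0 <= t -> H (Y t). Proof. by move=> /YWP[[]]. Qed.
Let HW t : 0 <= t -> H (W t). Proof. by move=> /YWP[[]]. Qed.

(** Y is differentiable with derivative Z: apply tagged_integral_increment on
    either side of t. *)
Let incr t (e : R) : 0 < t -> 0 < e -> exists2 d : R, 0 < d &
  forall k, `|k| < d -> 0 < t + k /\ N (Y (t + k) - Y t - rscale k (Z t)) <= `|k| * e.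
Proof.
move=> t0 e0; have [d d0 Hd] := ms_cont mZ (ltW t0) e0.
exists (Num.min d t) => [|k]; first by rewrite lt_min d0.
rewrite lt_min => /andP[kd]; rewrite ltr_norml => /andP[kt _].
have tk : 0 < t + k by lra.
have near s : `|s - t| <= `|k| -> 0 <= s -> N (Z s - Z t) <= e.
  by move=> h s0; apply/ltW/Hd => //; exact: le_lt_trans kd.
split => //; have [k0|k0] := leP 0 k.
  have h : t <= t + k by rewrite lerDl.
  have := tagged_integral_increment (e := e) HZ (ltW t0) h (HY (ltW t0)) (HY (ltW tk)) (HZ (ltW t0)).
  have [[_ _ I1 _] _] := YWP (ltW t0); have [[_ _ I2 _] _] := YWP (ltW tk).
  rewrite (_ : t + k - t = k); last by ring.
  rewrite ger0_norm//; apply => // s /andP[h1 h2]; apply: near.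
    by rewrite !ger0_norm// ?subr_ge0//; lra.
  by rewrite (le_trans _ h1)// ltW.
have h : t + k <= t by lra.
have := tagged_integral_increment (e := e) HZ (ltW tk) h (HY (ltW tk)) (HY (ltW t0)) (HZ (ltW t0)).
have [[_ _ I1 _] _] := YWP (ltW t0); have [[_ _ I2 _] _] := YWP (ltW tk).
rewrite (_ : t - (t + k) = - k); last by ring.
rewrite ltr0_norm// => /(_ I2 I1) h3.
have HkZ := si_HZ hb k (HZ (ltW t0)).
have HYY := si_HB hb (HY (ltW tk)) (HY (ltW t0)).
rewrite -(nrmN hb (si_HB hb HYY HkZ)).
rewrite (_ : - _ = Y t - Y (t + k) - rscale (- k) (Z t)); last first.
  by rewrite -(mulN1r k) -rscaleA rscaleN1 opprK !opprB addrC.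
apply: h3 => s /andP[h1 h2]; apply: near; last by rewrite (le_trans _ h1)// ltW.
by rewrite ler0_norm ?subr_le0// ltr0_norm//; lra.
Qed.

Section Window.
Variable h : R.
Hypothesis h0 : 0 < h.

Let U t := Y (t + h) - Y t.
Let D t := Z (t + h) - Z t.
Let v t := b (U t) (U t).

Let HU t : 0 <= t -> H (U t).
Proof. by move=> t0; apply: (si_HB hb); apply: HY => //; rewrite addr_ge0// ltW. Qed.
Let HD t : 0 <= t -> H (D t).
Proof. by move=> t0; apply: (si_HB hb); apply: HZ => //; rewrite addr_ge0// ltW. Qed.

Let U_incr t (e : R) : 0 < t -> 0 < e -> exists2 d : R, 0 < d &
  forall k, `|k| < d -> 0 < t + k /\ N (U (t + k) - U t - rscale k (D t)) <= `|k| * e.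
Proof.
move=> t0 e0; have e2 : 0 < e / 2 by rewrite divr_gt0.
have th0 : 0 < t + h by rewrite addr_gt0.
have [d1 d10 H1] := incr t0 e2; have [d2 d20 H2] := incr th0 e2.
exists (Num.min d1 d2) => [|k]; first by rewrite lt_min d10.
rewrite lt_min => /andP[/H1[tk k1] /H2[thk k2]]; split => //.
rewrite (_ : U _ - _ - _ = (Y (t + h + k) - Y (t + h) - rscale k (Z (t + h)))
   - (Y (t + k) - Y t - rscale k (Z t))); last first.
  by rewrite /U /D rscaleBr (addrAC t k) (subr4ACA (Y (t + h + k))); exact: subr4ACA.
have HkZ1 := si_HZ hb k (HZ (ltW t0)); have HkZ2 := si_HZ hb k (HZ (ltW th0)).
apply: le_trans (nrmB hb _ _) _.
- by apply: (si_HB hb) => //; apply: (si_HB hb); apply: HY; exact: ltW.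
- by apply: (si_HB hb) => //; apply: (si_HB hb); apply: HY; exact: ltW.
- lra.
Qed.

(** The energy of the window U t = Y (t + h) - Y t is differentiable, with the
    derivative suggested by U' = D, because U_incr bounds the remainder. *)
Let v_derive t : 0 < t -> is_derive t 1 v (2 * b (D t) (U t)).
Proof.
move=> t0; have HUt := HU (ltW t0); have HDt := HD (ltW t0).
have key : h1^-1 *: (v (h1 *: 1 + t) - v t) @[h1 --> 0^'] --> 2 * b (D t) (U t).
  apply/cvgrPdist_le => e e0.
  pose nU := N (U t); pose nD := N (D t).
  have nU0 : 0 <= nU := nrm_ge0 _ _; have nD0 : 0 <= nD := nrm_ge0 _ _.
  have q1 : 0 < e / (4 * (nU + 1)) by rewrite divr_gt0// mulr_gt0//; lra.
  pose e1 := Num.min 1 (e / (4 * (nU + 1))).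
  have e10 : 0 < e1 by rewrite lt_min ltr01.
  have [d d0 Hd] := U_incr t0 e10.
  have q2 : 0 < e / (2 * (nD + 1) ^+ 2).
    by rewrite divr_gt0// mulr_gt0// exprn_gt0//; lra.
  have : 0 < Num.min d (e / (2 * (nD + 1) ^+ 2)) by rewrite lt_min d0.
  move=> r0; apply/nbhs_ballP; exists (Num.min d (e / (2 * (nD + 1) ^+ 2))) => //=.
  move=> k; rewrite /ball/= sub0r normrN lt_min => /andP[kd ke] k0.
  have nk0 : 0 < `|k| by rewrite normr_gt0.
  rewrite /GRing.scale/= mulr1 (addrC k t).
  have [tk Hk] := Hd _ kd.
  set rho := U (t + k) - U t - rscale k (D t) in Hk.
  have HkD := si_HZ hb k HDt.
  have Hrho : H rho.
    by apply: (si_HB hb) => //; apply: (si_HB hb) => //; apply: HU; exact: ltW.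
  have HkDr := si_HD hb HkD Hrho.
  have UE : U (t + k) = U t + (rscale k (D t) + rho).
    by rewrite [rscale _ _ + rho]addrC /rho subrK [RHS]addrC subrK.
  have vE : v (t + k) - v t = 2 * k * b (D t) (U t) +
      (2 * b rho (U t) + b (rscale k (D t) + rho) (rscale k (D t) + rho)).
    rewrite /v UE (si_sqrD hb)// (si_sym hb HUt HkDr) (si_D hb)// (si_Z hb)//.
    by ring.
  rewrite vE.
  rewrite (_ : _ - _ = - (k^-1 * (2 * b rho (U t) +
     b (rscale k (D t) + rho) (rscale k (D t) + rho)))); last by field.
  rewrite normrN normrM normfV ler_pdivrMl// (le_trans (ler_normD _ _))//.
  rewrite normrM (ger0_norm (ler0n R 2)) (ger0_norm (si_ge0 hb HkDr)).
  have b1 : `|b rho (U t)| <= `|k| * (e / 4).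
    apply: le_trans (cauchy_schwarz hb Hrho HUt) _.
    apply: (@le_trans _ _ (`|k| * e1 * nU)); first by rewrite ler_wpM2r.
    rewrite -mulrA ler_wpM2l//.
    apply: (@le_trans _ _ (e / (4 * (nU + 1)) * nU)).
      by rewrite ler_wpM2r// ge_min lexx orbT.
    rewrite mulrAC ler_pdivrMr; last by rewrite mulr_gt0//; lra.
    rewrite (_ : e / 4 * (4 * (nU + 1)) = e * (nU + 1)); last by field.
    by rewrite ler_pM2l//; lra.
  have b2 : b (rscale k (D t) + rho) (rscale k (D t) + rho) <= `|k| * (e / 2).
    rewrite -(sqr_nrm hb)//.
    have n1 : N (rscale k (D t) + rho) <= `|k| * (nD + 1).
      apply: le_trans (nrmD hb HkD Hrho) _; rewrite (nrmZ hb)// mulrDr lerD2l.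
      by apply: le_trans Hk _; rewrite ler_wpM2l// ge_min lexx.
    apply: (@le_trans _ _ ((`|k| * (nD + 1)) ^+ 2)).
      by rewrite lerXn2r ?nnegrE ?nrm_ge0// mulr_ge0//; lra.
    rewrite exprMn expr2 -mulrA ler_wpM2l//.
    move: ke; rewrite ltr_pdivlMr; last by rewrite mulr_gt0// exprn_gt0//; lra.
    by lra.
  have -> : `|k| * e = 2 * (`|k| * (e / 4)) + `|k| * (e / 2) by field.
  by apply: lerD => //; rewrite ler_wpM2l.
apply: DeriveDef; first by apply/cvg_ex; exists (2 * b (D t) (U t)).
exact/cvg_lim.
Qed.

(** The increment D of Z agrees up to a null vector with the increment of W,
    that is, with the image of U under the generator. *)
Let v_diss t : 0 < t -> 2 * b (D t) (U t) <= - (2 * lam) * v t.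
Proof.
move=> t0; have th0 : 0 < t + h by rewrite addr_gt0.
have [[HY1 HW1 _ O1] N1] := YWP (ltW t0); have [[HY2 HW2 _ O2] N2] := YWP (ltW th0).
have HZ0 := HZ (lexx 0); have HZ1 := HZ (ltW t0); have HZ2 := HZ (ltW th0).
have HUt := HU (ltW t0); have HDt := HD (ltW t0).
have HWW := si_HB hb HW2 HW1.
rewrite (si_null hb HDt HWW HUt).
  rewrite mulNr -mulrA -mulrN ler_pM2l// -mulNr.
  by apply: OpD => //; exact: OpB.
apply/eqP; rewrite eq_le nrm_ge0 andbT.
rewrite (_ : _ - _ = (Z (t + h) - (Z 0 + W (t + h))) - (Z t - (Z 0 + W t))); last first.
  by rewrite [RHS]subr4ACA; congr (_ - _); rewrite opprD addrACA subrr add0r.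
apply: le_trans (nrmB hb _ _) _.
- by apply: (si_HB hb) => //; exact: (si_HD hb).
- by apply: (si_HB hb) => //; exact: (si_HD hb).
- by rewrite N1 N2 addr0.
Qed.

(** Gronwall for the energy of the window.  It starts at some tau > 0 since
    differentiability is only available at interior times. *)
Lemma window_decay (tau t : R) : 0 < tau -> tau <= t ->
  N (U t) <= expR (- lam * (t - tau)) * N (U tau).
Proof.
move=> tau0 taut; have t0 : 0 < t by exact: lt_le_trans taut.
pose g s := expR (2 * lam * s) * v s.
have dg (s : R) : 0 < s -> is_derive s 1 g
   (expR (2 * lam * s) * (2 * b (D s) (U s)) + v s * (2 * lam * expR (2 * lam * s))).
  move=> s0; have dv := v_derive s0.
  have de : is_derive s 1 (fun s => expR (2 * lam * s)) (2 * lam * expR (2 * lam * s)).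
    have dl : is_derive s 1 (fun s : R => 2 * lam * s) (2 * lam).
      have := is_deriveZ (2 * lam) (is_derive_id s (1 : R)).
      by rewrite /GRing.scale/= mulr1.
    by apply: is_derive_eq (is_derive1_comp (is_derive_expR _) dl) _; exact: mulrC.
  have -> : g = (fun s => expR (2 * lam * s)) * v by [].
  exact: is_derive_eq (is_deriveM de dv) _.
have := @ler0_derive1_nincry R g tau.
move=> /(_ _ _ _ tau t (lexx _) taut) H1.
have {}H1 : g t <= g tau.
  apply: H1.
  - move=> s; rewrite in_itv/= andbT => ts; have s0 := lt_trans tau0 ts.
    by have [] := dg s s0.
  - move=> s; rewrite in_itv/= andbT => ts; have s0 := lt_trans tau0 ts.
    have [_ dE] := dg s s0; rewrite derive1E dE.
    have := v_diss s0; have := expR_ge0 (2 * lam * s).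
    move: (expR _) => w w0 h1; nra.
  - apply: derivable_within_continuous => s; rewrite in_itv/= andbT => ts.
    by have := dg s (lt_le_trans tau0 ts) => -[].
have E2 s : expR (lam * s) ^+ 2 = expR (2 * lam * s).
  by rewrite expr2 -expRD; congr expR; ring.
have H2 : expR (lam * t) * N (U t) <= expR (lam * tau) * N (U tau).
  rewrite -(ler_pXn2r (n := 2))// ?nnegrE ?mulr_ge0 ?expR_ge0 ?nrm_ge0//.
  by rewrite !exprMn !E2 !(sqr_nrm hb)//; apply: HU; exact: ltW.
rewrite mulrBr expRB mulrAC mulNr expRN mulNr expRN invrK.
by rewrite -mulrA [N (U tau) * _]mulrC ler_pdivlMl ?expR_gt0.
Qed.

End Window.

(** Divide the decay of the windows Y (t + h) - Y t by h: for small h both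
    sides are close to the norms of Z, and tau = q is close to 0. *)
Theorem mild_decay t : 0 <= t -> N (Z t) <= expR (- lam * t) * N (Z 0).
Proof.
move=> t0; have [->|tn0] := eqVneq t 0; first by rewrite mulr0 expR0 mul1r.
have {t0 tn0}t0 : 0 < t by rewrite lt0r tn0.
set E0 := expR (- lam * t); set A := N (Z 0).
have E01 : 0 <= E0 <= 1.
  by rewrite expR_ge0/= -expR0 ler_expR mulNr oppr_le0 mulr_ge0// ltW.
have A0 : 0 <= A := nrm_ge0 _ _.
have main e : 0 < e -> e <= 1 -> N (Z t) <= E0 * A + e * (A + 5).
  move=> e0 e1.
  have [d d0 Hd] := ms_cont mZ (lexx 0) e0.
  have [r r0 Hr] := @continuous_dist R expR 0 e (@continuous_expR R) e0.
  pose q := Num.min (d / 2) (Num.min t (r / (2 * (lam + 1)))).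
  have l1 : 0 < 2 * (lam + 1) by rewrite mulr_gt0// ltr_wpDl.
  have q0 : 0 < q by rewrite !lt_min divr_gt0// t0 divr_gt0.
  have qt : q <= t by rewrite !ge_min lexx !orbT.
  have qd : q < d.
    have : q <= d / 2 by rewrite ge_min lexx.
    by lra.
  have qr : lam * q < r.
    have : q <= r / (2 * (lam + 1)) by rewrite !ge_min lexx !orbT.
    rewrite ler_pdivlMr// => h; nra.
  have Eq : expR (lam * q) <= 1 + e.
    have := Hr (lam * q); rewrite sub0r normrN ger0_norm; last by rewrite mulr_ge0// ltW.
    by rewrite expR0 => /(_ qr); rewrite ltr_norml => /andP[? ?]; lra.
  have [d1 d10 H1] := incr t0 e0; have [d2 d20 H2] := incr q0 e0.
  pose h := Num.min d1 d2 / 2.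
  have m0 : 0 < Num.min d1 d2 by rewrite lt_min d10.
  have h0 : 0 < h by rewrite divr_gt0.
  have hm : `|h| < Num.min d1 d2 by rewrite gtr0_norm// /h; lra.
  move: (hm); rewrite lt_min => /andP[/H1[th K1] /H2[qh K2]].
  rewrite gtr0_norm// in K1 K2.
  have HZt := HZ (ltW t0); have HZq := HZ (ltW q0).
  have HUt := si_HB hb (HY (ltW th)) (HY (ltW t0)).
  have HUq := si_HB hb (HY (ltW qh)) (HY (ltW q0)).
  have HhZt := si_HZ hb h HZt; have HhZq := si_HZ hb h HZq.
  have K3 : h * N (Z t) <= N (Y (t + h) - Y t) + h * e.
    have -> : h * N (Z t) = N (rscale h (Z t)) by rewrite (nrmZ hb)// gtr0_norm.
    apply: le_trans (nrm_dist_le hb HhZt HUt) _; rewrite lerD2l.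
    by rewrite (nrm_distC hb).
  have K4 : N (Y (q + h) - Y q) <= h * N (Z q) + h * e.
    have -> : h * N (Z q) = N (rscale h (Z q)) by rewrite (nrmZ hb)// gtr0_norm.
    by apply: le_trans (nrm_dist_le hb HUq HhZq) _; rewrite lerD2l.
  have K5 : N (Z q) <= A + e.
    have := nrm_dist_le hb HZq (HZ (lexx 0)).
    have := Hd _ (ltW q0); rewrite subr0 gtr0_norm// => /(_ qd).
    by rewrite -/A; lra.
  have K6 := window_decay h0 q0 qt.
  have K7 : expR (- lam * (t - q)) <= E0 * (1 + e).
    rewrite (_ : - lam * (t - q) = - lam * t + lam * q); last by ring.
    by rewrite expRD ler_wpM2l// expR_ge0.
  have K8 : 0 <= expR (- lam * (t - q)) := expR_ge0 _.
  have K9 := nrm_ge0 b (Y (q + h) - Y q).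
  move/andP: E01 => [E00 E01].
  have K10 : N (Y (t + h) - Y t) <= E0 * (1 + e) * (h * (A + e) + h * e).
    apply: le_trans K6 _; apply: ler_pM => //.
    by apply: le_trans K4 _; rewrite lerD2r ler_wpM2l// ltW.
  have K11 : h * N (Z t) <= h * (E0 * (1 + e) * (A + e + e) + e).
    apply: le_trans K3 _.
    apply: (@le_trans _ _ (E0 * (1 + e) * (h * (A + e) + h * e) + h * e)).
      by rewrite lerD2r.
    by rewrite le_eqVlt; apply/orP; left; apply/eqP; ring.
  move: K11; rewrite ler_pM2l// => K11; apply: le_trans K11 _.
  have : E0 * (e * (A + 2 * (1 + e))) <= e * (A + 2 * (1 + e)).
    rewrite ler_piMl// mulr_ge0 ?ltW//; lra.
  nra.
apply/ler_addgt0Pr => e e0.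
pose e' := Num.min 1 (e / (A + 5)).
have A5 : 0 < A + 5 by lra.
have e'0 : 0 < e' by rewrite lt_min ltr01 divr_gt0.
apply: le_trans (main e' e'0 _) _; first by rewrite ge_min lexx.
rewrite lerD2l -ler_pdivlMr//; by rewrite ge_min lexx orbT.
Qed.

End Decay.
End Mild.

(** * Waves on (0,1) coupled to scalars *)
Section UnitInterval.
Variable R : realType.
Local Notation mu := (@lebesgue_measure R).
Implicit Types (f g : R -> R).

Lemma measurable_I01 : measurable (@I01 R).
Proof. exact: measurable_itv. Qed.

Lemma lebesgue_measure_I01 : mu (@I01 R) = 1%:E.
Proof. by rewrite /I01 lebesgue_measure_itv/= lte_fin ltr01 sube0. Qed.

Lemma finite_I01 : (mu (@I01 R) < +oo)%E.
Proof. by rewrite /= lebesgue_measure_I01 ltry. Qed.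

Lemma sub_I01_itv (x y : R) : 0 <= x -> y <= 1 -> `]x, y[%classic `<=` @I01 R.
Proof. by move=> x0 y1; apply: subset_itv; rewrite bnd_simp. Qed.

Lemma integ_I01_cc f : integ (@I01 R) f <-> integ `[0, 1] f.
Proof.
split => intf; last first.
  by apply: integS intf; [exact: measurable_itv..|exact: subset_itv_oo_cc].
have mf : measurable_fun (@I01 R) f by exact: integ_meas intf.
have mf' : measurable_fun (`[0, 1] : set R) f by apply: measurable_fun_itv_cc mf.
apply: integP => //; rewrite integral_itv_bndoo; first by case/integrableP: intf.
exact/measurable_EFinP/measurableT_comp.
Qed.

Lemma sqint_I01_cc f : sqint (@I01 R) f <-> sqint `[0, 1] f.
Proof.
split => hf; last first.
  by apply: sqintS hf; [exact: measurable_itv..|exact: subset_itv_oo_cc].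
apply: sqintP => //; last by apply/integ_I01_cc; exact: (sqint_sqr measurable_I01).
by case: hf => mf _; apply: measurable_fun_itv_cc mf.
Qed.

Lemma Rintegral_I01_cc f : measurable_fun (@I01 R) f ->
  \int[mu]_(x in @I01 R) f x = \int[mu]_(x in `[0, 1]) f x.
Proof.
move=> mf; congr fine; rewrite [RHS]integral_itv_bndoo//.
exact/measurable_EFinP.
Qed.

Lemma Rintegral_itv_oo (x y : R) f : measurable_fun (`]x, y[ : set R) f ->
  \int[mu]_(t in `[x, y]) f t = \int[mu]_(t in `]x, y[) f t.
Proof.
move=> mf; congr fine; apply: (@integral_itv_bndoo R x y (EFin \o f) true false).
exact/measurable_EFinP.
Qed.

Lemma Rintegral_itv_ae (x : R) f g : 0 <= x <= 1 -> measurable_fun (@I01 R) f ->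
  measurable_fun (@I01 R) g -> {ae mu, forall x, @I01 R x -> f x = g x} ->
  \int[mu]_(y in `[0, x]) f y = \int[mu]_(y in `[0, x]) g y.
Proof.
move=> /andP[x0 x1] mf mg fg.
have sub : `]0, x[%classic `<=` @I01 R by exact: sub_I01_itv.
have mx : measurable (`]0, x[ : set R) by exact: measurable_itv.
have mf' : measurable_fun (`]0, x[ : set R) f := measurable_funS measurable_I01 sub mf.
have mg' : measurable_fun (`]0, x[ : set R) g := measurable_funS measurable_I01 sub mg.
rewrite !Rintegral_itv_oo//; apply: ae_eq_Rintegral => //.
by apply: ae_sub fg => y h /sub; exact: h.
Qed.

Lemma primitive_01_ae f g F : measurable_fun (@I01 R) f ->
  measurable_fun (@I01 R) g -> {ae mu, forall x, @I01 R x -> f x = g x} ->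
  primitive_on 0 1 f F -> primitive_on 0 1 g F.
Proof.
move=> mf mg fg Ff x x01; rewrite (Ff x x01); congr (_ + _).
exact: Rintegral_itv_ae fg.
Qed.

Lemma primitive_sqint f F : integ (@I01 R) f -> primitive_on 0 1 f F ->
  sqint (@I01 R) F.
Proof.
move=> /integ_I01_cc intf Ff.
apply: (sqint_bounded measurable_I01 finite_I01).
  apply: measurable_funS (primitive_measurable ler01 intf Ff).
    exact: measurable_itv.
  exact: subset_itv_oo_cc.
move=> x; rewrite /I01/= in_itv/= => /andP[x0 x1].
by apply: (primitive_bounded ler01 intf Ff); rewrite !ltW.
Qed.

(** The weight x |-> r - s * x turns the energy flux of a transported profile
    into boundary terms minus s times the norm of the profile. *)
Lemma weighted_flux (r s : R) f F : sqint (@I01 R) f -> primitive_on 0 1 f F ->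
  2 * \int[mu]_(x in @I01 R) ((r - s * x) * (F x * f x)) =
  (r - s) * F 1 ^+ 2 - r * F 0 ^+ 2 + s * \int[mu]_(x in @I01 R) F x ^+ 2.
Proof.
move=> hf Ff.
have mI := measurable_I01.
have mJ : measurable (`[0, 1] : set R) by exact: measurable_itv.
have iI := sqint_integ mI finite_I01 hf.
have iJ := (integ_I01_cc f).1 iI.
have cs (c : R) : integ `[0, 1] (fun=> c).
  by apply/integ_I01_cc; exact: (sqint_integ mI finite_I01 (sqint_cst _ mI finite_I01)).
have pr : primitive_on 0 1 (fun=> - s) (fun x => r - s * x).
  move=> x /andP[x0 x1]; rewrite Rintegral_cst; last exact: measurable_itv.
  rewrite /= lebesgue_measure_itv/= lte_fin; case: ltP => x0'.
    by rewrite sube0/=; ring.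
  have x00 : x = 0 by lra.
  by rewrite x00 (_ : fine _ = 0)//; ring.
have prF := primitive_onM ler01 (cs (- s)) iJ pr Ff.
have irF : integ `[0, 1] (fun x => (r - s * x) * f x + F x * (- s)).
  apply: integD => //; first exact: (integ_mul_primitive ler01 (cs (- s)) pr iJ).
  exact: (integ_mul_primitive ler01 iJ Ff (cs (- s))).
have := by_parts ler01 irF iJ prF Ff.
have hF := primitive_sqint iI Ff.
have m1 : measurable_fun (@I01 R) F by case: hF.
have m2 : measurable_fun (@I01 R) f by case: hf.
have mr : measurable_fun (@I01 R) (fun x => r - s * x).
  by apply: measurable_funB => //; exact: measurable_funM.
rewrite -Rintegral_I01_cc; last first.
  apply: measurable_funD; apply: measurable_funM => //; first exact: measurable_funM.
  by apply: measurable_funD; exact: measurable_funM.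
have i1 : integ (@I01 R) (fun x => (r - s * x) * (F x * f x)).
  apply/integ_I01_cc.
  apply: (integ_mul_primitive ler01 (cs (- s)) pr).
  exact: (integ_mul_primitive ler01 iJ Ff iJ).
have i2 : integ (@I01 R) (fun x => F x ^+ 2) by exact: sqint_sqr.
rewrite (_ : \int[mu]_(x in _) _ = \int[mu]_(x in @I01 R)
   (2 * ((r - s * x) * (F x * f x)) - s * F x ^+ 2)); last first.
  by apply: eq_Rintegral => x _; ring.
rewrite RintegralB//; [|exact: integZ|exact: integZ].
rewrite !RintegralZl// mulr0 subr0 mulr1 => h.
lra.
Qed.

End UnitInterval.

Section Transport.
Variables (R : realType) (k l : nat).
Local Notation mu := (@lebesgue_measure R).
Local Notation I01 := (@I01 R).
Variables (M : 'I_k -> 'I_k -> R) (P : 'I_k -> 'I_l -> R).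
Variables (K : 'I_l -> R) (J : 'I_l -> 'I_k -> R).

(** Generator of the coupled system: k profiles carried from 0 to 1 at unit
    speed, reinjected at 0 through M and P, drive the l scalars z through J.  As w j
    is only known almost everywhere, boundary values are those of its
    absolutely continuous representative v j. *)
Definition transport_op (w : 'I_k -> R -> R) (z : 'I_l -> R)
    (w' : 'I_k -> R -> R) (z' : 'I_l -> R) : Prop :=
  exists v : 'I_k -> R -> R,
  [/\ forall j, {ae mu, forall x, I01 x -> w j x = v j x},
      forall j, primitive_on 0 1 (fun x => - w' j x) (v j),
      forall j, v j 0 = \sum_i M j i * v i 1 + \sum_i P j i * z i &
      forall i, z' i = K i * z i + \sum_j J i j * v j 1].

Variables (r s : 'I_k -> R) (c : 'I_l -> R).

Definition weighted_form (w w' : 'I_k -> R -> R) (z z' : 'I_l -> R) : R :=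
  \sum_j \int[mu]_(x in I01) ((r j - s j * x) * (w j x * w' j x)) +
  \sum_i c i * (z i * z' i).

Lemma weight_integ j (f g : R -> R) : sqint I01 f -> sqint I01 g ->
  integ I01 (fun x => (r j - s j * x) * (f x * g x)).
Proof.
move=> hf hg; have mI := @measurable_I01 R.
have h1 : sqint I01 (fun x => (r j - s j * x) * f x).
  apply: (@sqint_bounded_mul _ _ _ _ (`|r j| + `|s j|)) => //.
    by apply: measurable_funB => //; exact: measurable_funM.
  move=> x; rewrite /Defs.I01/= in_itv/= => /andP[x0 x1].
  rewrite (le_trans (ler_normB _ _))// lerD2l normrM (gtr0_norm x0).
  by rewrite ler_piMr// ltW.
have := sqintM mI h1 hg.
by congr integ; apply/funext => x; rewrite mulrA.
Qed.

(** Exact balance of the weighted form along the flow; e collects the values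
    at the outflow boundary. *)
Lemma transport_balance w z w' z' :
  (forall j, sqint I01 (w j)) -> (forall j, sqint I01 (w' j)) ->
  transport_op w z w' z' -> exists e : 'I_k -> R,
  [/\ 2 * weighted_form w' w z' z =
       \sum_j (r j * (\sum_i M j i * e i + \sum_i P j i * z i) ^+ 2 - (r j - s j) * e j ^+ 2)
       - \sum_j s j * \int[mu]_(x in I01) w j x ^+ 2 + \sum_i 2 * c i * z i * z' i,
      forall i, z' i = K i * z i + \sum_j J i j * e j &
      forall j, \int[mu]_(x in I01) w' j x =
        \sum_i M j i * e i + \sum_i P j i * z i - e j].
Proof.
move=> hw hw' [v [wv vw' v0 z'E]].
have mI := @measurable_I01 R.
have iw' j := sqint_integ mI (@finite_I01 R) (hw' j).
have iN j : integ I01 (fun x => - w' j x).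
  have := integZ (- 1) mI (iw' j).
  by congr integ; apply/funext => x; rewrite mulN1r.
have hv j : sqint I01 (v j) by apply: primitive_sqint (vw' j).
have hNw' j : sqint I01 (fun x => - w' j x).
  have := sqintZ (- 1) mI (hw' j).
  by congr sqint; apply/funext => x; rewrite mulN1r.
have mw j : measurable_fun I01 (w j) by case: (hw j).
have mw' j : measurable_fun I01 (w' j) by case: (hw' j).
have mv j : measurable_fun I01 (v j) by case: (hv j).
have mr j : measurable_fun I01 (fun x => r j - s j * x).
  by apply: measurable_funB => //; exact: measurable_funM.
have E2 j : \int[mu]_(x in I01) v j x ^+ 2 = \int[mu]_(x in I01) w j x ^+ 2.
  apply: ae_eq_Rintegral => //; try exact: measurable_funX.
  by apply: ae_sub (wv j) => x h Ix; rewrite h.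
have E1 j : 2 * \int[mu]_(x in I01) ((r j - s j * x) * (w' j x * w j x)) =
   r j * v j 0 ^+ 2 - (r j - s j) * v j 1 ^+ 2 - s j * \int[mu]_(x in I01) w j x ^+ 2.
  rewrite (@ae_eq_Rintegral _ _ _ (fun x => (- 1) * ((r j - s j * x) * (v j x * (- w' j x)))))//; last 3 first.
  - by do 2! apply: measurable_funM => //.
  - apply: measurable_funM => //; apply: measurable_funM => //.
    by apply: measurable_funM => //; exact: (hNw' j).1.
  - by apply: ae_sub (wv j) => x h Ix; rewrite h//; ring.
  rewrite RintegralZl//; last exact: weight_integ.
  by rewrite mulrCA (weighted_flux (r j) (s j) (hNw' j) (vw' j)) -E2; ring.
exists (fun j => v j 1); split => // [|j].
  rewrite /weighted_form mulrDr !mulr_sumr -sumrB; congr (_ + _).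
    by apply: eq_bigr => j _; rewrite E1 v0.
  by apply: eq_bigr => i _; ring.
have z01 : 0 <= (1 : R) <= 1 by rewrite ler01 lexx.
have := vw' j 1 z01; rewrite -Rintegral_I01_cc; last exact: (hNw' j).1.
rewrite -v0 (_ : \int[mu]_(x in _) - _ = - \int[mu]_(x in I01) w' j x); first by move=> ->; ring.
rewrite -mulN1r -RintegralZl//; last exact: iw'.
by apply: eq_Rintegral => x _; rewrite mulN1r.
Qed.

End Transport.

(** * Delay equations for the signals *)
Section Calculus.
Variable R : realType.
Local Notation mu := (@lebesgue_measure R).
Implicit Types (D : set R) (f g F : R -> R).

Lemma C1_primitive_on (a b : R) f F : continuous f ->
  (forall x, derivable F x 1) -> (forall x, derive1 F x = f x) -> primitive_on a b f F.
Proof.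
move=> cf dF F'f x /andP[ax xb].
have [->|xa] := eqVneq x a.
  by rewrite set_itv1 Rintegral_set1 addr0.
have {}ax : a < x by rewrite lt_neqAle eq_sym xa.
have cF y : F z @[z --> y] --> F y.
  exact/differentiable_continuous/derivable1_diffP.
rewrite /Rintegral (@continuous_FTC2 _ f F a x ax) /=.
- by rewrite subrKC.
- exact: continuous_subspaceT.
- split; first by move=> y _.
  + exact: cvg_at_right_filter.
  + exact: cvg_at_left_filter.
- by move=> y _; rewrite F'f.
Qed.

Lemma sqint_patch D E f : measurable D -> measurable E -> sqint D f ->
  sqint E (f \_ D).
Proof.
move=> mD mE hf.
have mf : measurable_fun setT (f \_ D).
  by apply/(measurable_restrictT _ mD); case: hf.
apply: sqintP => //; first exact: measurable_funTS.
apply: (@integS _ setT) => //.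
have := (integ_mkcond _ mD).1 (sqint_sqr mD hf).
congr integ; apply/funext => x; rewrite !patchE.
by case: ifP => // _; rewrite expr0n.
Qed.

Lemma sqint_eq D f g : (forall x, D x -> f x = g x) -> measurable D ->
  sqint D f -> sqint D g.
Proof.
move=> fg mD hf; apply: sqint_ae (hf) => //; last exact: aeW.
by apply: eq_measurable_fun (hf.1) => x /set_mem; exact: fg.
Qed.

Lemma sqint_delay (T : R) f : sqint `[- 1, T] f -> sqint `[0, T + 1] (fun x => f (x - 1)).
Proof.
move=> hf; have mT : measurable (`[- 1, T] : set R) by exact: measurable_itv.
have h1 := sqint_reflect 0 mT hf.
have m1 : measurable [set x : R | `[- 1, T]%classic (0 - x)].
  by rewrite -[X in measurable X]setTI; exact: measurable_reflect.
have := sqint_reflect 1 m1 h1.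
rewrite (_ : [set x | _] = `[0, T + 1]%classic); last first.
  by apply/seteqP; split => x /=; rewrite !in_itv/= => /andP[? ?]; apply/andP; split; lra.
by congr sqint; apply/funext => x; congr f; ring.
Qed.

Lemma finite_itv (a b : R) : (mu `[a, b] < +oo)%E.
Proof. by rewrite /= lebesgue_measure_itv/=; case: ifP => _; rewrite ?ltry// -EFinD ltry. Qed.

Lemma continuous_sqint_itv (a b : R) f : {within `[a, b], continuous f} ->
  sqint `[a, b] f.
Proof.
move=> cf; have mf : measurable_fun `[a, b] f.
  by apply: subspace_continuous_measurable_fun.
have /compact_bounded[C [_ HC]] := continuous_compact cf (@segment_compact R a b).
apply: (@sqint_bounded _ _ _ (`|C| + 1)) => //; first exact: finite_itv.
by move=> x xab; apply: HC; [rewrite ltr_pwDr// ler_norm|exists x].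
Qed.

End Calculus.

Section Delay.
Variables (R : realType) (k l : nat).
Local Notation mu := (@lebesgue_measure R).
Local Notation I01 := (@I01 R).
Variables (M : 'I_k -> 'I_k -> R) (P : 'I_k -> 'I_l -> R).
Variables (K : 'I_l -> R) (J : 'I_l -> 'I_k -> R).

(** Signals start at time -1: their values on (-1, 0) are the initial profiles
    read backwards. *)
Definition loc_sqint (f : R -> R) := forall T : R, sqint `[- 1, T] f.

Section Data.
Variables (w0 : 'I_k -> R -> R) (z0 : 'I_l -> R).
Hypothesis hw0 : forall j, sqint I01 (w0 j).

(** Variation of constants for z' = K z + J W(. - 1). *)
Definition scalars (W : 'I_k -> R -> R) (i : 'I_l) (t : R) : R :=
  expR (K i * t) * (z0 i + \int[mu]_(r in `[0, t])
     (expR (- K i * r) * \sum_j J i j * W j (r - 1))).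

(** One step of the fixed point iteration.  The value at t only involves W up to
    t - 1, whose values have left the interval at time t. *)
Definition advance (W : 'I_k -> R -> R) (j : 'I_k) (t : R) : R :=
  if t < 0 then (if - 1 < t then w0 j (- t) else 0)
  else \sum_i M j i * W i (t - 1) + \sum_i P j i * scalars W i t.

Definition iterate n := iter n advance (fun _ _ => 0).

Lemma scalars_causal W W' (n : R) : (forall j t, t < n -> W j t = W' j t) ->
  forall i t, t < n + 1 -> scalars W i t = scalars W' i t.
Proof.
move=> WW' i t tn; rewrite /scalars; congr (_ * (_ + _)).
apply: eq_Rintegral => r; rewrite inE/= in_itv/= => /andP[r0 rt]; congr (_ * _).
by apply: eq_bigr => j _; rewrite WW'//; lra.
Qed.

Lemma advance_causal W W' (n : R) : (forall j t, t < n -> W j t = W' j t) ->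
  forall j t, t < n + 1 -> advance W j t = advance W' j t.
Proof.
move=> WW' j t tn; rewrite /advance; case: ifP => // _; congr (_ + _).
  by apply: eq_bigr => i _; rewrite WW'//; lra.
by apply: eq_bigr => i _; rewrite (scalars_causal WW').
Qed.

(** Because of the delay, the n-th iterate is already the solution up to time
    n - 1, so the iteration stabilizes on bounded time intervals. *)
Lemma iterate_causal n m : (n <= m)%N -> forall j t, t < n%:R - 1 ->
  iterate m j t = iterate n j t.
Proof.
elim: n m => [|n IH] m nm j t tn.
  rewrite sub0r in tn; case: m nm => [//|m] _.
  by rewrite /iterate iterS /advance (lt_trans tn)// ltNge ltW.
case: m nm => // m nm; rewrite /iterate !iterS.
apply: (@advance_causal _ _ (n%:R - 1)).
  by move=> j' t' t'n; exact: IH.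
by rewrite subrK; move: tn; rewrite -natr1 addrK.
Qed.

(** The limit of the iteration; by causality, finitely many steps depending on
    t compute the value at t. *)
Definition signal (j : 'I_k) (t : R) : R := iterate (Num.truncn `|t|).+2 j t.

Lemma signalE n j t : t < n%:R - 1 -> signal j t = iterate n j t.
Proof.
move=> tn; rewrite /signal; set q := _.+2.
have tq : t < q%:R - 1.
  rewrite /q -natr1 addrK (le_lt_trans (ler_norm t))//; exact: truncnS_gt.
have [nq|/ltnW qn] := leqP n q; first exact: iterate_causal.
by rewrite (iterate_causal qn).
Qed.

Lemma exists_bound (t : R) : exists n : nat, t < n%:R - 1.
Proof.
exists (Num.truncn `|t|).+2.
by rewrite -natr1 addrK (le_lt_trans (ler_norm t))//; exact: truncnS_gt.
Qed.

Lemma signal_fixpoint j t : advance signal j t = signal j t.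
Proof.
have [n tn] := exists_bound t.
rewrite (@signalE n.+1); last by rewrite -natr1 addrK (lt_trans tn)// gtrBl.
rewrite /iterate iterS; apply: (@advance_causal _ _ (n%:R - 1)).
  by move=> j' t' t'n; exact: signalE.
by rewrite subrK (lt_trans tn)// gtrBl.
Qed.

Section Scalars.
Variable W : 'I_k -> R -> R.
Hypothesis hW : forall j, loc_sqint (W j).
Variable i : 'I_l.

Lemma forcing_sqint (T : R) : sqint `[0, T] (fun r => \sum_j J i j * W j (r - 1)).
Proof.
apply: sqint_sum => //; first exact: finite_itv.
move=> j; apply: sqintZ => //.
by have := sqint_delay (hW j (T - 1)); rewrite subrK.
Qed.

(** Product rule for the exponential and the integral of the forcing. *)
Lemma scalars_primitive (T : R) : 0 <= T ->
  primitive_on 0 T (fun r => K i * scalars W i r + \sum_j J i j * W j (r - 1)) (scalars W i).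
Proof.
move=> T0.
pose kf r := \sum_j J i j * W j (r - 1).
have mT : measurable (`[0, T] : set R) by exact: measurable_itv.
have cexp (a : R) : continuous (fun r : R => expR (a * r)).
  move=> x; apply: (@continuous_comp _ _ _ (fun r => a * r) expR).
    exact: mulrl_continuous.
  exact: continuous_expR.
have ik : integ `[0, T] (fun r => expR (- K i * r) * kf r).
  apply: sqintM => //; last exact: forcing_sqint.
  by apply: continuous_sqint_itv; apply: continuous_subspaceT.
have iE : integ `[0, T] (fun r => K i * expR (K i * r)).
  apply: integZ => //; apply: sqint_integ => //; first exact: finite_itv.
  by apply: continuous_sqint_itv; apply: continuous_subspaceT.
pose G t := z0 i + \int[mu]_(r in `[0, t]) (expR (- K i * r) * kf r).
have prG : primitive_on 0 T (fun r => expR (- K i * r) * kf r) G.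
  by move=> x x0T; rewrite /G set_itv1 Rintegral_set1 addr0.
have prE : primitive_on 0 T (fun r => K i * expR (K i * r)) (fun r => expR (K i * r)).
  have dE (x : R) : is_derive x 1 (fun r : R => expR (K i * r)) (K i * expR (K i * x)).
    have dl : is_derive x 1 (fun s : R => K i * s) (K i).
      have := is_deriveZ (K i) (is_derive_id x (1 : R)).
      by rewrite /GRing.scale/= mulr1.
    by apply: is_derive_eq (is_derive1_comp (is_derive_expR _) dl) _; exact: mulrC.
  apply: C1_primitive_on.
  - by move=> x; apply: cvgM; [exact: cvg_cst|exact: cexp].
  - by move=> x; have [] := dE x.
  - by move=> x; rewrite derive1E; have [_ ->] := dE x.
have := primitive_onM T0 iE ik prE prG.
rewrite (_ : (fun x => _ + _) = (fun r => K i * scalars W i r + kf r))//.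
apply/funext => x; rewrite /scalars -/(kf _) /G mulNr.
have e0 : expR (K i * x) != 0 by rewrite gt_eqF ?expR_gt0.
by rewrite expRN mulrA mulfV// mul1r addrC; congr (_ + _); ring.
Qed.

Lemma scalars_sqint (T : R) : 0 <= T -> sqint `[0, T] (scalars W i).
Proof.
move=> T0; apply: continuous_sqint_itv.
have mT : measurable (`[0, T] : set R) by exact: measurable_itv.
rewrite /scalars => x.
have ik : integ `[0, T] (fun r => expR (- K i * r) * \sum_j J i j * W j (r - 1)).
  apply: sqintM => //; last exact: forcing_sqint.
  apply: continuous_sqint_itv; apply: continuous_subspaceT => y.
  apply: (@continuous_comp _ _ _ (fun r => - K i * r) expR).
    exact: mulrl_continuous.
  exact: continuous_expR.
apply: cvgM.
  apply: (@continuous_subspaceT _ _ _ (fun r : R => expR (K i * r))) => y.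
  apply: (@continuous_comp _ _ _ (fun r => K i * r) expR).
    exact: mulrl_continuous.
  exact: continuous_expR.
apply: cvgD; first exact: cvg_cst.
exact: (parameterized_integral_continuous T0 ik).
Qed.

End Scalars.

Lemma advance_sqint W : (forall j, loc_sqint (W j)) ->
  forall j, loc_sqint (advance W j).
Proof.
move=> hW j T.
have mI : measurable (`]- 1, 0[ : set R) by exact: measurable_itv.
have mT : measurable (`[- 1, T] : set R) by exact: measurable_itv.
have mT0 : measurable (`[0, T] : set R) by exact: measurable_itv.
have h1 : sqint `]- 1, 0[ (fun t => w0 j (- t)).
  have := sqint_reflect 0 (@measurable_I01 R) (hw0 j).
  rewrite (_ : [set x | _] = `]- 1, 0[%classic); last first.
    by apply/seteqP; split => x; rewrite /Defs.I01/= !in_itv/= => /andP[? ?]; apply/andP; split; lra.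
  by congr sqint; apply/funext => x; rewrite sub0r.
have h2 : sqint `[0, T] (fun t => \sum_i M j i * W i (t - 1) + \sum_i P j i * scalars W i t).
  have [T0|T0] := leP 0 T; last first.
    by rewrite set_itv_ge; [split; [exact: measurable_fun_set0|rewrite integral_set0]|rewrite bnd_simp -ltNge].
  apply: sqintD => //; apply: sqint_sum => //; try exact: finite_itv.
    move=> i; apply: sqintZ => //.
    by have := sqint_delay (hW i (T - 1)); rewrite subrK.
  by move=> i; apply: sqintZ => //; exact: scalars_sqint.
have := sqintD mT (sqint_patch mI mT h1) (sqint_patch mT0 mT h2).
apply: sqint_eq => // t; rewrite /= in_itv/= => /andP[t1 tT].
rewrite /advance !patchE !mem_setE !in_itv/= tT andbT.
have p0 : (point : R) = 0 by [].
rewrite [0 <= t]leNgt; case: (ltP t 0) => t0 /=; rewrite ?andbT ?andbF.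
  by case: ifP => _; exact: addr0.
exact: add0r.
Qed.

Lemma iterate_sqint n j : loc_sqint (iterate n j).
Proof.
elim: n j => [|n IH] j.
  by move=> T; apply: sqint_cst => //; exact: finite_itv.
by rewrite /iterate iterS; exact: advance_sqint.
Qed.

Lemma signal_sqint j : loc_sqint (signal j).
Proof.
move=> T; have [n Tn] := exists_bound T.
have := iterate_sqint n j T; apply: sqint_eq => //.
move=> t; rewrite /= in_itv/= => /andP[_ tT].
by rewrite (@signalE n)// (le_lt_trans tT).
Qed.

Lemma signal_past j x : I01 x -> signal j (- x) = w0 j x.
Proof.
rewrite /Defs.I01/= in_itv/= => /andP[x0 x1].
by rewrite -signal_fixpoint /advance ltrN2 x1 opprK oppr_lt0 x0.
Qed.

Lemma signal_delay j t : 0 <= t -> signal j t =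
  \sum_i M j i * signal i (t - 1) + \sum_i P j i * scalars signal i t.
Proof. by move=> t0; rewrite -[LHS]signal_fixpoint /advance ltNge t0. Qed.

Lemma scalars0 W i : scalars W i 0 = z0 i.
Proof. by rewrite /scalars set_itv1 Rintegral_set1 addr0 mulr0 expR0 mul1r. Qed.

End Data.
End Delay.

(** * Time integrals of orbits as limits of Riemann sums *)
Section Shifts.
Variable R : realType.
Local Notation mu := (@lebesgue_measure R).
Local Notation I01 := (@I01 R).
Implicit Types (f : R -> R).

Lemma Rintegral_shift (c a b : R) f : integ `[a, b] f ->
  \int[mu]_(x in `[a + c, b + c]) f (x - c) = \int[mu]_(x in `[a, b]) f x.
Proof.
move=> hf; have mT : measurable (`[a, b] : set R) by exact: measurable_itv.
have h1 := integ_reflect 0 mT hf.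
have m1 : measurable [set x : R | `[a, b]%classic (0 - x)].
  by rewrite -[X in measurable X]setTI; exact: measurable_reflect.
rewrite -(Rintegral_reflect 0 mT hf) -(Rintegral_reflect c m1 h1).
rewrite (_ : [set x | _] = `[a + c, b + c]%classic); last first.
  by apply/seteqP; split => x /=; rewrite !in_itv/= => /andP[? ?]; apply/andP; split; lra.
by apply: eq_Rintegral => x _; congr f; ring.
Qed.

Lemma sub_shift_I01 (t T x : R) : 0 <= t <= T -> I01 x -> - 1 <= t - x <= T.
Proof.
move=> /andP[t0 tT]; rewrite /Defs.I01/= in_itv/= => /andP[x0 x1].
by apply/andP; split; lra.
Qed.

Lemma profile_sqint (t T : R) f : 0 <= t <= T -> sqint `[- 1, T] f ->
  sqint I01 (fun x => f (t - x)).
Proof.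
move=> tT hf; have mE : measurable (`[- 1, T] : set R) by exact: measurable_itv.
apply: sqintS (sqint_reflect t mE hf) => //; last first.
- by move=> x /(sub_shift_I01 tT); rewrite /= in_itv.
- exact: measurable_I01.
- by rewrite -[X in measurable X]setTI; exact: measurable_reflect.
Qed.

Lemma sqint_translate (x T : R) f : 0 <= x <= 1 -> sqint `[- 1, T] f ->
  sqint `[0, T] (fun r => f (r - x)).
Proof.
move=> /andP[x0 x1] hf; have mE : measurable (`[- 1, T] : set R) by exact: measurable_itv.
have m2 : measurable [set y : R | `[- 1, T]%classic (0 - y)].
  by rewrite -[X in measurable X]setTI; exact: measurable_reflect.
have m3 : measurable [set z : R | [set y : R | `[- 1, T]%classic (0 - y)] (x - z)].
  by rewrite -[X in measurable X]setTI; exact: measurable_reflect.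
have : sqint `[0, T] (fun r => f (0 - (x - r))).
  apply: sqintS (sqint_reflect x m2 (sqint_reflect 0 mE hf)) => // r /=.
  by rewrite !in_itv/= => /andP[? ?]; apply/andP; split; lra.
by congr sqint; apply/funext => r; congr f; ring.
Qed.

(** Integrating over (0,1) first, by Tonelli, exchanges a distance in L2 of
    profiles for an integral over time. *)
Lemma tonelli_shift f (T c d xi e : R) : 0 <= c -> c <= d -> d <= T ->
  0 <= xi <= T -> sqint `[- 1, T] f ->
  (forall r, c <= r <= d -> \int[mu]_(x in I01) (f (xi - x) - f (r - x)) ^+ 2 <= e) ->
  integ I01 (fun x => \int[mu]_(r in `[c, d]) (f (xi - x) - f (r - x)) ^+ 2) /\
  \int[mu]_(x in I01) \int[mu]_(r in `[c, d]) (f (xi - x) - f (r - x)) ^+ 2 <= (d - c) * e.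
Proof.
move=> c0 cd dT xiT hf He.
have mE : measurable (`[- 1, T] : set R) by exact: measurable_itv.
have mI := @measurable_I01 R.
have mcd : measurable (`[c, d] : set R) by exact: measurable_itv.
pose ft := f \_ `[- 1, T].
have mft : measurable_fun setT ft by apply/(measurable_restrictT _ mE); case: hf.
have ftE r x : 0 <= r <= T -> I01 x -> ft (r - x) = f (r - x).
  by move=> rT Ix; rewrite /ft patchE mem_set//= in_itv/=; exact: sub_shift_I01.
have cT r : c <= r <= d -> 0 <= r <= T by move=> /andP[? ?]; apply/andP; split; lra.
pose g (p : R * R) : R := \1_I01 p.1 * (\1_(`[c, d]%classic) p.2 * (ft (xi - p.1) - ft (p.2 - p.1)) ^+ 2).
have mg : measurable_fun setT g.
  apply: measurable_funM; first exact: measurableT_comp (measurable_indic mI) _.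
  apply: measurable_funM; first exact: measurableT_comp (measurable_indic mcd) _.
  apply: measurable_funX; apply: measurable_funB.
    apply: measurableT_comp => //.
    exact: measurable_funB.
  apply: measurableT_comp => //; exact: measurable_funB.
have g0 p : 0 <= g p.
  have i0 (A : set R) (x : R) : 0 <= \1_A x :> R by rewrite indicE ler0n.
  exact: mulr_ge0 (i0 _ _) (mulr_ge0 (i0 _ _) (sqr_ge0 _)).
have mgE : measurable_fun setT (fun p => (g p)%:E) by exact/measurable_EFinP.
have g0E p : (0 <= (g p)%:E)%E by rewrite lee_fin.
pose h x := \int[mu]_(r in `[c, d]) (f (xi - x) - f (r - x)) ^+ 2.
have hE x : (\int[mu]_r (g (x, r))%:E)%E = ((h \_ I01) x)%:E.
  rewrite patchE; case: ifPn => Ix; last first.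
    by rewrite integral0_eq// => r _; rewrite /g/= indicE (negbTE Ix) mul0r.
  have Ix' := set_mem Ix.
  have sq : sqint `[c, d] (fun r => f (xi - x) - f (r - x)).
    apply: sqintB => //; first by apply: sqint_cst => //; exact: finite_itv.
    move: Ix'; rewrite /Defs.I01/= in_itv/= => /andP[x0 x1].
    have x01 : 0 <= x <= 1 by rewrite !ltW.
    apply: sqintS (sqint_translate x01 hf) => //.
  rewrite /h /Rintegral fineK; last exact: integrable_fin_num (sqint_sqr mcd sq).
  rewrite [RHS]integral_mkcond; apply: eq_integral => r _; rewrite /g/= patchE.
  rewrite indicE Ix mul1r indicE; case: ifPn => [rcd|_]; last by rewrite mul0r.
  rewrite mul1r; congr EFin; move: rcd; rewrite inE/= in_itv/= => /cT rT.
  by rewrite !ftE.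
have mh : measurable_fun setT (fun x => ((h \_ I01) x)%:E).
  under eq_fun do rewrite -hE.
  exact: (@measurable_fun_fubini_tonelli_F _ _ _ _ _ mu (fun p => (g p)%:E)).
have h0 x : 0 <= h x by apply: Rintegral_ge0 => r _; exact: sqr_ge0.
have bound : (\int[mu]_x ((h \_ I01) x)%:E <= ((d - c) * e)%:E)%E.
  under eq_integral do rewrite -hE.
  rewrite (@fubini_tonelli _ _ _ _ _ mu mu (fun p => (g p)%:E))//.
  apply: (@le_trans _ _ (\int[mu]_(r in `[c, d]) (cst e%:E r))%E).
    rewrite [leRHS]integral_mkcond; apply: ge0_le_integral => //.
    - by move=> r _; apply: integral_ge0 => x _; rewrite lee_fin.
    - exact: (@measurable_fun_fubini_tonelli_G _ _ _ _ _ mu (fun p => (g p)%:E)).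
    - by apply/(measurable_restrictT _ mcd).
    - move=> r _; rewrite patchE; case: ifPn => rcd; last first.
        by rewrite integral0_eq// => x _; rewrite /g/= !indicE (negbTE rcd) mul0r mulr0.
      move: (rcd); rewrite inE/= in_itv/= => rcd'; have rT := cT r rcd'.
      have sq : sqint I01 (fun x => f (xi - x) - f (r - x)).
        by apply: sqintB => //; exact: profile_sqint hf.
      have := He r rcd'; rewrite -lee_fin; apply: le_trans.
      rewrite /Rintegral fineK; last exact: integrable_fin_num (sqint_sqr mI sq).
      rewrite le_eqVlt; apply/orP; left; apply/eqP.
      rewrite [RHS]integral_mkcond; apply: eq_integral => x _; rewrite /g/= patchE.
      rewrite !indicE rcd mul1r; case: ifPn => [Ix|_]; last by rewrite mul0r.
      by rewrite mul1r; have Ix' := set_mem Ix; rewrite !ftE.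
  rewrite le_eqVlt; apply/orP; left; apply/eqP.
  apply: eq_trans (@integral_cst _ _ _ mu _ mcd e%:E) _.
  have muE : mu `[c, d] = (d - c)%:E.
    rewrite /= lebesgue_measure_itv/= lte_fin; case: ltP => // dc.
    by rewrite (_ : d = c) ?subrr//; apply/eqP; rewrite eq_le dc.
  by apply: eq_trans (congr1 (fun y => e%:E * y)%E muE) _; rewrite -EFinM mulrC.
have ih : integ I01 h.
  apply/(integ_mkcond _ mI); apply: integP; first exact/measurable_EFinP.
  rewrite (_ : (\int[mu]_x _)%E = \int[mu]_x ((h \_ I01) x)%:E)%E.
    by rewrite (le_lt_trans bound)// ltry.
  by apply: eq_integral => x _; rewrite ger0_norm// patchE; case: ifP.
split => //; rewrite Rintegral_mkcond -lee_fin /Rintegral fineK//.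
exact: (integrable_fin_num measurableT ((integ_mkcond h mI).1 ih)).
Qed.

(** The induction step of the Cauchy-Schwarz inequality for sums. *)
Lemma sqrD_le_prod (A a T B d b : R) : 0 <= T -> 0 <= B -> 0 <= d -> 0 <= b ->
  A ^+ 2 <= T * B -> a ^+ 2 <= d * b -> (A + a) ^+ 2 <= (T + d) * (B + b).
Proof.
move=> T0 B0 d0 b0 HA Ha.
have H : 2 * (A * a) <= T * b + d * B.
  apply: le_trans (ler_norm _) _.
  rewrite -(ler_pXn2r (n := 2))// ?nnegrE ?addr_ge0 ?mulr_ge0//.
  rewrite real_normK ?num_real// !exprMn.
  have := ler_pM (sqr_ge0 A) (sqr_ge0 a) HA Ha.
  have := sqr_ge0 (T * b - d * B); nra.
rewrite sqrrD; nra.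
Qed.

(** Discretization error of a Riemann sum, by Cauchy-Schwarz over the whole
    interval. *)
Lemma Riemann_sum_sqr f (t : R) (n : nat) (s xi : nat -> R) : s 0%N = 0 -> s n = t ->
  (forall i, (i < n)%N -> s i <= xi i <= s i.+1) -> sqint `[0, t] f ->
  (\sum_(i < n) (s i.+1 - s i) * f (xi i) - \int[mu]_(r in `[0, t]) f r) ^+ 2 <=
  t * \sum_(i < n) \int[mu]_(r in `[s i, s i.+1]) (f (xi i) - f r) ^+ 2.
Proof.
move=> s0 sn sxi hf.
have mono i : (i < n)%N -> s i <= s i.+1.
  by move=> /sxi/andP[h1]; exact: le_trans.
have sge m : (m <= n)%N -> 0 <= s m.
  elim: m => [|m IH] mn; first by rewrite s0.
  by rewrite (le_trans (IH (ltnW mn)))// mono.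
have sle m : (m <= n)%N -> s m <= t.
  move=> mn; rewrite -(subKn mn); move: (n - m)%N (leq_subr m n) => {mn}m'.
  elim: m' => [|m' IH] mn; first by rewrite subn0 sn.
  rewrite (le_trans _ (IH (ltnW mn)))// -[in leRHS](prednK (n := n - m')) ?subn_gt0//.
  by rewrite -subnS mono// subnS prednK ?subn_gt0// leq_subr.
suff H m : (m <= n)%N ->
  (\sum_(i < m) (s i.+1 - s i) * f (xi i) - \int[mu]_(r in `[0, s m]) f r) ^+ 2 <=
  s m * \sum_(i < m) \int[mu]_(r in `[s i, s i.+1]) (f (xi i) - f r) ^+ 2.
  by have := H n (leqnn n); rewrite sn.
elim: m => [|m IH] mn.
  by rewrite !big_ord0 s0 set_itv1 Rintegral_set1 subrr expr0n/= mulr0.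
have mi (a b : R) : measurable (`[a, b] : set R) by exact: measurable_itv.
have hs (a b : R) : 0 <= a -> b <= t -> sqint `[a, b] f.
  by move=> a0 bt; apply: sqintS hf => //; apply: subset_itv; rewrite bnd_simp.
have it (a b : R) : 0 <= a -> b <= t -> integ `[a, b] f.
  by move=> a0 bt; apply: sqint_integ; [exact: mi|exact: finite_itv|exact: hs].
rewrite !big_ord_recr/= (Rintegral_itv_cat (sge m (ltnW mn)) (mono m mn)); last first.
  by apply: it => //; exact: sle.
set D := s m.+1 - s m; have D0 : 0 <= D by rewrite subr_ge0 mono.
have muD : mu `[s m, s m.+1] = D%:E.
  by rewrite /= lebesgue_measure_itv/= lte_fin; case: ltP => // h;
     rewrite /D (_ : s m.+1 = s m) ?subrr//; apply/eqP; rewrite eq_le h mono.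
have hm := hs (s m) (s m.+1) (sge m (ltnW mn)) (sle _ mn).
have hc : sqint `[s m, s m.+1] (fun=> f (xi m)).
  by apply: sqint_cst => //; exact: finite_itv.
have E1 : D * f (xi m) - \int[mu]_(r in `[s m, s m.+1]) f r =
   \int[mu]_(r in `[s m, s m.+1]) (f (xi m) - f r).
  rewrite RintegralB//; last 2 first.
  - by apply: sqint_integ hc => //; exact: finite_itv.
  - by apply: sqint_integ hm => //; exact: finite_itv.
  rewrite Rintegral_cst//= (_ : fine _ = D); last exact: (congr1 fine muD).
  by rewrite mulrC.
rewrite opprD addrACA E1.
rewrite (_ : s m.+1 = s m + D); last by rewrite /D subrKC.
apply: sqrD_le_prod => //.
- exact: sge (ltnW mn).
- by apply: sumr_ge0 => i _; apply: Rintegral_ge0 => r _; exact: sqr_ge0.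
- by apply: Rintegral_ge0 => r _; exact: sqr_ge0.
- exact: IH (ltnW mn).
- have := sqr_Rintegral_le (mi _ _) muD (sqintB (mi _ _) hc hm).
  by rewrite /D subrKC.
Qed.

End Shifts.

Section Orbit.
Variables (R : realType) (k l : nat).
Local Notation mu := (@lebesgue_measure R).
Local Notation I01 := (@I01 R).
Variables (M : 'I_k -> 'I_k -> R) (P : 'I_k -> 'I_l -> R).
Variables (K : 'I_l -> R) (J : 'I_l -> 'I_k -> R).

Lemma uniform_radius (n : nat) (Q : 'I_n -> R -> Prop) :
  (forall j d d', 0 < d' -> d' <= d -> Q j d -> Q j d') ->
  (forall j, exists2 d : R, 0 < d & Q j d) -> exists2 d : R, 0 < d & forall j, Q j d.
Proof.
move=> mQ exQ; pose f j := s2val (cid2 (exQ j)).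
have Hf j : 0 < f j /\ Q j (f j) by rewrite /f; case: cid2.
pose d := \big[Num.min/1]_j f j.
have d0 : 0 < d.
  by rewrite /d; elim/big_ind: _ => // [x y x0 y0|j _]; [rewrite lt_min x0|case: (Hf j)].
exists d => // j; apply: mQ d0 _ (Hf j).2.
by rewrite /d (bigD1 j)//= ge_min lexx.
Qed.

Variables (om : 'I_k -> R -> R) (z : 'I_l -> R -> R).
Hypothesis hom : forall j, loc_sqint (om j).
Hypothesis prz : forall i T, 0 <= T ->
  primitive_on 0 T (fun r => K i * z i r + \sum_j J i j * om j (r - 1)) (z i).
Hypothesis om_delay : forall j t, 0 <= t ->
  om j t = \sum_i M j i * om i (t - 1) + \sum_i P j i * z i t.
Hypothesis z_sqint : forall i T, 0 <= T -> sqint `[0, T] (z i).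

Let mi (a b : R) : measurable (`[a, b] : set R).
Proof. exact: measurable_itv. Qed.

Let iom j a b : - 1 <= a -> integ `[a, b] (om j).
Proof.
move=> a1; apply: sqint_integ; [exact: mi|exact: finite_itv|].
apply: sqintS (hom j b); [exact: mi|exact: mi|].
by apply: subset_itv; rewrite bnd_simp.
Qed.

Let idelay j T : integ `[0, T] (fun r => om j (r - 1)).
Proof.
apply: sqint_integ; [exact: mi|exact: finite_itv|].
by have := sqint_delay (hom j (T - 1)); rewrite subrK.
Qed.

Let iz i T : 0 <= T -> integ `[0, T] (z i).
Proof. by move=> T0; apply: sqint_integ; [exact: mi|exact: finite_itv|exact: z_sqint]. Qed.

Let iforce i T : 0 <= T -> integ `[0, T] (fun r => K i * z i r + \sum_j J i j * om j (r - 1)).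
Proof.
move=> T0; apply: integD; first exact: mi.
  by apply: integZ; [exact: mi|exact: iz].
apply: integ_sum; first exact: mi.
by move=> j; apply: integZ; [exact: mi|exact: idelay].
Qed.

Lemma orbit_sqint j t : 0 <= t -> sqint I01 (fun x => om j (t - x)).
Proof. by move=> t0; apply: profile_sqint (hom j t); rewrite t0 lexx. Qed.

Lemma orbit_unif_continuous (T e : R) : 0 <= T -> 0 < e -> exists2 d : R, 0 < d &
  forall s t, 0 <= s <= T -> 0 <= t <= T -> `|s - t| < d ->
  (forall j, \int[mu]_(x in I01) (om j (s - x) - om j (t - x)) ^+ 2 < e) /\
  (forall i, (z i s - z i t) ^+ 2 < e).
Proof.
move=> T0 e0.
have [d1 d10 H1] : exists2 d : R, 0 < d & forall j, forall s t, 0 <= s <= T ->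
    0 <= t <= T -> `|s - t| < d ->
    \int[mu]_(x in I01) (om j (s - x) - om j (t - x)) ^+ 2 < e.
  apply: uniform_radius => [j d d' d'0 dd' H s t sT tT std|j].
    by apply: H => //; exact: lt_le_trans dd'.
  exact: shift_L2_unif_continuous (hom j T) e e0.
have [d2 d20 H2] : exists2 d : R, 0 < d & forall i, forall s t, 0 <= s <= T ->
    0 <= t <= T -> `|s - t| < d -> (z i s - z i t) ^+ 2 < e.
  apply: uniform_radius => [j d d' d'0 dd' H s t sT tT std|i].
    by apply: H => //; exact: lt_le_trans dd'.
  have m0 : 0 < Num.min 1 e by rewrite lt_min ltr01.
  have cz := primitive_continuous T0 (iforce i T0) (prz i T0).
  have [d d0 Hd] := unif_continuous_itv (within_continuous_dist cz) m0.
  exists d => // s t sT tT /(Hd _ _ sT tT); rewrite lt_min => /andP[h1 he].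
  rewrite -real_normK ?num_real// expr2 (le_lt_trans _ he)//.
  by rewrite ler_piMl// ltW.
exists (Num.min d1 d2) => [|s t sT tT]; first by rewrite lt_min d10.
by rewrite lt_min => /andP[? ?]; split => [j|i]; [exact: H1|exact: H2].
Qed.

(** The integral of om j (r - x) over r in [0, t] is that of om j over
    [- x, t - x], which is differentiated at its two ends. *)
Lemma time_average_primitive (t : R) j : 0 <= t ->
  primitive_on 0 1 (fun x => - (om j (t - x) - om j (0 - x)))
    (fun x => \int[mu]_(r in `[0, t]) om j (r - x)).
Proof.
move=> t0.
pose v x := \int[mu]_(r in `[0, t]) om j (r - x).
pose Om x := \int[mu]_(r in `[- 1, x]) om j r.
have OmB (a b : R) : - 1 <= a -> a <= b -> \int[mu]_(r in `[a, b]) om j r = Om b - Om a.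
  move=> a1 ab; rewrite /Om (Rintegral_itv_cat a1 ab (iom j b (lexx _))).
  by rewrite addrAC subrr add0r.
have vE x : 0 <= x <= 1 -> v x = Om (t - x) - Om (- x).
  move=> /andP[x0 x1]; rewrite /v -OmB; [|lra|lra].
  have ix : integ `[- x, t - x] (om j) by apply: iom; lra.
  by rewrite -(Rintegral_shift x ix) addNr subrK.
have refl (y x : R) : 0 <= y -> 0 <= x <= 1 ->
    \int[mu]_(r in `[0, x]) om j (y - r) = Om y - Om (y - x).
  move=> y0 /andP[x0 x1]; rewrite -OmB; [|lra|lra].
  have iy : integ `[y - x, y] (om j) by apply: iom; lra.
  rewrite -(Rintegral_reflect y (mi _ _) iy).
  rewrite (_ : [set r | _] = `[0, x]%classic)//.
  by apply/seteqP; split => r /=; rewrite !in_itv/= => /andP[? ?]; apply/andP; split; lra.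
have irefl (y x : R) : 0 <= y -> 0 <= x <= 1 -> integ `[0, x] (fun r => om j (y - r)).
  move=> y0 /andP[x0 x1].
  have iy : integ `[y - x, y] (om j) by apply: iom; lra.
  have := integ_reflect y (mi _ _) iy.
  rewrite (_ : [set r | _] = `[0, x]%classic)//.
  by apply/seteqP; split => r /=; rewrite !in_itv/= => /andP[? ?]; apply/andP; split; lra.
move=> x x01; rewrite -/(v x) -/(v 0) (vE _ x01) vE ?lexx ?ler01//.
rewrite (_ : \int[mu]_(y in _) _ =
   \int[mu]_(y in `[0, x]) (om j (0 - y) - om j (t - y))); last first.
  by apply: eq_Rintegral => y _; ring.
rewrite RintegralB//; [|exact: irefl|exact: irefl].
by rewrite !refl// subr0 oppr0 sub0r; ring.
Qed.

Lemma orbit_integral_sqint (t : R) j : 0 <= t ->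
  sqint I01 (fun x => \int[mu]_(r in `[0, t]) om j (r - x)).
Proof.
move=> t0; apply: primitive_sqint (time_average_primitive j t0).
have mI := @measurable_I01 R.
have := sqintB mI (orbit_sqint j (lexx 0)) (orbit_sqint j t0).
move/(sqint_integ mI (@finite_I01 R)).
by congr integ; apply/funext => x; rewrite opprB.
Qed.

(** All conditions that define the generator are linear and can be integrated
    over time; averaging over time gains the missing derivative in x. *)
Lemma orbit_op (t : R) : 0 <= t ->
  transport_op M P K J
    (fun j x => \int[mu]_(r in `[0, t]) om j (r - x))
    (fun i => \int[mu]_(r in `[0, t]) z i r)
    (fun j x => om j (t - x) - om j (0 - x)) (fun i => z i t - z i 0).
Proof.
move=> t0; pose v j x := \int[mu]_(r in `[0, t]) om j (r - x).
have v0 j : v j 0 = \int[mu]_(r in `[0, t]) om j r.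
  by rewrite /v; apply: eq_Rintegral => r _; rewrite subr0.
exists v; split => //.
- by move=> j; apply: aeW.
- by move=> j; exact: time_average_primitive.
- move=> j; rewrite v0.
  rewrite (_ : \int[mu]_(r in _) _ = \int[mu]_(r in `[0, t])
     (\sum_i M j i * om i (r - 1) + \sum_i P j i * z i r)); last first.
    by apply: eq_Rintegral => r; rewrite inE/= in_itv/= => /andP[r0 _]; exact: om_delay.
  have i1 i : integ `[0, t] (fun r => M j i * om i (r - 1)).
    by apply: integZ => //; exact: idelay.
  have i2 i : integ `[0, t] (fun r => P j i * z i r).
    by apply: integZ => //; exact: iz.
  rewrite RintegralD//; [|exact: integ_sum|exact: integ_sum].
  rewrite !Rintegral_sum//; congr (_ + _); apply: eq_bigr => i _; rewrite RintegralZl//.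
    exact: idelay.
  exact: iz.
- move=> i; have := prz i t0; move/(_ t); rewrite t0 lexx => /(_ isT) ->.
  rewrite addrAC subrr add0r.
  have i1 j : integ `[0, t] (fun r => J i j * om j (r - 1)).
    by apply: integZ => //; exact: idelay.
  rewrite RintegralD//; [|by apply: integZ => //; exact: iz|exact: integ_sum].
  rewrite RintegralZl//; last exact: iz.
  rewrite Rintegral_sum//; congr (_ + _); apply: eq_bigr => j _.
  by rewrite RintegralZl//; exact: idelay.
Qed.

(** On each step of a fine partition the orbit moves by little in L2, so that
    the sum over the steps of tonelli_shift bounds the quadratic error of
    Riemann_sum_sqr. *)
Lemma orbit_integral (t e : R) : 0 <= t -> 0 < e -> exists2 d : R, 0 < d &
  forall (n : nat) (s xi : nat -> R), s 0%N = 0 -> s n = t ->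
  (forall i, (i < n)%N -> s i <= xi i <= s i.+1 /\ s i.+1 - s i < d) ->
  (forall j, \int[mu]_(x in I01) (\sum_(i < n) (s i.+1 - s i) * om j (xi i - x)
      - \int[mu]_(r in `[0, t]) om j (r - x)) ^+ 2 < e) /\
  (forall i', (\sum_(i < n) (s i.+1 - s i) * z i' (xi i)
      - \int[mu]_(r in `[0, t]) z i' r) ^+ 2 < e).
Proof.
move=> t0 e0.
pose e' := e / (t ^+ 2 + 1).
have t20 : 0 < t ^+ 2 + 1 by rewrite ltr_wpDl// sqr_ge0.
have e'0 : 0 < e' by rewrite divr_gt0.
have te : t * (t * e') < e.
  rewrite mulrA -expr2 /e' mulrA ltr_pdivrMr// mulrC ltr_pM2l//; lra.
have [d d0 Hd] := orbit_unif_continuous t0 e'0.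
exists d => // n s xi s0 sn sxi.
have mono i : (i < n)%N -> s i <= s i.+1.
  by move=> /sxi[/andP[h1 h2] _]; exact: le_trans h2.
have sge m : (m <= n)%N -> 0 <= s m.
  elim: m => [|m IH] mn; first by rewrite s0.
  by rewrite (le_trans (IH (ltnW mn)))// mono.
have sle m : (m <= n)%N -> s m <= t.
  move=> mn; rewrite -(subKn mn); move: (n - m)%N (leq_subr m n) => {mn}m'.
  elim: m' => [|m' IH] mn; first by rewrite subn0 sn.
  rewrite (le_trans _ (IH (ltnW mn)))// -[in leRHS](prednK (n := n - m')) ?subn_gt0//.
  by rewrite -subnS mono// subnS prednK ?subn_gt0// leq_subr.
have xit i : (i < n)%N -> 0 <= xi i <= t.
  move=> i_n; have [/andP[h1 h2] _] := sxi i i_n.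
  by rewrite (le_trans (sge i (ltnW i_n)))//= (le_trans h2)// sle.
have near i r : (i < n)%N -> s i <= r <= s i.+1 -> 0 <= r <= t /\ `|xi i - r| < d.
  move=> i_n /andP[r1 r2]; have [/andP[h1 h2] h3] := sxi i i_n; split.
    by rewrite (le_trans (sge i (ltnW i_n)))//= (le_trans r2)// sle.
  by rewrite ltr_norml; apply/andP; split; lra.
have sumd : \sum_(i < n) (s i.+1 - s i) = t.
  by rewrite -(big_mkord xpredT (fun i => s i.+1 - s i)) telescope_sumr// sn s0 subr0.
have sxi' i : (i < n)%N -> s i <= xi i <= s i.+1 by move=> /sxi[].
split => [j|i'].
  have T i : (i < n)%N -> integ I01 (fun x => \int[mu]_(r in `[s i, s i.+1]) (om j (xi i - x) - om j (r - x)) ^+ 2) /\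
    \int[mu]_(x in I01) \int[mu]_(r in `[s i, s i.+1]) (om j (xi i - x) - om j (r - x)) ^+ 2 <= (s i.+1 - s i) * e'.
    move=> i_n; apply: (tonelli_shift (T := t)).
    - exact: sge (ltnW i_n).
    - exact: mono.
    - exact: sle.
    - exact: xit.
    - exact: hom.
    - by move=> r /(near i r i_n)[rt xr]; have [H _] := Hd _ _ (xit i i_n) rt xr; exact/ltW/H.
  have mI := @measurable_I01 R.
  have hv := orbit_integral_sqint j t0.
  have hS : sqint I01 (fun x => \sum_(i < n) (s i.+1 - s i) * om j (xi i - x)).
    apply: sqint_sum => //; first exact: finite_I01.
    by move=> i; apply: sqintZ => //; apply: orbit_sqint; case/andP: (xit i (ltn_ord i)).
  have iT : integ I01 (fun x => t * \sum_(i < n) \int[mu]_(r in `[s i, s i.+1]) (om j (xi i - x) - om j (r - x)) ^+ 2).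
    apply: integZ => //; apply: integ_sum => // i; exact: (T i (ltn_ord i)).1.
  apply: le_lt_trans te.
  apply: (@le_trans _ _ (\int[mu]_(x in I01) (t * \sum_(i < n) \int[mu]_(r in `[s i, s i.+1]) (om j (xi i - x) - om j (r - x)) ^+ 2))).
    apply: le_Rintegral => //; first exact: (sqint_sqr mI (sqintB mI hS hv)).
    move=> x Ix; apply: (@Riemann_sum_sqr _ (fun r => om j (r - x))) => //.
    move: Ix; rewrite /Defs.I01/= in_itv/= => /andP[x0 x1].
    by apply: sqint_translate (hom j t); rewrite !ltW.
  rewrite RintegralZl//; last first.
    by apply: integ_sum => // i; exact: (T i (ltn_ord i)).1.
  rewrite ler_wpM2l// Rintegral_sum//; last by move=> i; exact: (T i (ltn_ord i)).1.
  rewrite -[in leRHS]sumd mulr_suml; apply: ler_sum => i _; exact: (T i (ltn_ord i)).2.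
apply: le_lt_trans te.
apply: le_trans (Riemann_sum_sqr s0 sn sxi' (z_sqint i' t0)) _.
rewrite ler_wpM2l// -[in leRHS]sumd mulr_suml; apply: ler_sum => i _.
have i_n := ltn_ord i.
have -> : (s i.+1 - s i) * e' = \int[mu]_(r in `[s i, s i.+1]) e'.
  rewrite Rintegral_cst//= lebesgue_measure_itv/= lte_fin mulrC; case: ltP => // h.
  by rewrite (_ : s i.+1 = s i) ?subrr//; apply/eqP; rewrite eq_le h mono.
have cs (c : R) : sqint `[s i, s i.+1] (fun=> c) by apply: sqint_cst => //; exact: finite_itv.
apply: le_Rintegral => //.
- apply: (sqint_sqr (mi _ _)); apply: sqintB => //.
  apply: sqintS (z_sqint i' t0) => //; apply: subset_itv; rewrite bnd_simp.
    exact: sge (ltnW i_n).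
  exact: sle.
- by apply: sqint_integ (cs _) => //; exact: finite_itv.
- move=> r; rewrite /= in_itv/= => /(near i r i_n)[rt xr].
  by have [_ H] := Hd _ _ (xit i i_n) rt xr; exact/ltW/H.
Qed.

End Orbit.

(** * Weak derivatives and primitives *)
Section WeakDerivatives.
Variable R : realType.
Local Notation mu := (@lebesgue_measure R).
Local Notation I01 := (@I01 R).
Implicit Types (f g u w : R -> R).

Definition weak_deriv f g := forall w, C1c w ->
  \int[mu]_(x in I01) (f x * derive1 w x) = - \int[mu]_(x in I01) (g x * w x).

Lemma C1c_primitive w : C1c w -> primitive_on 0 1 (derive1 w) w.
Proof. by move=> [dw cw _]; exact: (@C1_primitive_on R 0 1 _ w cw dw (fun=> erefl)). Qed.

Lemma C1c_bounds w : C1c w -> w 0 = 0 /\ w 1 = 0.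
Proof.
move=> [_ _ [c [d [c0 d1 wE]]]]; split; apply: wE; apply/negP;
  rewrite negb_and -!ltNge ?c0//= d1 orbT//.
Qed.

Lemma C1c_sqint w : C1c w -> sqint `[0, 1] (derive1 w).
Proof. by move=> [_ cw _]; apply: continuous_sqint_itv; exact: continuous_subspaceT. Qed.

Lemma primitive_weak_deriv f g : integ I01 g -> primitive_on 0 1 g f -> weak_deriv f g.
Proof.
move=> ig fg w hw; have [w0 w1] := C1c_bounds hw.
have mJ : measurable (`[0, 1] : set R) by exact: measurable_itv.
have iJ := (integ_I01_cc g).1 ig.
have iw : integ `[0, 1] (derive1 w).
  by apply: sqint_integ (C1c_sqint hw) => //; exact: finite_itv.
have pw := C1c_primitive hw.
have := by_parts ler01 iJ iw fg pw.
have i1 := integ_mul_primitive ler01 iJ fg iw.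
have i2 := integ_mul_primitive ler01 iw pw iJ.
rewrite w0 w1 !mulr0 subrr RintegralD// => /eqP.
rewrite addr_eq0 => /eqP H.
rewrite !Rintegral_I01_cc.
- rewrite H; congr (- _); apply: eq_Rintegral => x _; exact: mulrC.
- have := integ_meas ((integ_I01_cc _).2 i2).
  by congr measurable_fun; apply/funext => x; exact: mulrC.
- exact: integ_meas ((integ_I01_cc _).2 i1).
Qed.

Lemma ae_continuous_eq0 (h : R -> R) : continuous h ->
  {ae mu, forall x, I01 x -> h x = 0} -> forall x, I01 x -> h x = 0.
Proof.
move=> ch [N [mN N0 hN]] x Ix; apply/eqP/negPn/negP => hx.
have hx0 : 0 < `|h x| by rewrite normr_gt0.
have [r r0 Hr] := continuous_dist x ch hx0.
move: (Ix); rewrite /Defs.I01/= in_itv/= => /andP[x0 x1].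
pose q := Num.min r (Num.min x (1 - x)).
have q0 : 0 < q by rewrite !lt_min r0 x0 subr_gt0.
have qr : q <= r by rewrite ge_min lexx.
have qx : q <= x by rewrite !ge_min lexx !orbT.
have q1 : q <= 1 - x by rewrite !ge_min lexx !orbT.
have sub : `]x - q, x + q[%classic `<=` N.
  move=> y; rewrite /= in_itv/= => /andP[y1 y2]; apply: hN => /= H.
  have Iy : I01 y by rewrite /Defs.I01/= in_itv/=; apply/andP; split; lra.
  have xy : `|x - y| < r by rewrite ltr_norml; apply/andP; split; lra.
  by have := Hr y xy; rewrite (H Iy) subr0 ltxx.
have xq : x - q < x + q by lra.
have muE : mu `](x - q), (x + q)[%classic = (x + q - (x - q))%:E.
  by rewrite /= lebesgue_measure_itv/= lte_fin xq.
have : ((x + q - (x - q))%:E <= 0)%E.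
  rewrite -muE -N0; apply: le_measure => //; rewrite inE//; exact: measurable_itv.
by rewrite lee_fin; lra.
Qed.

Lemma continuous_Rintegral_eq0 (q : R -> R) : continuous q -> (forall x, 0 <= q x) ->
  \int[mu]_(x in I01) q x = 0 -> forall x, I01 x -> q x = 0.
Proof.
move=> cq q0 h0; apply: ae_continuous_eq0 => //.
have mI := @measurable_I01 R.
have iq : integ I01 q.
  apply/integ_I01_cc; apply: sqint_integ; [exact: measurable_itv|exact: finite_itv|].
  by apply: continuous_sqint_itv; exact: continuous_subspaceT.
have mq : measurable_fun I01 (EFin \o q) by apply/measurable_EFinP; exact: integ_meas iq.
have h1 : (\int[mu]_(x in I01) `|(q x)%:E| = 0)%E.
  under eq_integral do rewrite gee0_abs ?lee_fin//.
  have /fineK <- : (\int[mu]_(x in I01) (q x)%:E \is a fin_num)%E.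
    exact: integrable_fin_num iq.
  by congr EFin.
by have := (ae_eq_integral_abs mu mI mq).1 h1; apply: ae_sub => x h /h [].
Qed.

Lemma clamp_continuous (a b : R) u : a <= b -> {within `[a, b], continuous u} ->
  continuous (fun s => u (Num.max a (Num.min b s))).
Proof.
move=> ab cu x; pose C (s : R) := Num.max a (Num.min b s).
have CP s : a <= C s <= b by rewrite /C le_max lexx/= ge_max ab ge_min lexx.
apply/cvgrPdist_lt => e e0.
have [r r0 Hr] := within_continuous_dist cu (CP x) e0.
apply/nbhs_ballP; exists r => // y xy /=.
by apply: Hr; [exact: CP|exact: le_lt_trans (clamp_lip _ _ _ _) xy].
Qed.

(** The integral of k vanishes, so its primitive has compact support again. *)
Lemma bump_C1c (a b : R) (k : R -> R) : 0 < a -> b < 1 -> continuous k ->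
  (forall x, ~ (a <= x <= b) -> k x = 0) -> \int[mu]_(x in I01) k x = 0 ->
  exists w, C1c w /\ derive1 w = k.
Proof.
move=> a0 b1 ck k0 ik0.
pose w (s : R) := \int[mu]_(r in `[0, s]) k r.
have sk (c d : R) : sqint `[c, d] k.
  by apply: continuous_sqint_itv; exact: continuous_subspaceT.
have ik (c d : R) : integ `[c, d] k.
  by apply: sqint_integ; [exact: measurable_itv|exact: finite_itv|exact: sk].
have wlow x : x < a -> w x = 0.
  move=> xa; rewrite /w (_ : \int[mu]_(r in _) _ = \int[mu]_(r in `[0, x]) (0 : R)).
    by rewrite Rintegral_cst ?mul0r//; exact: measurable_itv.
  apply: eq_Rintegral => r; rewrite inE/= in_itv/= => /andP[_ rx].
  by apply: k0; apply/negP; rewrite negb_and -ltNge (le_lt_trans rx).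
have whigh x : b < x -> w x = 0.
  move=> bx; rewrite /w -ik0 Rintegral_mkcond [RHS]Rintegral_mkcond.
  apply: eq_Rintegral => r _; rewrite !patchE.
  case: (boolP (a <= r <= b)) => [/andP[ar rb]|/negP/k0 ->]; last by do 2?case: ifP.
  rewrite !mem_set//=; last first.
    by rewrite in_itv/=; apply/andP; split; lra.
  by rewrite /Defs.I01/= in_itv/=; apply/andP; split; lra.
have dw x : derivable w x 1 /\ derive1 w x = k x.
  have [xa|ax] := ltP x a.
    have nw : \near x, w x = (cst 0 : R -> R) x.
      have : \forall y \near x, y < a by exact: lt_nbhsl.
      by apply: filterS => y /wlow.
    have d0 : derivable (cst 0 : R -> R) x 1 by exact: derivable_cst.
    split; first by apply: near_eq_derivable d0 => //; apply: filterS nw => y ->.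
    rewrite derive1E (near_eq_derive _ nw)// derive_cst k0//.
    by apply/negP; rewrite negb_and -ltNge xa.
  have x1 : x < x + 1 by rewrite ltrDl.
  have x0 : 0 < x := lt_le_trans a0 ax.
  exact: (continuous_FTC1_closed x1 (ik 0 (x + 1)) x0 (ck x)).
have dwk : derive1 w = k by apply/funext => x; exact: (dw x).2.
exists w; split => //; split.
- by move=> x; exact: (dw x).1.
- by rewrite dwk.
- exists a, b; split => // x /negP; rewrite negb_and -!ltNge => /orP[/wlow|/whigh]//.
Qed.

(** If u is orthogonal to the derivatives of all test functions, testing
    against a primitive of theta * (u - c), where theta is a bump and c the
    mean of u for the weight theta, shows that u = c on the bump. *)
Lemma weak_deriv0_local (u : R -> R) (a b : R) : continuous u -> 0 < a -> a < b -> b < 1 ->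
  (forall w, C1c w -> \int[mu]_(x in I01) (u x * derive1 w x) = 0) ->
  exists c, forall x, a < x < b -> u x = c.
Proof.
move=> cu a0 ab b1 Hu.
pose th (s : R) := Num.max 0 ((s - a) * (b - s)).
have cth : continuous th.
  move=> x; apply: (@continuous_max R R (fun=> 0) (fun s => (s - a) * (b - s))); first exact: cvg_cst.
  by apply: cvgM; apply: cvgB; [exact: cvg_id|exact: cvg_cst|exact: cvg_cst|exact: cvg_id].
have th0 x : 0 <= th x by rewrite /th le_max lexx.
have thE x : ~ (a <= x <= b) -> th x = 0.
  move=> /negP; rewrite negb_and -!ltNge => H; rewrite /th.
  by apply/max_idPl; case/orP: H => ?; nra.
have thp x : a < x < b -> 0 < th x.
  by move=> /andP[ax xb]; rewrite /th lt_max mulr_gt0 ?orbT// subr_gt0.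
have ic (f : R -> R) : continuous f -> integ I01 f.
  move=> cf; apply/integ_I01_cc; apply: sqint_integ; [exact: measurable_itv|exact: finite_itv|].
  by apply: continuous_sqint_itv; exact: continuous_subspaceT.
have mI := @measurable_I01 R.
have cthu : continuous (fun x => th x * u x) by move=> x; apply: cvgM; [exact: cth|exact: cu].
have cthuu : continuous (fun x => th x * u x ^+ 2).
  by move=> x; apply: cvgM; [exact: cth|apply: cvgM; exact: cu].
pose Jt := \int[mu]_(x in I01) th x.
pose m := \int[mu]_(x in I01) (th x * u x).
pose k x := Jt * (th x * u x) - m * th x.
have ck : continuous k.
  by move=> x; apply: cvgB; apply: cvgM; [exact: cvg_cst|exact: cthu|exact: cvg_cst|exact: cth].
have k0 x : ~ (a <= x <= b) -> k x = 0 by move=> /thE h; rewrite /k h; ring.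
have ik0 : \int[mu]_(x in I01) k x = 0.
  rewrite RintegralB//; [|by apply: integZ => //; exact: ic|by apply: integZ => //; exact: ic].
  by rewrite !RintegralZl//; [rewrite -/m -/Jt; ring|exact: ic|exact: ic].
have [w [hw wk]] := bump_C1c a0 b1 ck k0 ik0.
have := Hu w hw; rewrite wk => Huk.
have Q0 : \int[mu]_(x in I01) (th x * (Jt * u x - m) ^+ 2) = 0.
  rewrite (_ : \int[mu]_(x in _) _ = \int[mu]_(x in I01) (Jt * (u x * k x) - m * k x)); last first.
    by apply: eq_Rintegral => x _; rewrite /k; ring.
  rewrite RintegralB//; last 2 first.
  - by apply: integZ => //; apply: ic => x; apply: cvgM; [exact: cu|exact: ck].
  - by apply: integZ => //; exact: ic.
  rewrite !RintegralZl//; last 2 first.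
  - exact: ic.
  - by apply: ic => x; apply: cvgM; [exact: cu|exact: ck].
  by rewrite Huk ik0 !mulr0 subrr.
have sub x : a < x < b -> I01 x.
  by move=> /andP[ax xb]; rewrite /Defs.I01/= in_itv/=; apply/andP; split; lra.
have Jt0 : Jt != 0.
  apply/eqP => J0; have mid : a < (a + b) / 2 < b by apply/andP; split; lra.
  have := continuous_Rintegral_eq0 cth th0 J0 (sub _ mid).
  by have := thp _ mid => /lt0r_neq0/eqP.
exists (m / Jt) => x xab.
have := continuous_Rintegral_eq0 _ _ Q0 (sub _ xab); move=> H.
have /eqP : th x * (Jt * u x - m) ^+ 2 = 0.
  apply: H => [y|y].
    apply: cvgM; first exact: cth.
    by apply: cvgM; (apply: cvgB; [apply: cvgM; [exact: cvg_cst|exact: cu]|exact: cvg_cst]).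
  by rewrite mulr_ge0// sqr_ge0.
rewrite mulf_eq0 (negbTE (lt0r_neq0 (thp _ xab)))/= sqrf_eq0 subr_eq0 => /eqP <-.
by field.
Qed.

(** The difference between f and the primitive F of g is orthogonal to the
    derivatives of all test functions, hence locally constant in (0,1), and
    constant on [0,1] by continuity. *)
Lemma du_Bois_Reymond (f g : R -> R) : {within `[0, 1], continuous f} -> integ I01 g ->
  weak_deriv f g -> primitive_on 0 1 g f.
Proof.
move=> cf ig fg.
have iJ := (integ_I01_cc g).1 ig.
pose F x := \int[mu]_(y in `[0, x]) g y.
have pF : primitive_on 0 1 g F by move=> x _; rewrite /F set_itv1 Rintegral_set1 add0r.
have cF := primitive_continuous ler01 iJ pF.
pose u x := f x - F x.
have cu : {within `[0, 1], continuous u}.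
  by move=> x; apply: cvgB; [exact: cf|exact: cF].
(* Extending u by constants outside [0,1] makes it continuous on the line. *)
pose ue (s : R) := u (Num.max 0 (Num.min 1 s)).
have cue : continuous ue by exact: clamp_continuous ler01 cu.
have ueE x : 0 <= x <= 1 -> ue x = u x.
  by move=> /andP[x0 x1]; rewrite /ue (min_idPr x1) (max_idPr x0).
have Hu w : C1c w -> \int[mu]_(x in I01) (ue x * derive1 w x) = 0.
  move=> hw; have Fg := primitive_weak_deriv ig pF hw; have fgw := fg w hw.
  have sw := (sqint_I01_cc _).2 (C1c_sqint hw).
  have mI := @measurable_I01 R.
  have sf : sqint I01 f by apply/sqint_I01_cc; exact: continuous_sqint_itv.
  have sF : sqint I01 F by apply/sqint_I01_cc; exact: continuous_sqint_itv.
  rewrite (_ : \int[mu]_(x in _) _ =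
     \int[mu]_(x in I01) (f x * derive1 w x - F x * derive1 w x)); last first.
    apply: eq_Rintegral => x; rewrite inE /Defs.I01/= in_itv/= => /andP[x0 x1].
    by rewrite ueE ?ltW// /u; ring.
  by rewrite RintegralB//; [rewrite fgw Fg subrr|exact: sqintM|exact: sqintM].
have const x y : 0 < x < 1 -> 0 < y < 1 -> ue x = ue y.
  move=> /andP[x0 x1] /andP[y0 y1].
  pose a := Num.min x y / 2; pose b := (1 + Num.max x y) / 2.
  have m0 : 0 < Num.min x y by rewrite lt_min x0.
  have M1 : Num.max x y < 1 by rewrite gt_max x1.
  have mx : Num.min x y <= x by rewrite ge_min lexx.
  have my : Num.min x y <= y by rewrite ge_min lexx orbT.
  have Mx : x <= Num.max x y by rewrite le_max lexx.
  have My : y <= Num.max x y by rewrite le_max lexx orbT.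
  have a0 : 0 < a by rewrite divr_gt0.
  have b1 : b < 1 by rewrite /b; lra.
  have ab : a < b by rewrite /a /b; lra.
  have [c Hc] := weak_deriv0_local cue a0 ab b1 Hu.
  by rewrite !Hc//; rewrite /a /b; clear -mx my Mx My m0 M1; apply/andP; split; lra.
have half : 0 < (2^-1 : R) < 1 by apply/andP; split; lra.
have constc x : 0 <= x <= 1 -> ue x = ue 2^-1.
  move=> /andP[x0 x1]; apply/eqP; rewrite -subr_eq0; apply/negPn/negP => n0.
  have p0 : 0 < `|ue x - ue 2^-1| by rewrite normr_gt0.
  have [r r0 Hr] := continuous_dist x cue p0.
  pose q := Num.min 1 (r / 2).
  have q0 : 0 < q by rewrite lt_min ltr01 divr_gt0.
  have q1 : q <= 1 by rewrite ge_min lexx.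
  have qr : q <= r / 2 by rewrite ge_min lexx orbT.
  have yI : 0 < x + q * (2^-1 - x) < 1.
    by clear -q0 q1 x0 x1; apply/andP; split; nra.
  have xy : `|x - (x + q * (2^-1 - x))| < r.
    rewrite opprD addNKr normrN normrM gtr0_norm//.
    have : `|2^-1 - x| <= 1 by clear -x0 x1; rewrite ler_norml; apply/andP; split; lra.
    by move=> h; have := normr_ge0 (2^-1 - x); nra.
  by have := Hr _ xy; rewrite (const _ _ yI half) ltxx.
move=> x x01; have z01 : 0 <= (0 : R) <= 1 by rewrite lexx ler01.
have := constc _ x01; rewrite -(constc _ z01) !ueE// /u => /eqP.
rewrite subr_eq => /eqP ->; rewrite /F set_itv1 Rintegral_set1; ring.
Qed.

(** Lebesgue differentiation. *)
Lemma primitive_eq0_ae g : integ I01 g ->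
  (forall x, 0 <= x <= 1 -> \int[mu]_(y in `[0, x]) g y = 0) ->
  {ae mu, forall x, I01 x -> g x = 0}.
Proof.
move=> ig g0; have mI := @measurable_I01 R.
pose gt := g \_ I01.
have igt : integ setT gt by exact: ((integ_mkcond g mI).1 ig).
have loc : locally_integrable setT gt by exact: integrable_locally.
have iy (y : R) : mu.-integrable [set` Interval (BLeft 0) (BRight y)] (EFin \o gt).
  by apply: integrableS igt => //; exact: measurable_itv.
have := FTC1 iy loc; apply: ae_sub => x H Ix.
have F0 y : 0 <= y <= 1 -> \int[mu]_(t in [set` Interval (BLeft 0) (BRight y)]) gt t = 0.
  move=> y01; rewrite -[RHS](g0 y y01); apply: Rintegral_itv_ae => //.
  - by apply: measurable_funTS; exact: integ_meas igt.
  - exact: integ_meas ig.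
  - by apply: aeW => t It; rewrite /gt patchE mem_set.
have [x0 x1] : 0 < x /\ x < 1 by move: Ix; rewrite /Defs.I01/= in_itv/= => /andP[].
have {}H := H _; case: H => [|_]; first by rewrite /= ?lte_fin ?bnd_simp ?ltW.
rewrite [in RHS]/gt patchE mem_set// => <-.
rewrite derive1E (@near_eq_derive _ _ _ _ (cst 0)) ?derive_cst//.
have : \forall y \near x, I01 y by apply: open_nbhs_nbhs; split => //; exact: interval_open.
by apply: filterS => y; rewrite /Defs.I01/= in_itv/= => /andP[y0 y1]; rewrite F0// !ltW.
Qed.

(** The difference of the two weak derivatives is a weak derivative of 0, so
    that its primitive vanishes by the lemma of du Bois-Reymond. *)
Lemma weak_deriv_unique f g g' : sqint I01 f -> sqint I01 g -> sqint I01 g' ->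
  weak_deriv f g -> weak_deriv f g' -> {ae mu, forall x, I01 x -> g x = g' x}.
Proof.
move=> hf hg hg' fg fg'; have mI := @measurable_I01 R.
pose d x := g x - g' x.
have hd : sqint I01 d by exact: sqintB.
have id := sqint_integ mI (@finite_I01 R) hd.
have H : weak_deriv (fun=> 0) d.
  move=> w hw.
  have sw : sqint I01 w.
    apply/sqint_I01_cc; apply: continuous_sqint_itv.
    apply: (primitive_continuous ler01 _ (C1c_primitive hw)).
    apply: sqint_integ (C1c_sqint hw); [exact: measurable_itv|exact: finite_itv].
  rewrite (_ : \int[mu]_(x in _) _ = \int[mu]_(x in I01) (0 : R)); last first.
    by apply: eq_Rintegral => x _; rewrite mul0r.
  rewrite Rintegral_cst// mul0r /d.
  rewrite (_ : \int[mu]_(x in _) _ = \int[mu]_(x in I01) (g x * w x - g' x * w x)); last first.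
    by apply: eq_Rintegral => x _; rewrite mulrBl.
  rewrite RintegralB//; [|exact: sqintM|exact: sqintM].
  by have := fg w hw; rewrite (fg' w hw) => /oppr_inj ->; rewrite subrr oppr0.
have c0 : {within (`[0, 1] : set R), continuous (fun _ : R => 0 : R)}.
  by apply: continuous_subspaceT => x; exact: cvg_cst.
have pd := du_Bois_Reymond c0 id H.
have := primitive_eq0_ae id; move=> H0.
have {}H0 : {ae mu, forall x, I01 x -> d x = 0}.
  by apply: H0 => x x01; have := pd x x01; rewrite add0r.
by apply: ae_sub H0 => x h Ix; apply/eqP; rewrite -subr_eq0; apply/eqP; exact: h.
Qed.

End WeakDerivatives.

(** * Quadratic estimates at the boundary *)
Section Constants.
Variable R : realType.

Lemma cross_le (x y c : R) : 0 < c -> 2 * (x * y) <= c * x ^+ 2 + y ^+ 2 / c.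
Proof.
move=> c0; have := sqr_ge0 (c * x - y).
rewrite -(pmulr_rge0 _ (_ : 0 < c^-1)) ?invr_gt0//.
rewrite (_ : c^-1 * _ = c * x ^+ 2 + y ^+ 2 / c - 2 * (x * y)); last first.
  by field; rewrite gt_eqF.
by rewrite subr_ge0.
Qed.

(** Boundary terms of the error.  E and e are the values leaving at the two
    ends, th = h - eta, y = phi(0), A2 and A3 are the squared norms of the
    two waves and S2 and S3 their means.  In terms of the velocity
    s = (e - beta y) / (1 + gamma) at 0, the damper dissipates 4 gamma s^2, which
    absorbs all the terms in s of order d; the cross term provides
    - 20 d beta^2 y^2, which dominates the remaining terms in y. *)
Lemma error_boundary (m beta gamma d E th e y A2 A3 S2 S3 q : R) :
  0 < m -> 0 < beta -> 0 < gamma -> 0 < d ->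
  S2 ^+ 2 <= A2 -> S3 ^+ 2 <= A3 ->
  q = 1 + 4 * m ^+ 2 + gamma ^+ 2 / beta ^+ 2 ->
  d * (10 * (1 + gamma) ^+ 2 + 300 * beta ^+ 2 * q) <= 3 * gamma ->
  (2 * th / m - E) ^+ 2 - (1 - 3 * d) * e ^+ 2
  + (1 + 2 * d) * (((1 - gamma) * e - 2 * beta * y) / (1 + gamma)) ^+ 2 - (1 + d) * E ^+ 2
  + 2 * (2 / m + d / (2 * m)) * th * (E - th / m)
  + 2 * (2 * beta) * y * ((e - beta * y) / (1 + gamma))
  - 3 * d * A2 - d * A3
  + 20 * beta * d * ((e - beta * y) / (1 + gamma) * ((S2 + S3) / 2 + th + gamma * y) - beta * y ^+ 2)
  <= - (d / 2) * E ^+ 2 - d / (4 * m ^+ 2) * th ^+ 2 - 5 * d * beta ^+ 2 * y ^+ 2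
     - d / 2 * A2 - d / 2 * A3.
Proof.
move=> m0 b0 g0 d0 SA2 SA3 qE dG.
set s := (e - beta * y) / (1 + gamma).
have g1 : 1 + gamma != 0 by rewrite gt_eqF// ltr_wpDl// ltW.
have eE : e = (1 + gamma) * s + beta * y by rewrite /s; field.
have WE : ((1 - gamma) * e - 2 * beta * y) / (1 + gamma) = (1 - gamma) * s - beta * y.
  by rewrite /s; field.
rewrite WE; set L := (S2 + S3) / 2 + th + gamma * y.
have m1 : m != 0 by rewrite gt_eqF.
have b1 : beta != 0 by rewrite gt_eqF.
have q1 : 1 <= q.
  have h1 : 0 <= gamma ^+ 2 / beta ^+ 2 by rewrite divr_ge0 ?sqr_ge0.
  have h2 := sqr_ge0 m; by rewrite qE; lra.
have q0 : 0 < q := lt_le_trans ltr01 q1.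
have q2 : 4 * m ^+ 2 <= q.
  have : 0 <= gamma ^+ 2 / beta ^+ 2 by rewrite divr_ge0 ?sqr_ge0.
  by rewrite qE; lra.
have q3 : gamma ^+ 2 <= q * beta ^+ 2.
  have -> : gamma ^+ 2 = gamma ^+ 2 / beta ^+ 2 * beta ^+ 2 by field.
  rewrite ler_wpM2r ?sqr_ge0// qE lerDr addr_ge0// mulr_ge0 ?sqr_ge0//.
have qV0 : 0 < q^-1 by rewrite invr_gt0.
have qV1 : q^-1 <= 1 by rewrite invf_le1.
have qV2 : q^-1 <= (4 * m ^+ 2)^-1.
  by rewrite lef_pV2// posrE// mulr_gt0// exprn_gt0.
have qV3 : q^-1 * gamma ^+ 2 <= beta ^+ 2.
  by rewrite mulrC ler_pdivrMr// mulrC.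
(* The weight 2 / m + d / (2 m) of th makes the difference a square. *)
have H1 : (2 * th / m - E) ^+ 2 - (1 + d) * E ^+ 2
   + 2 * (2 / m + d / (2 * m)) * th * (E - th / m) <=
   - (d / 2) * E ^+ 2 - d / (2 * m ^+ 2) * th ^+ 2.
  rewrite -subr_ge0.
  rewrite (_ : _ - _ = (d / 2) * (E - th / m) ^+ 2); last by field.
  by rewrite mulr_ge0 ?sqr_ge0// ltW// divr_gt0.
have H2 : - (1 - 3 * d) * e ^+ 2 + (1 + 2 * d) * ((1 - gamma) * s - beta * y) ^+ 2
   + 2 * (2 * beta) * y * s <=
   (- 4 * gamma + d * (10 * (1 + gamma) ^+ 2)) * s ^+ 2 + 10 * d * beta ^+ 2 * y ^+ 2.
  rewrite eE -subr_ge0.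
  rewrite (_ : _ - _ = d * (2 * ((1 - gamma) * s + beta * y) ^+ 2
    + 3 * ((1 + gamma) * s - beta * y) ^+ 2 + 16 * gamma * s ^+ 2)); last by ring.
  rewrite pmulr_rge0// addr_ge0//; last first.
    by rewrite mulr_ge0 ?sqr_ge0// mulr_ge0// ltW.
  by rewrite addr_ge0// mulr_ge0// sqr_ge0.
(* Young's inequality with constant 30 beta q: q is large enough for the part
   L^2 / (3 q) to be absorbed by the norms of the waves, th and y. *)
have H3 : 20 * beta * d * (s * L) <= 300 * beta ^+ 2 * q * d * s ^+ 2 + d * (L ^+ 2 / (3 * q)).
  have c0 : 0 < 30 * beta * q by rewrite !mulr_gt0.
  have := cross_le s L c0.
  rewrite -(ler_pM2l (_ : 0 < 10 * beta * d)); last by rewrite !mulr_gt0.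
  rewrite (_ : 10 * beta * d * (2 * (s * L)) = 20 * beta * d * (s * L)); last by ring.
  rewrite (_ : 10 * beta * d * (_ + _) = 300 * beta ^+ 2 * q * d * s ^+ 2 + d * (L ^+ 2 / (3 * q)))//.
  by field; rewrite b1 gt_eqF.
have H4 : L ^+ 2 / 3 <= A2 / 2 + A3 / 2 + th ^+ 2 + gamma ^+ 2 * y ^+ 2.
  rewrite /L; have h1 := sqr_ge0 (S2 - S3); have h2 := sqr_ge0 ((S2 + S3) / 2 - th).
  have h3 := sqr_ge0 ((S2 + S3) / 2 - gamma * y); have h4 := sqr_ge0 (th - gamma * y).
  nra.
have H5 : L ^+ 2 / (3 * q) <= A2 / 2 + A3 / 2 + th ^+ 2 / (4 * m ^+ 2) + beta ^+ 2 * y ^+ 2.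
  rewrite (_ : L ^+ 2 / (3 * q) = q^-1 * (L ^+ 2 / 3)); last by field; rewrite gt_eqF.
  apply: le_trans (ler_wpM2l (ltW qV0) H4) _.
  have A20 : 0 <= A2 := le_trans (sqr_ge0 _) SA2.
  have A30 : 0 <= A3 := le_trans (sqr_ge0 _) SA3.
  rewrite !mulrDr; apply: lerD; [apply: lerD; [apply: lerD|]|].
  - by rewrite ler_piMl// divr_ge0.
  - by rewrite ler_piMl// divr_ge0.
  - by rewrite [leRHS]mulrC ler_wpM2r ?sqr_ge0.
  - by rewrite mulrA ler_wpM2r ?sqr_ge0.
have H6 := ler_wpM2l (ltW d0) H5.
have H7 : d * (10 * (1 + gamma) ^+ 2 + 300 * beta ^+ 2 * q) * s ^+ 2 <= 3 * gamma * s ^+ 2.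
  by rewrite ler_wpM2r ?sqr_ge0.
have H8 : 0 <= gamma * s ^+ 2 by rewrite mulr_ge0 ?sqr_ge0// ltW.
have E1 : d / (2 * m ^+ 2) * th ^+ 2 = 2 * (d / (4 * m ^+ 2) * th ^+ 2) by field.
have E2 : d * (A2 / 2 + A3 / 2 + th ^+ 2 / (4 * m ^+ 2) + beta ^+ 2 * y ^+ 2) =
   d / 2 * A2 + d / 2 * A3 + d / (4 * m ^+ 2) * th ^+ 2 + d * beta ^+ 2 * y ^+ 2 by field.
rewrite E1 in H1; rewrite E2 in H6.
have A20 : 0 <= d * A2 by rewrite mulr_ge0 ?(le_trans (sqr_ge0 _) SA2)// ltW.
have A30 : 0 <= d * A3 by rewrite mulr_ge0 ?(le_trans (sqr_ge0 _) SA3)// ltW.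
have Y0 : 0 <= d * beta ^+ 2 * y ^+ 2 by rewrite mulr_ge0 ?sqr_ge0// mulr_ge0 ?sqr_ge0// ltW.
have E3 : 20 * beta * d * (s * L - beta * y ^+ 2) = 20 * beta * d * (s * L) - 20 * (d * beta ^+ 2 * y ^+ 2) by ring.
rewrite E3.
have E4 : (- 4 * gamma + d * (10 * (1 + gamma) ^+ 2)) * s ^+ 2 + 300 * beta ^+ 2 * q * d * s ^+ 2
   = d * (10 * (1 + gamma) ^+ 2 + 300 * beta ^+ 2 * q) * s ^+ 2 - 4 * (gamma * s ^+ 2) by ring.
have {}H2 := lerD H2 H3.
have {}H2 : - (1 - 3 * d) * e ^+ 2 + (1 + 2 * d) * ((1 - gamma) * s - beta * y) ^+ 2
   + 2 * (2 * beta) * y * s + 20 * beta * d * (s * L) <=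
   d * (10 * (1 + gamma) ^+ 2 + 300 * beta ^+ 2 * q) * s ^+ 2 - 4 * (gamma * s ^+ 2)
   + 10 * (d * beta ^+ 2 * y ^+ 2) + d * (L ^+ 2 / (3 * q)).
  by apply: le_trans H2 _; rewrite -E4 le_eqVlt; apply/orP; left; apply/eqP; ring.
set a1 := (2 * th / m - E) ^+ 2 in H1 *; set a2 := 2 * (2 / m + _) * th * _ in H1 *.
set a3 := d / (4 * m ^+ 2) * _ in H1 H6 *; set a4 := d * beta ^+ 2 * _ in H2 H6 Y0 *.
set a5 := (1 + 2 * d) * _ in H2 *; set a6 := 2 * (2 * beta) * y * s in H2 *.
set a7 := 20 * beta * d * _ in H2 *; set a8 := gamma * s ^+ 2 in H2 H7 H8 *.
have H9 : - (1 - 3 * d) * e ^+ 2 = - ((1 - 3 * d) * e ^+ 2) by ring.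
rewrite H9 in H2; set a9 := (1 - 3 * d) * e ^+ 2 in H2 *.
have -> : 5 * d * beta ^+ 2 * y ^+ 2 = 5 * a4 by rewrite /a4; ring.
have H10 : 3 * gamma * s ^+ 2 = 3 * a8 by rewrite /a8; ring.
rewrite H10 in H7; set a10 := d * _ * s ^+ 2 in H2 H7; set a11 := d * (L ^+ 2 / _) in H2 H6.
have H11 : (1 + d) * E ^+ 2 = E ^+ 2 + d * E ^+ 2 by ring.
rewrite H11 in H1 *.
have H12 : - (d / 2) * E ^+ 2 = - (d * E ^+ 2) / 2 by ring.
rewrite H12 in H1 *; move: H1; set a12 := d * E ^+ 2; set a13 := E ^+ 2 => H1.
have -> : 3 * d * A2 = 3 * (d * A2) by ring.
have H13 A : d / 2 * A = d * A / 2 by ring.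
rewrite !H13 in H6 *; set a14 := d * A2 in A20 H6 *; set a15 := d * A3 in A30 H6 *.
lra.
Qed.

(** Energy of the rod end against the boundary force, in terms of G = psi(1)
    and F = phi'(1): the products G F cancel, which is what the weight
    2 / (m + a alpha) of h achieves, and the terms in E and th, which come from
    the error, are left to the error part of the form. *)
Lemma rod_boundary (m a alpha delta E th F G h n1 n2 : R) :
  0 < m -> 0 < a -> 0 < alpha -> 0 < delta -> delta <= 1 / 4 ->
  n1 = m * alpha / (m + a * alpha) -> n2 = a / (m + a * alpha) ->
  6 * delta <= n1 -> 6 * delta <= n2 -> h = m * G + a * F ->
  (G + F - (2 * th / m - E)) ^+ 2 - (1 - 2 * delta) * (G - F - E) ^+ 2
  + 2 * (2 / (m + a * alpha)) * h * (- F - alpha * G)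
  <= - (2 * n1) * G ^+ 2 - (2 * n2) * F ^+ 2
     + (8 / n1 + 4 / n2 + 8) * (E ^+ 2 + th ^+ 2 / m ^+ 2).
Proof.
move=> m0 a0 al0 d0 d1 n1E n2E dn1 dn2 ->.
have k0 : 0 < m + a * alpha by rewrite addr_gt0// mulr_gt0.
have n10 : 0 < n1 by rewrite n1E divr_gt0// mulr_gt0.
have n20 : 0 < n2 by rewrite n2E divr_gt0.
set b := th / m; have -> : 2 * th / m = 2 * b by rewrite /b; ring.
have -> : th ^+ 2 / m ^+ 2 = b ^+ 2 by rewrite /b; field; rewrite gt_eqF.
have -> : 2 * (2 / (m + a * alpha)) * (m * G + a * F) * (- F - alpha * G) =
   - 4 * n1 * G ^+ 2 - 4 * n2 * F ^+ 2 - 4 * (G * F).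
  by rewrite n1E n2E; field; rewrite gt_eqF.
have H1 := cross_le (- G) (2 * (b - E)) n10.
have H2 := cross_le (- F) (2 * b) n20.
have H3 : (2 * (b - E)) ^+ 2 / n1 <= 8 * (E ^+ 2 + b ^+ 2) / n1.
  by rewrite ler_pM2r ?invr_gt0//; have := sqr_ge0 (b + E); nra.
have H4 : (2 * b) ^+ 2 / n2 <= 4 * (E ^+ 2 + b ^+ 2) / n2.
  by rewrite ler_pM2r ?invr_gt0//; have := sqr_ge0 E; nra.
have H5 : 2 * delta * (G - F - E) ^+ 2 <= 6 * delta * (G ^+ 2 + F ^+ 2 + E ^+ 2).
  rewrite (_ : 6 * delta * _ = 2 * delta * (3 * (G ^+ 2 + F ^+ 2 + E ^+ 2))); last by ring.
  rewrite ler_pM2l ?mulr_gt0//.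
  by have := sqr_ge0 (G + F); have := sqr_ge0 (G + E); have := sqr_ge0 (F - E); nra.
have H6 : 6 * delta * G ^+ 2 <= n1 * G ^+ 2 by rewrite ler_wpM2r ?sqr_ge0.
have H7 : 6 * delta * F ^+ 2 <= n2 * F ^+ 2 by rewrite ler_wpM2r ?sqr_ge0.
have H8 : 6 * delta * E ^+ 2 <= 2 * E ^+ 2 by rewrite ler_wpM2r ?sqr_ge0//; lra.
have H9 : 4 * ((b - E) * b) <= 6 * (E ^+ 2 + b ^+ 2) by have := sqr_ge0 (E + b); nra.
set X := E ^+ 2 + b ^+ 2 in H3 H4 H9 *.
have E3 : 8 * X / n1 = 8 / n1 * X by ring.
have E4 : 4 * X / n2 = 4 / n2 * X by ring.
rewrite E3 in H3; rewrite E4 in H4; rewrite (mulrDl _ 8) (mulrDl (8 / n1)).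
move: ((2 * b) ^+ 2 / n2) ((2 * (b - E)) ^+ 2 / n1) (8 / n1 * X) (4 / n2 * X) H1 H2 H3 H4 {E3 E4}.
move=> y1 y2 x1 x2 H1 H2 H3 H4.
have -> : (G + F - (2 * b - E)) ^+ 2 - (1 - 2 * delta) * (G - F - E) ^+ 2 =
  4 * (G * F) + 2 * (- G * (2 * (b - E))) + 2 * (- F * (2 * b)) + 4 * ((b - E) * b)
  + 2 * delta * (G - F - E) ^+ 2 by ring.
rewrite !sqrrN in H1 H2.
have H5' : 6 * delta * (G ^+ 2 + F ^+ 2 + E ^+ 2) =
  6 * delta * G ^+ 2 + 6 * delta * F ^+ 2 + 6 * delta * E ^+ 2 by ring.
rewrite H5' in H5.
have XE : X = E ^+ 2 + b ^+ 2 by []; clearbody X.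
have b2 := sqr_ge0 b.
move: H1 H2 H3 H4 H5 H6 H7 H8 H9 XE b2.
move: (_ * (- G * _)) (_ * (- F * _)) (_ * (G - F - E) ^+ 2) (4 * (_ * b)) => v1 v2 v3 v4.
have -> : - 4 * n1 * G ^+ 2 = - 4 * (n1 * G ^+ 2) by ring.
have -> : 4 * n2 * F ^+ 2 = 4 * (n2 * F ^+ 2) by ring.
have -> : - (2 * n1) * G ^+ 2 = - 2 * (n1 * G ^+ 2) by ring.
have -> : 2 * n2 * F ^+ 2 = 2 * (n2 * F ^+ 2) by ring.
lra.
Qed.

(** The cross term uses up only a part of the diagonal weights, so that the
    form stays positive. *)
Lemma cross_small (m beta gamma d th y A2 A3 S2 S3 : R) :
  0 < m -> 0 < beta -> 0 < gamma -> 0 < d ->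
  S2 ^+ 2 <= A2 -> S3 ^+ 2 <= A3 -> 60 * beta * d <= 1 ->
  30 * beta * m * d <= 1 -> d * (10 + 30 * gamma ^+ 2) <= 1 ->
  `|20 * beta * d * (y * ((S2 + S3) / 2 + th + gamma * y))| <=
    A2 / 4 + A3 / 4 + m^-1 * th ^+ 2 + beta * y ^+ 2.
Proof.
move=> m0 b0 g0 d0 SA2 SA3 d1 d2 d3; set L := _ + gamma * y.
have H0 : 2 * `|y * L| <= y ^+ 2 + L ^+ 2.
  by rewrite normrM -(real_normK (num_real y)) -(real_normK (num_real L));
    have := sqr_ge0 (`|y| - `|L|); nra.
have H4 : L ^+ 2 / 3 <= A2 / 2 + A3 / 2 + th ^+ 2 + gamma ^+ 2 * y ^+ 2.
  rewrite /L; have h1 := sqr_ge0 (S2 - S3); have h2 := sqr_ge0 ((S2 + S3) / 2 - th).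
  have h3 := sqr_ge0 ((S2 + S3) / 2 - gamma * y); have h4 := sqr_ge0 (th - gamma * y).
  nra.
have bd : 0 < beta * d by rewrite mulr_gt0.
have A20 : 0 <= A2 := le_trans (sqr_ge0 _) SA2.
have A30 : 0 <= A3 := le_trans (sqr_ge0 _) SA3.
rewrite normrM gtr0_norm; last by rewrite -mulrA mulr_gt0.
have H5 : 20 * beta * d * `|y * L| <= beta * d * (10 * y ^+ 2 + 30 * (A2 / 2 + A3 / 2 + th ^+ 2 + gamma ^+ 2 * y ^+ 2)).
  rewrite (_ : 20 * beta * d * _ = beta * d * (10 * (2 * `|y * L|))); last by ring.
  by rewrite ler_pM2l//; lra.
apply: le_trans H5 _.
have t2 := sqr_ge0 th; have y2 := sqr_ge0 y.
have K1 : 60 * beta * d * A2 <= 1 * A2 by rewrite ler_wpM2r.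
have K2 : 60 * beta * d * A3 <= 1 * A3 by rewrite ler_wpM2r.
have K3 : 30 * beta * d * th ^+ 2 <= m^-1 * th ^+ 2.
  by rewrite ler_wpM2r// -div1r ler_pdivlMr// (le_trans _ d2)// le_eqVlt; apply/orP; left; apply/eqP; ring.
have K4 : d * (10 + 30 * gamma ^+ 2) * (beta * y ^+ 2) <= 1 * (beta * y ^+ 2).
  by rewrite ler_wpM2r// mulr_ge0// ltW.
have -> : beta * d * (10 * y ^+ 2 + 30 * (A2 / 2 + A3 / 2 + th ^+ 2 + gamma ^+ 2 * y ^+ 2)) =
  60 * beta * d * A2 / 4 + 60 * beta * d * A3 / 4 + 30 * beta * d * th ^+ 2
  + d * (10 + 30 * gamma ^+ 2) * (beta * y ^+ 2) by field.
clear -K1 K2 K3 K4 A20 A30 t2; lra.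
Qed.

(** Choice of the constants: delta and d small enough for the two preceding
    estimates, then B large compared with 1 / d, so that the dissipation of
    the error absorbs its action on the rod. *)
Lemma boundary_dissipation (m a alpha beta gamma : R) :
  0 < m -> 0 < a -> 0 < alpha -> 0 < beta -> 0 < gamma ->
  exists delta d B kap : R,
  [/\ 0 < delta <= 1 / 4, 0 < d <= 1 / 6, 0 < B & 0 < kap] /\
  [/\ 60 * beta * d <= 1, 30 * beta * m * d <= 1 & d * (10 + 30 * gamma ^+ 2) <= 1] /\
  forall p Q e E h th y A0 A1 A2 A3 S2 S3 : R,
  0 <= A0 -> 0 <= A1 -> S2 ^+ 2 <= A2 -> S3 ^+ 2 <= A3 ->
  ((2 * h - (m - a) * (Q + E)) / (m + a) - (2 * th / m - E)) ^+ 2 - (1 - delta) * p ^+ 2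
  + ((1 - delta) * (- p) ^+ 2 - (1 - 2 * delta) * Q ^+ 2)
  + B * ((2 * th / m - E) ^+ 2 - (1 - 3 * d) * e ^+ 2
         + (1 + 2 * d) * (((1 - gamma) * e - 2 * beta * y) / (1 + gamma)) ^+ 2 - (1 + d) * E ^+ 2)
  - (delta * A0 + delta * A1 + B * (3 * d * A2 + d * A3))
  + 2 * (2 / (m + a * alpha)) * h * (- (1 + alpha) / (m + a) * h + (m - a * alpha) / (m + a) * (Q + E))
  + B * (2 * (2 / m + d / (2 * m)) * th * (E - th / m)
         + 2 * (2 * beta) * y * ((e - beta * y) / (1 + gamma))
         + 20 * beta * d * ((e - beta * y) / (1 + gamma) * ((S2 + S3) / 2 + th + gamma * y) - beta * y ^+ 2))
  <= - kap * (A0 + A1 + A2 + A3 + (h ^+ 2 + th ^+ 2 + y ^+ 2)).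
Proof.
move=> m0 a0 al0 b0 g0.
have k0 : 0 < m + a * alpha by rewrite addr_gt0// mulr_gt0.
have ma0 : 0 < m + a by rewrite addr_gt0.
pose n1 := m * alpha / (m + a * alpha); pose n2 := a / (m + a * alpha).
have n10 : 0 < n1 by rewrite divr_gt0// mulr_gt0.
have n20 : 0 < n2 by rewrite divr_gt0.
have sq2 (x y : R) : (x + y) ^+ 2 <= 2 * x ^+ 2 + 2 * y ^+ 2.
  by have := sqr_ge0 (x - y); rewrite sqrrB sqrrD; lra.
have inv_le (x D : R) : 0 <= x -> x <= D -> 0 < D -> D^-1 * x <= 1.
  by move=> x0 xD D0; rewrite mulrC ler_pdivrMr// mul1r.
pose D1 := 4 + 6 / n1 + 6 / n2.
have q1 : 0 < 6 / n1 by rewrite divr_gt0.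
have q2 : 0 < 6 / n2 by rewrite divr_gt0.
have D10 : 0 < D1 by rewrite /D1; lra.
pose delta := D1^-1.
have de0 : 0 < delta by rewrite invr_gt0.
have de1 : delta <= 1 / 4.
  by have := @inv_le 4 D1 (ler0n _ _) _ D10; rewrite -/delta /D1 => /(_ _); lra.
have den (n : R) : 0 < n -> 6 / n <= D1 -> 6 * delta <= n.
  move=> n0 nD; have := @inv_le (6 / n) D1 (ltW (divr_gt0 (ltr0n _ 6) n0)) nD D10.
  by rewrite mulrA ler_pdivrMr// mul1r mulrC.
have de2 : 6 * delta <= n1 by apply: den => //; rewrite /D1; lra.
have de3 : 6 * delta <= n2 by apply: den => //; rewrite /D1; lra.
pose q := 1 + 4 * m ^+ 2 + gamma ^+ 2 / beta ^+ 2.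
have q0 : 0 <= q.
  by rewrite addr_ge0 ?divr_ge0 ?sqr_ge0// addr_ge0// mulr_ge0 ?sqr_ge0.
pose G := (10 * (1 + gamma) ^+ 2 + 300 * beta ^+ 2 * q).
have G0 : 0 <= G.
  have h1 := mulr_ge0 (sqr_ge0 beta) q0; have h2 := sqr_ge0 (1 + gamma).
  by rewrite /G -(mulrA 300); clearbody q; lra.
pose D := 6 + 60 * beta + 30 * beta * m + (10 + 30 * gamma ^+ 2) + G / (3 * gamma).
have bm : 0 < beta * m by rewrite mulr_gt0.
have gg := sqr_ge0 gamma.
have Gg : 0 <= G / (3 * gamma) by rewrite divr_ge0// mulr_ge0// ltW.
have bm3 : 30 * beta * m = 30 * (beta * m) by ring.
have D0 : 0 < D by rewrite /D bm3; lra.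
pose d := D^-1.
have d0 : 0 < d by rewrite invr_gt0.
have dle x : 0 <= x -> x <= D -> d * x <= 1 by move=> x0 xD; exact: inv_le.
have d1 : d <= 1 / 6 by have := @dle 6 (ler0n _ _); rewrite /D bm3 => /(_ _); lra.
have d2 : 60 * beta * d <= 1 by rewrite mulrC; apply: dle; rewrite /D ?bm3; lra.
have d3 : 30 * beta * m * d <= 1 by rewrite mulrC; apply: dle; rewrite /D ?bm3; lra.
have d4 : d * (10 + 30 * gamma ^+ 2) <= 1 by apply: dle; rewrite /D ?bm3; lra.
have d5 : d * G <= 3 * gamma.
  have GD : G / (3 * gamma) <= D by rewrite /D bm3; lra.
  have g3 : 0 < 3 * gamma by rewrite mulr_gt0.
  by have := dle _ Gg GD; rewrite mulrA ler_pdivrMr// mul1r.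
pose CC := 8 / n1 + 4 / n2 + 8.
have CC0 : 0 < CC by rewrite /CC !addr_gt0// divr_gt0.
pose B := 8 * CC / d.
have B0 : 0 < B by rewrite divr_gt0// mulr_gt0.
(* By the choice of B, d * B = 8 * CC: the coefficients left in E^2 and th^2 / m^2
   are at most - 4 CC + CC and - 2 CC + CC. *)
pose kap := Num.min (Num.min (Num.min delta (4 * CC)) (Num.min (n1 / m ^+ 2) (n2 / a ^+ 2)))
  (Num.min (CC / m ^+ 2) (40 * CC * beta ^+ 2)).
have [kap0 K] : 0 < kap /\ [/\ kap <= delta, kap <= 4 * CC, kap <= n1 / m ^+ 2 & kap <= n2 / a ^+ 2]
   /\ [/\ kap <= CC / m ^+ 2 & kap <= 40 * CC * beta ^+ 2].
  split; last by split; split; rewrite /kap !ge_min lexx ?orbT.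
  by rewrite /kap !lt_min de0 !divr_gt0 ?mulr_gt0 ?exprn_gt0.
case: K => [[K1 K2 K3 K4] [K5 K6]].
exists delta, d, B, kap; do !split => //; try by apply/andP.
move=> p Q e E h th y A0 A1 A2 A3 S2 S3 A00 A10 SA2 SA3.
(* G1 = psi(1) and F1 = phi'(1), recovered from h and the outgoing values. *)
pose G1 := (h + a * (Q + E)) / (m + a); pose F1 := (h - m * (Q + E)) / (m + a).
have ma1 : m + a != 0 by rewrite gt_eqF.
have m1 : m != 0 by rewrite gt_eqF.
have hE : h = m * G1 + a * F1 by rewrite /G1 /F1; field.
have QE : Q = G1 - F1 - E by rewrite /G1 /F1; field.
have H1 := rod_boundary E th m0 a0 al0 de0 de1 erefl erefl de2 de3 hE.
have H2 := error_boundary E th e y m0 b0 g0 d0 SA2 SA3 erefl d5.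
have {}H2 := ler_wpM2l (ltW B0) H2.
rewrite (_ : (2 * h - (m - a) * (Q + E)) / (m + a) = G1 + F1); last by rewrite /G1 /F1; field.
rewrite (_ : - (1 + alpha) / (m + a) * h + (m - a * alpha) / (m + a) * (Q + E) = - F1 - alpha * G1); last by rewrite /G1 /F1; field.
have EE : (G1 - F1 - E) ^+ 2 = Q ^+ 2 by rewrite QE.
rewrite -/n1 -/n2 -/CC EE in H1.
apply: le_trans (_ : (G1 + F1 - (2 * th / m - E)) ^+ 2 - (1 - 2 * delta) * Q ^+ 2 +
  2 * (2 / (m + a * alpha)) * h * (- F1 - alpha * G1) - delta * A0 - delta * A1 +
  B * (- (d / 2) * E ^+ 2 - d / (4 * m ^+ 2) * th ^+ 2 - 5 * d * beta ^+ 2 * y ^+ 2 - d / 2 * A2 - d / 2 * A3) <= _).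
  apply: le_trans (lerD (lexx _) H2); rewrite le_eqVlt; apply/orP; left; apply/eqP.
  by move: (_ / (1 + gamma)) (_ / (1 + gamma)) (2 * th / m) (2 / m + _) (th / m) => *; ring.
have Bd : B * d = 8 * CC by rewrite /B divfK// gt_eqF.
have -> : B * (- (d / 2) * E ^+ 2 - d / (4 * m ^+ 2) * th ^+ 2 - 5 * d * beta ^+ 2 * y ^+ 2 - d / 2 * A2 - d / 2 * A3) =
  - (4 * CC) * E ^+ 2 - 2 * (CC / m ^+ 2 * th ^+ 2) - 40 * CC * beta ^+ 2 * y ^+ 2 - 4 * CC * A2 - 4 * CC * A3.
  rewrite (_ : B * _ = B * d * (- E ^+ 2 / 2 - (4 * m ^+ 2)^-1 * th ^+ 2 - 5 * beta ^+ 2 * y ^+ 2 - A2 / 2 - A3 / 2)).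
    by rewrite Bd; field.
  by field.
have A20 : 0 <= A2 := le_trans (sqr_ge0 _) SA2.
have A30 : 0 <= A3 := le_trans (sqr_ge0 _) SA3.
have L0 := ler_wpM2r A00 K1; have L1 := ler_wpM2r A10 K1.
have L2 := ler_wpM2r A20 K2; have L3 := ler_wpM2r A30 K2.
have L4 := ler_wpM2r (sqr_ge0 th) K5; have L5 := ler_wpM2r (sqr_ge0 y) K6.
have L6 : kap * h ^+ 2 <= 2 * n1 * G1 ^+ 2 + 2 * n2 * F1 ^+ 2.
  have hh : h ^+ 2 <= 2 * (m ^+ 2 * G1 ^+ 2) + 2 * (a ^+ 2 * F1 ^+ 2).
    by rewrite hE -!exprMn; exact: sq2.
  apply: le_trans (ler_wpM2l (ltW kap0) hh) _.
  have M1 : kap * (m ^+ 2 * G1 ^+ 2) <= n1 * G1 ^+ 2.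
    by rewrite mulrA ler_wpM2r ?sqr_ge0// -ler_pdivlMr ?exprn_gt0.
  have M2 : kap * (a ^+ 2 * F1 ^+ 2) <= n2 * F1 ^+ 2.
    by rewrite mulrA ler_wpM2r ?sqr_ge0// -ler_pdivlMr ?exprn_gt0.
  by clear -M1 M2; rewrite mulrDr; lra.
have CE : 0 <= CC * E ^+ 2 by rewrite mulr_ge0 ?sqr_ge0// ltW.
have T1 : CC * (E ^+ 2 + th ^+ 2 / m ^+ 2) = CC * E ^+ 2 + CC / m ^+ 2 * th ^+ 2 by field.
rewrite T1 in H1.
have -> : - kap * (A0 + A1 + A2 + A3 + (h ^+ 2 + th ^+ 2 + y ^+ 2)) = - (kap * A0 + kap * A1
  + kap * A2 + kap * A3 + (kap * h ^+ 2 + kap * th ^+ 2 + kap * y ^+ 2)) by ring.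
have E1 : 40 * CC * beta ^+ 2 * y ^+ 2 = 40 * (CC * beta ^+ 2 * y ^+ 2) by ring.
have E2 : 4 * CC * A2 = 4 * (CC * A2) by ring.
have E3 : 4 * CC * A3 = 4 * (CC * A3) by ring.
have E4 : - (4 * CC) * E ^+ 2 = - 4 * (CC * E ^+ 2) by ring.
rewrite E1 in L5 *; rewrite E2 in L2 *; rewrite E3 in L3 *; rewrite E4.
move: H1 L0 L1 L2 L3 L4 L5 L6 CE.
move: (2 * n1) (2 * n2) => c1 c2; rewrite (mulNr c1).
move: (_ - (1 - 2 * delta) * _ + _) (CC * E ^+ 2) (CC / m ^+ 2 * _) => u1 u2 u3.
move: (CC * A2) (CC * A3) (CC * beta ^+ 2 * _) (c1 * _) (c2 * _) => u4 u5 u6 u7 u8.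
move: (kap * A0) (kap * A1) (kap * A2) (kap * A3) (kap * _ ^+ 2) (kap * _ ^+ 2) (kap * _ ^+ 2) => k1 k2 k3 k4 k5 k6 k7.
move: (delta * A0) (delta * A1) => k8 k9.
clear -kap0; lra.
Qed.

End Constants.

(** * The Lyapunov form *)
Section Lyapunov.
Variable R : realType.
Local Notation mu := (@lebesgue_measure R).
Local Notation I01 := (@I01 R).

Definition list_mx (l : seq (seq R)) i j : R := nth 0 (nth [::] l i) j.

Lemma big_ord4 (F : 'I_4 -> R) : \sum_j F j =
  F (inord 0) + F (inord 1) + F (inord 2) + F (inord 3).
Proof.
rewrite !big_ord_recr big_ord0/= add0r.
by do ![congr (_ + _)]; congr F; apply: val_inj; rewrite /= inordK.
Qed.

Lemma big_ord3 (F : 'I_3 -> R) : \sum_j F j = F (inord 0) + F (inord 1) + F (inord 2).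
Proof.
rewrite !big_ord_recr big_ord0/= add0r.
by do ![congr (_ + _)]; congr F; apply: val_inj; rewrite /= inordK.
Qed.

Variables m a alpha beta gamma : R.

(** Coefficients of the system in the coordinates: w 0, w 1 are the waves of u
    and w 2, w 3 those of the error phi - f; the scalars are h, h - eta and
    phi(0).  The rows 2 and 3 of M and P involve only the error. *)
Definition cM (j i : 'I_4) : R := list_mx
  [:: [:: 0; - (m - a) / (m + a); 0; 1 - (m - a) / (m + a)];
      [:: - 1; 0; 0; 0]; [:: 0; 0; 0; - 1];
      [:: 0; 0; (1 - gamma) / (1 + gamma); 0]] j i.

Definition cP (j : 'I_4) (i : 'I_3) : R := list_mx
  [:: [:: 2 / (m + a); - 2 / m; 0]; [:: 0; 0; 0]; [:: 0; 2 / m; 0];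
      [:: 0; 0; - 2 * beta / (1 + gamma)]] j i.

Definition cK (i : 'I_3) : R :=
  nth 0 [:: - (1 + alpha) / (m + a); - m^-1; - beta / (1 + gamma)] i.

Definition cJ (i : 'I_3) (j : 'I_4) : R := list_mx
  [:: [:: 0; (m - a * alpha) / (m + a); 0; (m - a * alpha) / (m + a)];
      [:: 0; 0; 0; 1]; [:: 0; 0; (1 + gamma)^-1; 0]] i j.

Definition system_op := transport_op cM cP cK cJ.

(** A combination of the error coordinates whose derivative along the flow is
    - beta * phi(0): its product with phi(0) makes the constant mode decay. *)
Definition mean_mode (w : 'I_4 -> R -> R) (z : 'I_3 -> R) : R :=
  (\int[mu]_(x in I01) w (inord 2) x + \int[mu]_(x in I01) w (inord 3) x) / 2
  + z (inord 1) + gamma * z (inord 2).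

Variables delta d B : R.

(** The weights of the error carry the factor B. *)
Definition lyap_r (j : 'I_4) : R := nth 0 [:: 1; 1 - delta; B; B * (1 + 2 * d)] j.
Definition lyap_s (j : 'I_4) : R := nth 0 [:: delta; delta; B * (3 * d); B * d] j.
Definition lyap_c (i : 'I_3) : R :=
  nth 0 [:: 2 / (m + a * alpha); B * (2 / m + d / (2 * m)); B * (2 * beta)] i.

Definition lyap (w w' : 'I_4 -> R -> R) (z z' : 'I_3 -> R) : R :=
  weighted_form lyap_r lyap_s lyap_c w w' z z' +
  10 * beta * d * B * (z (inord 2) * mean_mode w' z' + z' (inord 2) * mean_mode w z).

Lemma lyapC w w' z z' : lyap w w' z z' = lyap w' w z' z.
Proof.
rewrite /lyap /weighted_form; congr (_ + _ + _).
- by apply: eq_bigr => j _; apply: eq_Rintegral => x _; ring.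
- by apply: eq_bigr => i _; ring.
- by ring.
Qed.

Lemma lyap_ae w1 w2 w z1 z2 z : (forall j, sqint I01 (w1 j)) ->
  (forall j, sqint I01 (w2 j)) -> (forall j, sqint I01 (w j)) ->
  (forall j, {ae mu, forall x, I01 x -> w1 j x = w2 j x}) -> z1 =1 z2 ->
  lyap w1 w z1 z = lyap w2 w z2 z.
Proof.
move=> h1 h2 h ww zz; have mI := @measurable_I01 R.
have mr j : measurable_fun I01 (fun x => lyap_r j - lyap_s j * x).
  by apply: measurable_funB => //; exact: measurable_funM.
have E j : \int[mu]_(x in I01) w1 j x = \int[mu]_(x in I01) w2 j x.
  by apply: ae_eq_Rintegral => //; [case: (h1 j)|case: (h2 j)].
rewrite /lyap /weighted_form /mean_mode !zz !E; congr (_ + _ + _).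
- apply: eq_bigr => j _; apply: ae_eq_Rintegral => //.
  + by apply: measurable_funM => //; apply: measurable_funM; [case: (h1 j)|case: (h j)].
  + by apply: measurable_funM => //; apply: measurable_funM; [case: (h2 j)|case: (h j)].
  + by apply: ae_sub (ww j) => x e Ix; rewrite e.
- by apply: eq_bigr => i _; rewrite zz.
Qed.

Lemma lyapD w1 w2 w z1 z2 z : (forall j, sqint I01 (w1 j)) ->
  (forall j, sqint I01 (w2 j)) -> (forall j, sqint I01 (w j)) ->
  lyap (fun j x => w1 j x + w2 j x) w (fun i => z1 i + z2 i) z =
  lyap w1 w z1 z + lyap w2 w z2 z.
Proof.
move=> h1 h2 h; have mI := @measurable_I01 R.
have E j : \int[mu]_(x in I01) (w1 j x + w2 j x) =
    \int[mu]_(x in I01) w1 j x + \int[mu]_(x in I01) w2 j x.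
  by rewrite RintegralD//; apply: sqint_integ => //; exact: finite_I01.
rewrite /lyap /weighted_form /mean_mode !E.
rewrite (eq_bigr (fun j =>
  \int[mu]_(x in I01) ((lyap_r j - lyap_s j * x) * (w1 j x * w j x)) +
  \int[mu]_(x in I01) ((lyap_r j - lyap_s j * x) * (w2 j x * w j x)))); last first.
  move=> j _; rewrite -RintegralD//; [|exact: weight_integ|exact: weight_integ].
  by apply: eq_Rintegral => x _; ring.
rewrite big_split/= !big_ord3; ring.
Qed.

Lemma lyapZ r w1 w z1 z : (forall j, sqint I01 (w1 j)) -> (forall j, sqint I01 (w j)) ->
  lyap (fun j x => r * w1 j x) w (fun i => r * z1 i) z = r * lyap w1 w z1 z.
Proof.
move=> h1 h; have mI := @measurable_I01 R.
have E j : \int[mu]_(x in I01) (r * w1 j x) = r * \int[mu]_(x in I01) w1 j x.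
  by rewrite RintegralZl//; apply: sqint_integ => //; exact: finite_I01.
rewrite /lyap /weighted_form /mean_mode !E.
rewrite (eq_bigr (fun j =>
  r * \int[mu]_(x in I01) ((lyap_r j - lyap_s j * x) * (w1 j x * w j x)))); last first.
  move=> j _; rewrite -RintegralZl//; last exact: weight_integ.
  by apply: eq_Rintegral => x _; ring.
rewrite -mulr_sumr !big_ord3; ring.
Qed.

Definition sqnorm (w : 'I_4 -> R -> R) (z : 'I_3 -> R) : R :=
  \sum_j \int[mu]_(x in I01) w j x ^+ 2 + \sum_i z i ^+ 2.

End Lyapunov.

Section LyapunovEstimates.
Variable R : realType.
Local Notation mu := (@lebesgue_measure R).
Local Notation I01 := (@I01 R).

Lemma weighted_sqr_bounds (r s l u : R) f : sqint I01 f -> 0 <= s -> l <= r - s -> r <= u ->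
  l * \int[mu]_(x in I01) f x ^+ 2 <=
    \int[mu]_(x in I01) ((r - s * x) * (f x * f x)) <= u * \int[mu]_(x in I01) f x ^+ 2.
Proof.
move=> hf s0 lr ru; have mI := @measurable_I01 R.
have i2 := sqint_sqr mI hf; have iw := weight_integ (fun=> r) (fun=> s) (ord0 : 'I_1) hf hf.
have [il iu] := (integZ l mI i2, integZ u mI i2).
rewrite -!RintegralZl//; apply/andP; split; apply: le_Rintegral => // x;
  rewrite /Defs.I01/= in_itv/= => /andP[x0 x1]; rewrite -expr2 ler_wpM2r ?sqr_ge0//.
  by rewrite (le_trans lr)// lerB// ler_piMr// ltW.
by rewrite (le_trans _ ru)// lerBlDr lerDl mulr_ge0// ltW.
Qed.

Variables m a alpha beta gamma : R.
Hypotheses (m0 : 0 < m) (a0 : 0 < a) (alpha0 : 0 < alpha) (beta0 : 0 < beta) (gamma0 : 0 < gamma).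

(** The balance of the weighted form is an identity in the outgoing values, so
    that the decay is an instance of boundary_dissipation; the means of the
    waves are bounded by their norms. *)
Lemma lyapunov_form : exists delta d B lam c C : R, [/\ 0 < lam, 0 < c & 0 < C] /\
  let b := lyap m a alpha beta gamma delta d B in
  (forall w z w' z', (forall j, sqint I01 (w j)) -> (forall j, sqint I01 (w' j)) ->
    system_op m a alpha beta gamma w z w' z' -> b w' w z' z <= - lam * b w w z z) /\
  (forall w z, (forall j, sqint I01 (w j)) -> c * sqnorm w z <= b w w z z <= C * sqnorm w z).
Proof.
have [delta [d [B [kap [[/andP[de0 de1] /andP[d0 d1] B0 kap0] [[d2 d3 d4] H]]]]]] :=
  boundary_dissipation m0 a0 alpha0 beta0 gamma0.
have k0 : 0 < m + a * alpha by rewrite addr_gt0// mulr_gt0.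
pose ch := 2 / (m + a * alpha); have ch0 : 0 < ch by rewrite divr_gt0.
pose c := Num.min (Num.min (1 / 2) (B / 4)) (Num.min ch (Num.min (B / m) (B * beta))).
pose C := 1 + 3 * B + ch + B * (4 / m) + 3 * (B * beta).
have mV : 0 < m^-1 by rewrite invr_gt0.
have Bm : 0 < B / m by rewrite mulr_gt0.
have Bb : 0 < B * beta by rewrite mulr_gt0.
have c0 : 0 < c by rewrite /c !lt_min ch0 Bm Bb divr_gt0// divr_gt0.
have B4 : B * (4 / m) = 4 * (B / m) by ring.
have C0 : 0 < C by rewrite /C B4; lra.
have bnd w z : (forall j, sqint I01 (w j)) ->
    c * sqnorm w z <= lyap m a alpha beta gamma delta d B w w z z <= C * sqnorm w z.
  move=> hw; rewrite /lyap /weighted_form /sqnorm !big_ord4 !big_ord3.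
  pose A j := \int[mu]_(x in I01) w (inord j) x ^+ 2.
  pose S j := \int[mu]_(x in I01) w (inord j) x.
  have SA j : S j ^+ 2 <= A j.
    by have := sqr_Rintegral_le (@measurable_I01 R) (@lebesgue_measure_I01 R) (hw (inord j)); rewrite mul1r.
  have A0 j : 0 <= A j := le_trans (sqr_ge0 _) (SA j).

  have bd2 : 3 * d <= 1 / 2 by lra.
  have /andP[T0 T0'] : 1 / 2 * A 0%N <= \int[mu]_(x in I01) ((1 - delta * x) * (w (inord 0) x * w (inord 0) x)) <= 1 * A 0%N.
    by apply: (weighted_sqr_bounds (hw _)); lra.
  have /andP[T1 T1'] : 1 / 2 * A 1%N <= \int[mu]_(x in I01) ((1 - delta - delta * x) * (w (inord 1) x * w (inord 1) x)) <= 1 * A 1%N.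
    by apply: (weighted_sqr_bounds (hw _)); lra.
  have Bd : 0 <= B * d by rewrite mulr_ge0 ?ltW.
  have Bd1 : B * d <= B / 6 by rewrite ler_pM2l//; lra.
  have /andP[T2 T2'] : B / 2 * A 2%N <= \int[mu]_(x in I01) ((B - B * (3 * d) * x) * (w (inord 2) x * w (inord 2) x)) <= B * A 2%N.
    by apply: (weighted_sqr_bounds (hw _)); rewrite ?(mulrCA B 3); lra.
  have /andP[T3 T3'] : B * A 3%N <= \int[mu]_(x in I01) ((B * (1 + 2 * d) - B * d * x) * (w (inord 3) x * w (inord 3) x)) <= 2 * B * A 3%N.
    by apply: (weighted_sqr_bounds (hw _)); rewrite ?mulrDr ?(mulrCA B 2); lra.
  have := cross_small (z (inord 1)) (z (inord 2)) m0 beta0 gamma0 d0 (SA 2%N) (SA 3%N) d2 d3 d4.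
  rewrite /lyap_r /lyap_s /lyap_c !inordK//= -/(mean_mode gamma w z) -!/(A _).
  set X := 20 * beta * d * _.
  have -> : 10 * beta * d * B * (z (inord 2) * mean_mode gamma w z + z (inord 2) * mean_mode gamma w z) = B * X.
    by rewrite /X /mean_mode -!/(S _); ring.
  move: (z (inord 0)) (z (inord 1)) (z (inord 2)) T0 T0' T1 T1' T2 T2' T3 T3' => h th y.
  move: (\int[mu]_(x in I01) ((1 - delta * x) * _)) (\int[mu]_(x in I01) ((1 - delta - delta * x) * _)) => t0 t1.
  move: (\int[mu]_(x in I01) ((B - B * (3 * d) * x) * _)) (\int[mu]_(x in I01) ((B * (1 + 2 * d) - B * d * x) * _)) => t2 t3.
  move=> T0 T0' T1 T1' T2 T2' T3 T3'; rewrite ler_norml => /andP[X1 X2].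
  have {}X1 := ler_wpM2l (ltW B0) X1; have {}X2 := ler_wpM2l (ltW B0) X2.
  have h2 := sqr_ge0 h; have th2 := sqr_ge0 th; have y2 := sqr_ge0 y.
  have [c1 [c2 [c3 [c4 c5]]]] : c <= 1 / 2 /\ c <= B / 4 /\ c <= ch /\ c <= B / m /\ c <= B * beta.
    by do !split; rewrite /c !ge_min lexx ?orbT.
  have U0 := ler_wpM2r (A0 0%N) c1; have U1 := ler_wpM2r (A0 1%N) c1.
  have U2 := ler_wpM2r (A0 2%N) c2; have U3 := ler_wpM2r (A0 3%N) c2.
  have U4 := ler_wpM2r h2 c3; have U5 := ler_wpM2r th2 c4; have U6 := ler_wpM2r y2 c5.
  have [C1 [C2 [C3 [C4 C5]]]] : 1 <= C /\ 3 * B <= C /\ ch <= C /\ B * (4 / m) <= C /\ 3 * (B * beta) <= C.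
    by rewrite /C B4; do !split; lra.
  have V0 := ler_wpM2r (A0 0%N) C1; have V1 := ler_wpM2r (A0 1%N) C1.
  have V2 := ler_wpM2r (A0 2%N) C2; have V3 := ler_wpM2r (A0 3%N) C2.
  have V4 := ler_wpM2r h2 C3; have V5 := ler_wpM2r th2 C4; have V6 := ler_wpM2r y2 C5.
  have BA2 := mulr_ge0 (ltW B0) (A0 2%N); have BA3 := mulr_ge0 (ltW B0) (A0 3%N).
  have W1 : 0 <= B * (d / (2 * m) * th ^+ 2).
    apply: mulr_ge0 (ltW B0) (mulr_ge0 _ th2); apply: divr_ge0 (ltW d0) _.
    exact: mulr_ge0 (ler0n _ 2) (ltW m0).
  have W2 : B * (d / (2 * m) * th ^+ 2) <= B / m * th ^+ 2.
    rewrite (_ : B * _ = B / m * th ^+ 2 * (d / 2)); last by field; rewrite gt_eqF.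
    have d21 : d / 2 <= 1 by lra.
    exact: ler_piMr (mulr_ge0 (ltW Bm) th2) d21.
  have -> : B * (2 / m + d / (2 * m)) * (th * th) = 2 * (B / m * th ^+ 2) + B * (d / (2 * m) * th ^+ 2) by ring.
  rewrite -/ch -[h * h]expr2 -[y * y]expr2 (mulrCA B 2 beta) -(mulrA 2 (B * beta)).
  rewrite B4 -(mulrA 4) in V5; rewrite -(mulrA 3) in V6; rewrite -(mulrA 2 B) in T3'; rewrite -(mulrA 3 B) in V2; rewrite -(mulrA 3 B) in V3.
  have XE : B * (A 2%N / 4 + A 3%N / 4 + m^-1 * th ^+ 2 + beta * y ^+ 2) =
    (B * A 2%N) / 4 + (B * A 3%N) / 4 + B / m * th ^+ 2 + B * beta * y ^+ 2 by ring.
  rewrite mulrN XE in X1; rewrite XE in X2.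
  have B3 n : B / n * A 2%N = B * A 2%N / n by ring.
  have B5 n : B / n * A 3%N = B * A 3%N / n by ring.
  rewrite B3 in T2; rewrite B3 in U2; rewrite B5 in U3.
  rewrite !(mulrDr c) !(mulrDr C).
  clearbody A S X ch c C.
  move: X1 X2 U0 U1 U2 U3 U4 U5 U6 V0 V1 V2 V3 V4 V5 V6 BA2 BA3 W1 W2 T0 T0' T1 T1' T2 T2' T3 T3'.
  move: (B * A 2%N) (B * A 3%N) (B / m * _) (B * beta * _) (B * X) (B * (d / _ * _)) (ch * _) => x1 x2 x3 x4 x5 x6 x7.
  move: (c * A 0%N) (c * A 1%N) (c * A 2%N) (c * A 3%N) (c * h ^+ 2) (c * th ^+ 2) (c * y ^+ 2) => u0 u1 u2 u3 u4 u5 u6.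
  move: (C * A 0%N) (C * A 1%N) (C * A 2%N) (C * A 3%N) (C * h ^+ 2) (C * th ^+ 2) (C * y ^+ 2) => v0 v1 v2 v3 v4 v5 v6.
  by clear; move=> *; apply/andP; split; lra.
exists delta, d, B, (kap / (2 * C)), c, C; split; first by split => //; rewrite divr_gt0// mulr_gt0.
move=> b; split; last exact: bnd.
move=> w z w' z' hw hw' op; have [e [He z'E mE]] := transport_balance (lyap_r delta d B) (lyap_s delta d B)
  (lyap_c m a alpha beta d B) hw hw' op.
have /andP[_ b2] := bnd w z hw.
have : 2 * b w' w z' z <= - kap * sqnorm w z; last first.
  have CN : kap / (2 * C) * b w w z z <= kap / (2 * C) * (C * sqnorm w z).
    by rewrite ler_pM2l// divr_gt0// mulr_gt0.
  rewrite (_ : kap / (2 * C) * (C * sqnorm w z) = kap * sqnorm w z / 2) in CN; last by field; rewrite gt_eqF.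
  rewrite !mulNr; move: CN.
  move: (kap * sqnorm w z) (kap / (2 * C) * b w w z z) (b w' w z' z) => x1 x2 x3; lra.
pose A j := \int[mu]_(x in I01) w (inord j) x ^+ 2.
pose S j := \int[mu]_(x in I01) w (inord j) x.
have SA j : S j ^+ 2 <= A j.
  by have := sqr_Rintegral_le (@measurable_I01 R) (@lebesgue_measure_I01 R) (hw (inord j)); rewrite mul1r.
have A0 j : 0 <= A j := le_trans (sqr_ge0 _) (SA j).
have := H (e (inord 0)) (e (inord 1)) (e (inord 2)) (e (inord 3)) (z (inord 0)) (z (inord 1)) (z (inord 2))
  _ _ _ _ _ _ (A0 0%N) (A0 1%N) (SA 2%N) (SA 3%N).
rewrite [sqnorm _ _]/sqnorm big_ord4 big_ord3; apply: le_trans.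
rewrite /b /lyap mulrDr He /mean_mode !mE !big_ord4 !big_ord3 !z'E !big_ord4.
rewrite /lyap_r /lyap_s /lyap_c /cM /cP /cK /cJ /list_mx !inordK//=.
rewrite -!/(A _) -!/(S _).
rewrite le_eqVlt; apply/orP; left; apply/eqP.
by field; rewrite !gt_eqF// addr_gt0.
Qed.

End LyapunovEstimates.

(** * Real coordinates of complex states *)
Section ComplexFunctions.
Variable R : realType.
Local Notation C := R[i].
Local Notation mu := (@lebesgue_measure R).
Local Notation I01 := (@I01 R).
Implicit Types (f g : R -> C) (p : bool).

(** Real and imaginary parts are indexed by bool in order to state every
    property once for both. *)
Definition part p (z : C) : R := if p then complex.Re z else complex.Im z.
Definition mkc (v : bool -> R) : C := (v true +i* v false)%C.

Lemma part_mkc p v : part p (mkc v) = v p. Proof. by case: p. Qed.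

Lemma part_inj z z' : (forall p, part p z = part p z') -> z = z'.
Proof.
by case: z z' => [x y] [x' y'] H; move: (H true) (H false) => /= -> ->.
Qed.

Lemma part0 p : part p 0 = 0. Proof. by case: p. Qed.
Lemma partD p z z' : part p (z + z') = part p z + part p z'.
Proof. by case: p; case: z z' => [x y] [x' y']. Qed.
Lemma partN p z : part p (- z) = - part p z.
Proof. by case: p; case: z => [x y]. Qed.
Lemma partB p z z' : part p (z - z') = part p z - part p z'.
Proof. by rewrite partD partN. Qed.
Lemma partZ p r z : part p (r%:C%C * z) = r * part p z.
Proof. by case: p; case: z => [x y] /=; rewrite mul0r ?subr0 ?addr0. Qed.

Lemma sqmodE (z : C) : sqmod z = part true z ^+ 2 + part false z ^+ 2.
Proof. by []. Qed.

Lemma L2_sqint f : L2 f <-> forall p, sqint I01 (fun x => part p (f x)).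
Proof.
have mI := @measurable_I01 R; split=> [[mr mi fi] p|H]; last first.
  have [m1 i1] := H true; have [m2 i2] := H false; split => //.
  change (\int[mu]_(x in I01) ((part true (f x) ^+ 2)%:E + (part false (f x) ^+ 2)%:E) < +oo)%E.
  rewrite ge0_integralD//; [exact: lte_add_pinfty| | | |]; do ?by move=> x _; rewrite lee_fin sqr_ge0.
    by apply/measurable_EFinP; exact: measurable_funX.
  by apply/measurable_EFinP; exact: measurable_funX.
split; first by case: p.
apply: le_lt_trans fi; apply: ge0_le_integral => //.
- by move=> x _; rewrite lee_fin sqr_ge0.
- by apply/measurable_EFinP/measurable_funX; case: p.
- by apply/measurable_EFinP; apply: measurable_funD; exact: measurable_funX.
- by move=> x _; rewrite lee_fin /sqmod; case: p; rewrite ?lerDl ?lerDr sqr_ge0.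
Qed.

Lemma part_cintegral p D (f : R -> C) :
  part p (cintegral D f) = \int[mu]_(x in D) part p (f x).
Proof. by case: p. Qed.

Lemma has_wderivP f (f1 : R -> C) :
  has_wderiv f f1 <-> L2 f1 /\ forall p, weak_deriv (fun x => part p (f x)) (fun x => part p (f1 x)).
Proof.
have E p w (h : R -> C) : part p (cintegral I01 (fun x => h x * (w x)%:C%C)) =
    \int[mu]_(x in I01) (part p (h x) * w x).
  rewrite part_cintegral; apply: eq_Rintegral => x _.
  by rewrite mulrC partZ mulrC.
split=> -[hL H]; split => //.
  by move=> p w hw; have := congr1 (part p) (H w hw); rewrite E partN E.
by move=> w hw; apply: part_inj => p; rewrite E partN E; exact: H.
Qed.

Lemma H1_sqint f : H1 f -> forall p, sqint I01 (fun x => part p (f x)).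
Proof. by case=> /L2_sqint. Qed.

Lemma has_wderiv_sqint f (f1 : R -> C) : has_wderiv f f1 -> forall p, sqint I01 (fun x => part p (f1 x)).
Proof. by case=> /L2_sqint. Qed.

Lemma H1_primitive f (f1 : R -> C) : H1 f -> has_wderiv f f1 -> forall p,
  primitive_on 0 1 (fun x => part p (f1 x)) (fun x => part p (f x)).
Proof.
move=> [hf cr ci _] /has_wderivP[/L2_sqint h1 wd] p.
apply: du_Bois_Reymond (wd p); first by case: p.
exact: sqint_integ (@measurable_I01 R) (@finite_I01 R) (h1 p).
Qed.

Lemma primitive_H1 f (f1 : R -> C) : (forall p, sqint I01 (fun x => part p (f1 x))) ->
  (forall p, primitive_on 0 1 (fun x => part p (f1 x)) (fun x => part p (f x))) ->
  H1 f /\ has_wderiv f f1.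
Proof.
move=> h1 pr; have mI := @measurable_I01 R; have fI := @finite_I01 R.
have i1 p := sqint_integ mI fI (h1 p).
have W : has_wderiv f f1.
  by apply/has_wderivP; split; [exact/L2_sqint|move=> p; exact: primitive_weak_deriv].
split => //; split; last by exists f1.
- by apply/L2_sqint => p; exact: primitive_sqint (i1 p) (pr p).
- exact: (primitive_continuous ler01 ((integ_I01_cc _).1 (i1 true)) (pr true)).
- exact: (primitive_continuous ler01 ((integ_I01_cc _).1 (i1 false)) (pr false)).
Qed.

Lemma wderivP f : H1 f -> has_wderiv f (wderiv f).
Proof. by case=> _ _ _ [f1 W]; rewrite /wderiv; apply: (@xgetPex _ _ [set f1 | has_wderiv f f1]); exists f1. Qed.

Lemma wderiv_ae f (f1 : R -> C) : H1 f -> has_wderiv f f1 -> forall p,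
  {ae mu, forall x, I01 x -> part p (wderiv f x) = part p (f1 x)}.
Proof.
move=> hf W p; have W' := wderivP hf.
apply: (weak_deriv_unique (H1_sqint hf p) (has_wderiv_sqint W' p) (has_wderiv_sqint W p)).
  by case/has_wderivP: W'.
by case/has_wderivP: W.
Qed.

End ComplexFunctions.

Section Coordinates.
Variable R : realType.
Local Notation C := R[i].
Local Notation mu := (@lebesgue_measure R).
Local Notation I01 := (@I01 R).
Implicit Types (f g F G phi psi : R -> C) (p : bool) (r : R).

Lemma ae_reflect (c : R) (P : R -> Prop) :
  {ae mu, forall x, P x} -> {ae mu, forall x, P (c - x)}.
Proof.
move=> [N [mN N0 hN]]; exists [set x | N (c - x)]; split.
- by rewrite -[X in measurable X]setTI; exact: measurable_reflect.
- by rewrite -N0; exact: lebesgue_measure_reflect.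
- by move=> x /hN.
Qed.

Lemma I01_reflect x : I01 x -> I01 (1 - x).
Proof. by rewrite /Defs.I01/= !in_itv/= => /andP[x0 x1]; apply/andP; split; lra. Qed.

Lemma reflect_I01 : [set x | I01 (1 - x)] = I01.
Proof.
by apply/seteqP; split => x /I01_reflect //; rewrite subKr.
Qed.

Lemma sqint_I01_reflect (u : R -> R) : sqint I01 u -> sqint I01 (fun x => u (1 - x)).
Proof. by move=> /(sqint_reflect 1 (@measurable_I01 R)); rewrite reflect_I01. Qed.

Lemma Rintegral_I01_reflect (u : R -> R) : integ I01 u ->
  \int[mu]_(x in I01) u (1 - x) = \int[mu]_(x in I01) u x.
Proof. by move=> /(Rintegral_reflect 1 (@measurable_I01 R)); rewrite reflect_I01. Qed.

(** Characteristic coordinates of u and of the error phi - f, in terms of the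
    slopes F, G and the velocities g, psi of u and phi.  The first wave of
    each pair is reflected, so that all four travel from 0 to 1. *)
Definition waves p F g G psi (j : 'I_4) (x : R) : R := part p (nth 0
  [:: g (1 - x) + F (1 - x); g x - F x;
      psi (1 - x) - g (1 - x) + (G (1 - x) - F (1 - x));
      psi x - g x - (G x - F x)] j).

Definition end_scalars p (eta h y : C) (i : 'I_3) : R :=
  part p (nth 0 [:: h; h - eta; y] i).

Lemma waves_ae p F g G psi F' g' G' psi' :
  {ae mu, forall x, I01 x -> part p (F x) = part p (F' x)} ->
  {ae mu, forall x, I01 x -> part p (g x) = part p (g' x)} ->
  {ae mu, forall x, I01 x -> part p (G x) = part p (G' x)} ->
  {ae mu, forall x, I01 x -> part p (psi x) = part p (psi' x)} ->
  forall j, {ae mu, forall x, I01 x -> waves p F g G psi j x = waves p F' g' G' psi' j x}.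
Proof.
move=> eF eg eG ep j.
have q1 := ae_sub2 (fun x a b => conj a b) (ae_sub2 (fun x a b => conj a b) eF eg)
  (ae_sub2 (fun x a b => conj a b) eG ep).
apply: ae_sub2 q1 (ae_reflect 1 q1) => x [[a1 a2] [a3 a4]] [[b1 b2] [b3 b4]] Ix.
have Jx := I01_reflect Ix.
case: j => [[|[|[|[|//]]]] ?]; rewrite /waves/= !(partD, partN);
  by rewrite ?a1 ?a2 ?a3 ?a4 ?b1 ?b2 ?b3 ?b4.
Qed.

Lemma waves_sqint p F g G psi : sqint I01 (fun x => part p (F x)) ->
  sqint I01 (fun x => part p (g x)) -> sqint I01 (fun x => part p (G x)) ->
  sqint I01 (fun x => part p (psi x)) -> forall j, sqint I01 (waves p F g G psi j).
Proof.
move=> hF hg hG hp j; have mI := @measurable_I01 R.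
have rF := sqint_I01_reflect hF; have rg := sqint_I01_reflect hg.
have rG := sqint_I01_reflect hG; have rp := sqint_I01_reflect hp.
case: j => [[|[|[|[|//]]]] ?]; rewrite /waves/=.
- by have := sqintD mI rg rF; congr sqint; apply/funext => x; rewrite partD.
- by have := sqintB mI hg hF; congr sqint; apply/funext => x; rewrite partB.
- have := sqintD mI (sqintB mI rp rg) (sqintB mI rG rF).
  by congr sqint; apply/funext => x; rewrite !(partD, partN).
- have := sqintB mI (sqintB mI hp hg) (sqintB mI hG hF).
  by congr sqint; apply/funext => x; rewrite !(partD, partN) !opprD.
Qed.

Lemma wavesDZ p r F g G psi F' g' G' psi' j x :
  waves p (fun x => F x + r%:C%C * F' x) (fun x => g x + r%:C%C * g' x)
    (fun x => G x + r%:C%C * G' x) (fun x => psi x + r%:C%C * psi' x) j x =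
  waves p F g G psi j x + r * waves p F' g' G' psi' j x.
Proof.
by case: j => [[|[|[|[|//]]]] ?]; rewrite /waves/= !(partD, partN, partZ); ring.
Qed.

Lemma L2DZ r f g : L2 f -> L2 g -> L2 (fun x => f x + r%:C%C * g x).
Proof.
move=> /L2_sqint hf /L2_sqint hg; apply/L2_sqint => p; have mI := @measurable_I01 R.
have := sqintD mI (hf p) (sqintZ r mI (hg p)).
by congr sqint; apply/funext => x; rewrite partD partZ.
Qed.

Lemma H1DZ r f f1 g g1 : H1 f -> has_wderiv f f1 -> H1 g -> has_wderiv g g1 ->
  H1 (fun x => f x + r%:C%C * g x) /\
  has_wderiv (fun x => f x + r%:C%C * g x) (fun x => f1 x + r%:C%C * g1 x).
Proof.
move=> hf hf1 hg hg1; have mI := @measurable_I01 R; have fI := @finite_I01 R.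
have sf := has_wderiv_sqint hf1; have sg := has_wderiv_sqint hg1.
apply: primitive_H1; first exact/L2_sqint/(L2DZ _ hf1.1 hg1.1).
move=> p x x01; rewrite !partD !partZ (H1_primitive hf hf1 p x01) (H1_primitive hg hg1 p x01).
have mx : measurable (`[0, x] : set R) by exact: measurable_itv.
have sub : `[0, x] `<=` (`[0, 1] : set R).
  by apply: subset_itvl; rewrite bnd_simp; case/andP: x01.
have i1 := integS (measurable_itv _) mx sub ((integ_I01_cc _).1 (sqint_integ mI fI (sf p))).
have i2 := integS (measurable_itv _) mx sub ((integ_I01_cc _).1 (sqint_integ mI fI (sg p))).
rewrite (_ : \int[mu]_(y in `[0, x]) part p (f1 y + r%:C%C * g1 y) =
   \int[mu]_(y in `[0, x]) (part p (f1 y) + r * part p (g1 y))); last first.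
  by apply: eq_Rintegral => y _; rewrite partD partZ.
by rewrite RintegralD// ?RintegralZl//; [ring|exact: integZ].
Qed.

Definition st_waves p (Z : state R) : 'I_4 -> R -> R :=
  let '(f, g, eta, phi, psi, h) := Z in waves p (wderiv f) g (wderiv phi) psi.

Definition st_scalars p (Z : state R) : 'I_3 -> R :=
  let '(f, g, eta, phi, psi, h) := Z in end_scalars p eta h (phi 0).

Lemma st_waves_sqint p Z j : calH1 Z -> sqint I01 (st_waves p Z j).
Proof.
case: Z => [[[[[f g] eta] phi] psi] h] [[hf _] /L2_sqint hg hphi /L2_sqint hpsi].
by apply: waves_sqint => //; apply: has_wderiv_sqint; exact: wderivP.
Qed.

Lemma st_wavesE p f f1 g eta phi phi1 psi h : H1 f -> has_wderiv f f1 ->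
  H1 phi -> has_wderiv phi phi1 -> forall j, {ae mu, forall x, I01 x ->
    st_waves p (f, g, eta, phi, psi, h) j x = waves p f1 g phi1 psi j x}.
Proof.
move=> hf hf1 hphi hphi1 j.
by apply: waves_ae; [exact: wderiv_ae| |exact: wderiv_ae|]; exact: aeW.
Qed.

Lemma stateDZE r f g eta phi psi h f' g' eta' phi' psi' h' :
  ((f, g, eta, phi, psi, h) : state R) + rscale r ((f', g', eta', phi', psi', h') : state R) =
  ((fun x : R => f x + r%:C%C * f' x), (fun x : R => g x + r%:C%C * g' x), eta + r%:C%C * eta',
   (fun x : R => phi x + r%:C%C * phi' x), (fun x : R => psi x + r%:C%C * psi' x), h + r%:C%C * h').
Proof. by []. Qed.

(** The coordinates are real-linear, up to a null set because wderiv only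
    picks some representative. *)
Lemma coordsDZ p r (Z Z' : state R) : calH1 Z -> calH1 Z' ->
  [/\ calH1 (Z + rscale r Z'),
    forall j, {ae mu, forall x, I01 x ->
      st_waves p (Z + rscale r Z') j x = st_waves p Z j x + r * st_waves p Z' j x} &
    forall i, st_scalars p (Z + rscale r Z') i = st_scalars p Z i + r * st_scalars p Z' i].
Proof.
case: Z => [[[[[f g] eta] phi] psi] h]; case: Z' => [[[[[f' g'] eta'] phi'] psi'] h'].
move=> [[hf f0] hg hphi hpsi] [[hf' f0'] hg' hphi' hpsi'].
have [Hf Wf] := H1DZ r hf (wderivP hf) hf' (wderivP hf').
have [Hp Wp] := H1DZ r hphi (wderivP hphi) hphi' (wderivP hphi').
rewrite stateDZE; split.
- split; [split; [exact: Hf|]|exact: L2DZ hg hg'|exact: Hp|exact: L2DZ hpsi hpsi'].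
  by rewrite f0 f0' mulr0 addr0.
- move=> j; apply: ae_sub (st_wavesE p (fun x => g x + r%:C%C * g' x) (eta + r%:C%C * eta')
    (fun x => psi x + r%:C%C * psi' x) (h + r%:C%C * h') Hf Wf Hp Wp j) => x e Ix.
  by rewrite (e Ix) wavesDZ.
- case=> [[|[|[|//]]] ?]; rewrite /st_scalars /end_scalars/= !(partD, partN, partZ)//.
  by ring.
Qed.

Lemma calH1_0 : calH1 (0 : state R).
Proof.
have [H0 _] : H1 (fun _ : R => 0 : C) /\ has_wderiv (fun _ : R => 0 : C) (fun=> 0).
  have mI := @measurable_I01 R; have fI := @finite_I01 R.
  apply: primitive_H1 => [p|p x _]; rewrite ?part0; first exact: sqint_cst.
  by rewrite (_ : \int[mu]_(y in _) _ = 0) ?addr0//; rewrite Rintegral_cst ?part0 ?mul0r//; exact: measurable_itv.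
split; [by split|by case: H0|exact: H0|by case: H0].
Qed.

Lemma coords0 p :
  (forall j, {ae mu, forall x, I01 x -> st_waves p 0 j x = 0}) /\ (forall i, st_scalars p 0 i = 0).
Proof.
have [_ H1 H2] := coordsDZ p (-1) calH1_0 calH1_0.
rewrite rscaleN1 subrr in H1 H2; split.
  by move=> j; apply: ae_sub (H1 j) => x e Ix; rewrite e// mulN1r subrr.
by move=> i; rewrite H2 mulN1r subrr.
Qed.

Lemma coordsZ p r (Z : state R) : calH1 Z ->
  [/\ calH1 (rscale r Z),
    forall j, {ae mu, forall x, I01 x -> st_waves p (rscale r Z) j x = r * st_waves p Z j x} &
    forall i, st_scalars p (rscale r Z) i = r * st_scalars p Z i].
Proof.
move=> hZ; have [H W S] := coordsDZ p r calH1_0 hZ; rewrite add0r in H W S.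
have [W0 S0] := coords0 p; split => //.
  by move=> j; apply: ae_sub2 (W j) (W0 j) => x e e0 Ix; rewrite e// e0// add0r.
by move=> i; rewrite S S0 add0r.
Qed.

Lemma coordsD p (Z Z' : state R) : calH1 Z -> calH1 Z' ->
  [/\ calH1 (Z + Z'),
    forall j, {ae mu, forall x, I01 x -> st_waves p (Z + Z') j x = st_waves p Z j x + st_waves p Z' j x} &
    forall i, st_scalars p (Z + Z') i = st_scalars p Z i + st_scalars p Z' i].
Proof.
move=> hZ hZ'; have [H W S] := coordsDZ p 1 hZ hZ'; rewrite rscale1 in H W S; split => //.
  by move=> j; apply: ae_sub (W j) => x e Ix; rewrite e// mul1r.
by move=> i; rewrite S mul1r.
Qed.

Lemma coordsB p (Z Z' : state R) : calH1 Z -> calH1 Z' ->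
  [/\ calH1 (Z - Z'),
    forall j, {ae mu, forall x, I01 x -> st_waves p (Z - Z') j x = st_waves p Z j x - st_waves p Z' j x} &
    forall i, st_scalars p (Z - Z') i = st_scalars p Z i - st_scalars p Z' i].
Proof.
move=> hZ hZ'; have [H W S] := coordsDZ p (-1) hZ hZ'; rewrite rscaleN1 in H W S; split => //.
  by move=> j; apply: ae_sub (W j) => x e Ix; rewrite e// mulN1r.
by move=> i; rewrite S mulN1r.
Qed.

End Coordinates.

(** * Equivalence with the norm of the state space *)
Section Energy.
Variable R : realType.
Local Notation C := R[i].
Local Notation mu := (@lebesgue_measure R).
Local Notation I01 := (@I01 R).

Lemma RintegralD_I01 (u v : R -> R) : integ I01 u -> integ I01 v ->
  \int[mu]_(x in I01) (u x + v x) = \int[mu]_(x in I01) u x + \int[mu]_(x in I01) v x.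
Proof. by move=> iu iv; rewrite RintegralD//; exact: measurable_I01. Qed.

(** Parallelogram law, after reflecting the waves w 0 and w 2. *)
Lemma waves_sqr_integral p (F g G psi : R -> C) :
  sqint I01 (fun x => part p (F x)) -> sqint I01 (fun x => part p (g x)) ->
  sqint I01 (fun x => part p (G x)) -> sqint I01 (fun x => part p (psi x)) ->
  \sum_j \int[mu]_(x in I01) waves p F g G psi j x ^+ 2 =
  \int[mu]_(x in I01) (2 * ((part p (g x)) ^+ 2 + (part p (F x)) ^+ 2 +
     (part p (psi x) - part p (g x)) ^+ 2 + (part p (G x) - part p (F x)) ^+ 2)).
Proof.
move=> hF hg hG hp; have mI := @measurable_I01 R.
set f := fun x => part p (F x) in hF; set k := fun x => part p (g x) in hg.
set u := fun x => part p (G x) in hG; set v := fun x => part p (psi x) in hp.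
have h0 : sqint I01 (fun x => k x + f x) by exact: sqintD.
have h1 : sqint I01 (fun x => k x - f x) by exact: sqintB.
have h2 : sqint I01 (fun x => v x - k x + (u x - f x)).
  by apply: sqintD => //; exact: sqintB.
have h3 : sqint I01 (fun x => v x - k x - (u x - f x)).
  by apply: sqintB => //; exact: sqintB.
have [i0 i1 i2 i3] := And4 (sqint_sqr mI h0) (sqint_sqr mI h1) (sqint_sqr mI h2) (sqint_sqr mI h3).
rewrite big_ord4 /waves !inordK//=.
rewrite (_ : \int[mu]_(x in I01) _ = \int[mu]_(x in I01) (k x + f x) ^+ 2); last first.
  rewrite -(Rintegral_I01_reflect i0); apply: eq_Rintegral => x _.
  by rewrite partD.
rewrite (_ : \int[mu]_(x in I01) part p (g x - F x) ^+ 2 = \int[mu]_(x in I01) (k x - f x) ^+ 2); last first.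
  by apply: eq_Rintegral => x _; rewrite partB.
rewrite (_ : \int[mu]_(x in I01) part p (psi (1 - x) - _ + _) ^+ 2 = \int[mu]_(x in I01) (v x - k x + (u x - f x)) ^+ 2); last first.
  rewrite -(Rintegral_I01_reflect i2); apply: eq_Rintegral => x _.
  by rewrite !(partD, partN).
rewrite (_ : \int[mu]_(x in I01) part p (psi x - _ - _) ^+ 2 = \int[mu]_(x in I01) (v x - k x - (u x - f x)) ^+ 2); last first.
  by apply: eq_Rintegral => x _; rewrite !(partD, partN).
have i01 := integD mI i0 i1; have i012 := integD mI i01 i2.
rewrite -(RintegralD_I01 i0 i1) -(RintegralD_I01 i01 i2) -(RintegralD_I01 i012 i3).
by apply: eq_Rintegral => x _; rewrite /k /f /u /v; ring.
Qed.

Definition st_sqnorm (Z : state R) : R :=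
  sqnorm (st_waves true Z) (st_scalars true Z) + sqnorm (st_waves false Z) (st_scalars false Z).

Variables m a alpha beta gamma : R.
Hypotheses (m0 : 0 < m) (a0 : 0 < a) (alpha0 : 0 < alpha) (beta0 : 0 < beta).
Local Notation normsq := (normsq m a alpha beta).

Lemma normsqE f g eta phi psi h : calH1 ((f, g, eta, phi, psi, h) : state R) ->
  let N p := \int[mu]_(x in I01) (part p (wderiv f x) ^+ 2 + part p (g x) ^+ 2 +
      part p (wderiv phi x) ^+ 2 + part p (psi x) ^+ 2) +
    m^-1 * part p eta ^+ 2 + beta * part p (phi 0) ^+ 2 + (m + a * alpha)^-1 * part p h ^+ 2 in
  normsq (f, g, eta, phi, psi, h) = N true + N false.
Proof.
move=> [[/wderivP/has_wderiv_sqint hf _] /L2_sqint hg /wderivP/has_wderiv_sqint hphi /L2_sqint hpsi] N.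
have mI := @measurable_I01 R.
have I p : integ I01 (fun x => part p (wderiv f x) ^+ 2 + part p (g x) ^+ 2 +
      part p (wderiv phi x) ^+ 2 + part p (psi x) ^+ 2).
  apply: integD => //; last exact: sqint_sqr.
  by apply: integD => //; [apply: integD => //|]; exact: sqint_sqr.
rewrite /Defs.normsq /N !sqmodE.
rewrite (_ : \int[mu]_(x in I01) (sqmod _ + _ + _ + _) = \int[mu]_(x in I01)
  ((part true (wderiv f x) ^+ 2 + part true (g x) ^+ 2 +
      part true (wderiv phi x) ^+ 2 + part true (psi x) ^+ 2) +
   (part false (wderiv f x) ^+ 2 + part false (g x) ^+ 2 +
      part false (wderiv phi x) ^+ 2 + part false (psi x) ^+ 2))); last first.
  by apply: eq_Rintegral => x _; rewrite !sqmodE; ring.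
by rewrite (RintegralD_I01 (I true) (I false)); ring.
Qed.

(** Both squared norms are nondegenerate quadratic forms in the same data: the
    slopes and velocities inside the interval, and three scalars. *)
Lemma sqnorm_normsq : exists2 K : R, 0 < K & forall Z, calH1 Z ->
  normsq Z <= K * st_sqnorm Z /\ st_sqnorm Z <= K * normsq Z.
Proof.
have k0 : 0 < m + a * alpha by rewrite addr_gt0// mulr_gt0.
pose s := (m + a * alpha); pose K := 6 + (2 / m + beta + s^-1) + (3 * s + 2 * m + beta^-1).
have s0 : 0 < s by [].
have [mV sV bV] : [/\ 0 < m^-1, 0 < s^-1 & 0 < beta^-1] by rewrite !invr_gt0.
have aux (x y : R) : 0 < x -> 0 < y -> [/\ 6 <= 6 + x + y, x <= 6 + x + y & y <= 6 + x + y].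
  by move=> x0 y0; split; lra.
have [K1 K2 K3] := aux (2 / m + beta + s^-1) (3 * s + 2 * m + beta^-1)
  (addr_gt0 (addr_gt0 (mulr_gt0 (ltr0n _ 2) mV) beta0) sV)
  (addr_gt0 (addr_gt0 (mulr_gt0 (ltr0n _ 3) s0) (mulr_gt0 (ltr0n _ 2) m0)) bV).
rewrite -/K in K1 K2 K3.
have K0 : 0 < K := lt_le_trans (ltr0n _ 6) K1.
exists K => // -[[[[[f g] eta] phi] psi] h] HZ; rewrite normsqE// /st_sqnorm.
case: HZ => [[/wderivP/has_wderiv_sqint hf _] /L2_sqint hg /wderivP/has_wderiv_sqint hphi /L2_sqint hpsi].
pose I p := \int[mu]_(x in I01) (part p (wderiv f x) ^+ 2 + part p (g x) ^+ 2 +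
      part p (wderiv phi x) ^+ 2 + part p (psi x) ^+ 2).
pose N p := I p + m^-1 * part p eta ^+ 2 + beta * part p (phi 0) ^+ 2 + s^-1 * part p h ^+ 2.
pose S p := sqnorm (st_waves p (f, g, eta, phi, psi, h)) (st_scalars p (f, g, eta, phi, psi, h)).
suff H p : N p <= K * S p /\ S p <= K * N p.
  have [h1 h2] := H true; have [h3 h4] := H false.
  change (N true + N false <= K * (S true + S false) /\ S true + S false <= K * (N true + N false)).
  by rewrite (mulrDr K (S true)) (mulrDr K (N true)); split; exact: lerD.
have mI := @measurable_I01 R.
rewrite /S /sqnorm waves_sqr_integral// big_ord3 /st_scalars /end_scalars !inordK//= partB.
have [if_ ig ip iq] := And4 (sqint_sqr mI (hf p)) (sqint_sqr mI (hg p)) (sqint_sqr mI (hphi p)) (sqint_sqr mI (hpsi p)).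
have iI : integ I01 (fun x => part p (wderiv f x) ^+ 2 + part p (g x) ^+ 2 +
      part p (wderiv phi x) ^+ 2 + part p (psi x) ^+ 2).
  by apply: integD => //; apply: integD => //; exact: integD.
have iJ : integ I01 (fun x => 2 * ((part p (g x)) ^+ 2 + (part p (wderiv f x)) ^+ 2 +
     (part p (psi x) - part p (g x)) ^+ 2 + (part p (wderiv phi x) - part p (wderiv f x)) ^+ 2)).
  by apply: integZ => //; do ?[apply: integD => //]; apply: sqint_sqr => //; exact: sqintB.
set J := \int[mu]_(x in I01) (2 * _).
have IJ : I p <= 6 * J.
  rewrite /J -RintegralZl//; apply: le_Rintegral => //; first exact: integZ.
  move=> x _; move: (part p (wderiv f x)) (part p (g x)) (part p (psi x)) (part p (wderiv phi x)) => x1 x2 x3 x4.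
  have := sqr_ge0 (x3 - 2 * x2); have := sqr_ge0 (x4 - 2 * x1); have := sqr_ge0 (x3 - x2); have := sqr_ge0 (x4 - x1); have := sqr_ge0 x1; have := sqr_ge0 x2.
  by have := sqr_ge0 x3; have := sqr_ge0 x4; rewrite !sqrrB; lra.
have JI : J <= 6 * I p.
  rewrite /I -RintegralZl//; apply: le_Rintegral => //; first exact: integZ.
  move=> x _; move: (part p (wderiv f x)) (part p (g x)) (part p (psi x)) (part p (wderiv phi x)) => x1 x2 x3 x4.
  have := sqr_ge0 (x3 + x2); have := sqr_ge0 (x4 + x1); have := sqr_ge0 x1; have := sqr_ge0 x2.
  by have := sqr_ge0 x3; have := sqr_ge0 x4; rewrite !sqrrB !sqrrD; lra.
have I0 : 0 <= I p by apply: Rintegral_ge0 => x _; rewrite !addr_ge0 ?sqr_ge0.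
have J0 : 0 <= J by apply: Rintegral_ge0 => x _; rewrite mulr_ge0// !addr_ge0 ?sqr_ge0.
have L1 : 6 * J <= K * J by rewrite ler_wpM2r.
have L2 : 6 * I p <= K * I p by rewrite ler_wpM2r.
rewrite /N; clearbody J; move: (I p) I0 IJ JI L2 => i I0 IJ JI L2.
move: (part p eta) (part p (phi 0)) (part p h) => e y t.
have [e2 y2 t2 d2] := And4 (sqr_ge0 e) (sqr_ge0 y) (sqr_ge0 t) (sqr_ge0 (t - e)).
have E1 : m^-1 * e ^+ 2 <= 2 / m * (t ^+ 2 + (t - e) ^+ 2).
  rewrite (mulrC 2) -mulrA ler_pM2l// sqrrB.
  by have := sqr_ge0 (2 * t - e); rewrite sqrrB; lra.
have T0 : 0 <= t ^+ 2 + (t - e) ^+ 2 + y ^+ 2 by lra.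
have E2 : (2 / m + beta + s^-1) * (t ^+ 2 + (t - e) ^+ 2 + y ^+ 2) <= K * (t ^+ 2 + (t - e) ^+ 2 + y ^+ 2).
  by rewrite ler_wpM2r.
have E3 : m^-1 * e ^+ 2 + beta * y ^+ 2 + s^-1 * t ^+ 2 <= (2 / m + beta + s^-1) * (t ^+ 2 + (t - e) ^+ 2 + y ^+ 2).
  have [q1 q2 q3 q4] := And4 (mulr_ge0 (ltW mV) y2) (mulr_ge0 (ltW beta0) T0) (mulr_ge0 (ltW sV) d2) (mulr_ge0 (ltW sV) y2).
  have q5 := mulr_ge0 (ltW beta0) t2; have q6 := mulr_ge0 (ltW beta0) d2.
  rewrite (mulrC 2) in E1 *; rewrite !mulrDl !mulrDr; rewrite -!mulrA !mulrDr in E1 *.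
  lra.
split; first by rewrite mulrDr; lra.
pose Q := m^-1 * e ^+ 2 + beta * y ^+ 2 + s^-1 * t ^+ 2.
have [p1 p2 p3] := And3 (mulr_ge0 (ltW mV) e2) (mulr_ge0 (ltW beta0) y2) (mulr_ge0 (ltW sV) t2).
have Q0 : 0 <= Q by rewrite /Q; lra.
have E4 : (3 * s + 2 * m + beta^-1) * Q <= K * Q by rewrite ler_wpM2r.
have E5 : t ^+ 2 <= s * Q.
  rewrite -ler_pdivrMl//; apply: le_trans (_ : s^-1 * t ^+ 2 <= _) => //; rewrite /Q; lra.
have E6 : e ^+ 2 <= m * Q.
  rewrite -ler_pdivrMl//; rewrite /Q; lra.
have E7 : y ^+ 2 <= beta^-1 * Q.
  rewrite -ler_pdivrMl ?invr_gt0// invrK; rewrite /Q; lra.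
have E8 : (t - e) ^+ 2 <= 2 * t ^+ 2 + 2 * e ^+ 2.
  by have := sqr_ge0 (t + e); rewrite sqrrB sqrrD; lra.
have -> : K * (i + m^-1 * e ^+ 2 + beta * y ^+ 2 + s^-1 * t ^+ 2) = K * i + K * Q.
  by rewrite /Q; ring.
have E9 : (3 * s + 2 * m + beta^-1) * Q = 3 * (s * Q) + 2 * (m * Q) + beta^-1 * Q by ring.
rewrite E9 in E4; lra.
Qed.

End Energy.

(** * The generator in coordinates *)
Section Generator.
Variable R : realType.
Local Notation C := R[i].
Local Notation mu := (@lebesgue_measure R).
Local Notation I01 := (@I01 R).

Lemma primitive_onDZ r (u v U V : R -> R) : integ I01 u -> integ I01 v ->
  primitive_on 0 1 u U -> primitive_on 0 1 v V ->
  primitive_on 0 1 (fun x => u x + r * v x) (fun x => U x + r * V x).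
Proof.
move=> /integ_I01_cc iu /integ_I01_cc iv pu pv x x01; rewrite (pu _ x01) (pv _ x01).
have mx : measurable (`[0, x] : set R) by exact: measurable_itv.
have sub : `[0, x] `<=` (`[0, 1] : set R).
  by apply: subset_itvl; rewrite bnd_simp; case/andP: x01.
have i1 := integS (measurable_itv _) mx sub iu.
have i2 := integS (measurable_itv _) mx sub iv.
by rewrite RintegralD// ?RintegralZl//; [ring|exact: integZ].
Qed.

Lemma primitive_reflect (u U : R -> R) : integ I01 u -> primitive_on 0 1 u U ->
  primitive_on 0 1 (fun x => - u (1 - x)) (fun x => U (1 - x)).
Proof.
move=> /integ_I01_cc iu pu x /andP[x0 x1]; rewrite subr0.
have x01 : 0 <= 1 - x <= 1 by apply/andP; split; lra.
rewrite (pu _ x01) (pu 1); last by rewrite ler01 lexx.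
have [y0 y1] := andP x01.
rewrite (Rintegral_itv_cat y0 y1 iu).
have mx : measurable (`[1 - x, 1] : set R) by exact: measurable_itv.
have sub : `[1 - x, 1] `<=` (`[0, 1] : set R).
  by apply: subset_itvr; rewrite bnd_simp.
have i1 := integS (measurable_itv _) mx sub iu.
have := Rintegral_reflect 1 mx i1.
rewrite (_ : [set y | _] = `[0, x]%classic); last first.
  by apply/seteqP; split => y /=; rewrite !in_itv/= => /andP[h1 h2]; apply/andP; split; lra.
move=> E; rewrite (_ : \int[mu]_(y in `[0, x]) - u (1 - y) = - \int[mu]_(y in `[0, x]) u (1 - y)); last first.
  rewrite -mulN1r -RintegralZl//.
  - by apply: eq_Rintegral => y _; rewrite mulN1r.
  - have := integ_reflect 1 mx i1.
    rewrite (_ : [set y | _] = `[0, x]%classic)//.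
    by apply/seteqP; split => y /=; rewrite !in_itv/= => /andP[h1 h2]; apply/andP; split; lra.
by rewrite E; ring.
Qed.

(** The time derivative exchanges slopes and velocities: along the flow, F and
    g are replaced by the derivatives of g and F.  A wave running from 0 to 1
    has opposite derivatives in time and in space. *)
Lemma waves_primitive p (F g G psi F' g' G' psi' : R -> C) :
  sqint I01 (fun x => part p (F' x)) -> sqint I01 (fun x => part p (g' x)) ->
  sqint I01 (fun x => part p (G' x)) -> sqint I01 (fun x => part p (psi' x)) ->
  primitive_on 0 1 (fun x => part p (F' x)) (fun x => part p (F x)) ->
  primitive_on 0 1 (fun x => part p (g' x)) (fun x => part p (g x)) ->
  primitive_on 0 1 (fun x => part p (G' x)) (fun x => part p (G x)) ->
  primitive_on 0 1 (fun x => part p (psi' x)) (fun x => part p (psi x)) ->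
  forall j, primitive_on 0 1 (fun x => - waves p g' F' psi' G' j x) (waves p F g G psi j).
Proof.
have mI := @measurable_I01 R; have fI := @finite_I01 R.
move=> /(sqint_integ mI fI) iF /(sqint_integ mI fI) ig /(sqint_integ mI fI) iG /(sqint_integ mI fI) ip.
move=> pF pg pG pp.
have iN (u : R -> R) r (v : R -> R) : integ I01 u -> integ I01 v -> integ I01 (fun x => u x + r * v x).
  by move=> iu iv; apply: integD => //; exact: integZ.
have igF := iN _ 1 _ ig iF; have pgF := primitive_onDZ 1 ig iF pg pF.
have igF' := iN _ (-1) _ ig iF; have pgF' := primitive_onDZ (-1) ig iF pg pF.
have iGp := iN _ 1 _ ip iG; have pGp := primitive_onDZ 1 ip iG pp pG.
have iGp' := iN _ (-1) _ ip iG; have pGp' := primitive_onDZ (-1) ip iG pp pG.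
case=> [[|[|[|[|//]]]] ?]; rewrite /waves/=.
- have := primitive_reflect igF pgF; congr primitive_on; apply/funext => x;
    by rewrite !(partD, partN); ring.
- by move: pgF'; congr primitive_on; apply/funext => x; rewrite !(partD, partN); ring.
- have := primitive_onDZ (-1) iGp igF pGp pgF.
  move/(primitive_reflect (iN _ (-1) _ iGp igF)); congr primitive_on; apply/funext => x;
    by rewrite !(partD, partN); ring.
- have := primitive_onDZ (-1) iGp' igF' pGp' pgF'.
  by congr primitive_on; apply/funext => x; rewrite !(partD, partN); ring.
Qed.

Variables m a alpha beta gamma : R.
Hypotheses (m0 : 0 < m) (a0 : 0 < a) (alpha0 : 0 < alpha) (beta0 : 0 < beta) (gamma0 : 0 < gamma).
Local Notation opL := (opL m a alpha beta gamma).

(** The domain conditions of the generator are the reinjection rule at 0. *)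
Lemma opL_system p (Y W : state R) : opL Y W ->
  system_op m a alpha beta gamma (st_waves p Y) (st_scalars p Y) (st_waves p W) (st_scalars p W).
Proof.
case: Y => [[[[[f g] eta] phi] psi] h].
move=> [f1 [f2 [phi1 [phi2 [[[hf wf hf1 wf1] _ [hg g0] [hphi wphi hphi1 wphi1] hpsi] [[bc eE hE] ->]]]]]].
have sf2 := has_wderiv_sqint wf1; have sp2 := has_wderiv_sqint wphi1.
have wg := wderivP hg; have wpsi := wderivP hpsi.
have sg := has_wderiv_sqint wg; have sp := has_wderiv_sqint wpsi.
have ma1 : m + a != 0 by rewrite gt_eqF ?addr_gt0.
have m1 : m != 0 by rewrite gt_eqF.
have g1 : 1 + gamma != 0 by rewrite gt_eqF ?addr_gt0.
exists (waves p f1 g phi1 psi); split.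
- exact: st_wavesE.
- by apply: waves_primitive => //; exact: H1_primitive.
- move=> j; rewrite big_ord4 big_ord3 /cM /cP /list_mx /waves /st_scalars /end_scalars.
  rewrite !inordK//=.
  move: (congr1 (part p) bc) (congr1 (part p) eE) (congr1 (part p) hE) (congr1 (part p) g0).
  case: j => [[|[|[|[|//]]]] ?] /=; rewrite ?subr0 ?subrr !(partD, partN, partZ) ?part0 => E1 E2 E3 E4; rewrite ?E1 ?E2 ?E3 ?E4; by field; rewrite ?ma1 ?m1 ?g1.
- move=> i; rewrite big_ord4 /cK /cJ /list_mx /waves /st_scalars /end_scalars.
  rewrite !inordK//=.
  move: (congr1 (part p) bc) (congr1 (part p) eE) (congr1 (part p) hE) (congr1 (part p) g0).
  case: i => [[|[|[|//]]] ?] /=; rewrite ?subr0 ?subrr !(partD, partN, partZ) ?part0 => E1 E2 E3 E4; rewrite ?E1 ?E2 ?E3 ?E4; by field; rewrite ?ma1 ?m1 ?g1.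
Qed.

Variables delta d B : R.
Local Notation form := (lyap m a alpha beta gamma delta d B).

Definition energy (Z Z' : state R) : R :=
  form (st_waves true Z) (st_waves true Z') (st_scalars true Z) (st_scalars true Z') +
  form (st_waves false Z) (st_waves false Z') (st_scalars false Z) (st_scalars false Z').

Lemma formZl p r (Z Z' : state R) : calH1 Z -> calH1 Z' ->
  form (st_waves p (rscale r Z)) (st_waves p Z') (st_scalars p (rscale r Z)) (st_scalars p Z') =
  r * form (st_waves p Z) (st_waves p Z') (st_scalars p Z) (st_scalars p Z').
Proof.
move=> hZ hZ'; have [H W S] := coordsZ p r hZ; have mI := @measurable_I01 R.
rewrite (lyap_ae _ _ _ _ _ _ _ _ _ _ _ _ W S); last 3 first.
- by move=> j; exact: st_waves_sqint.
- by move=> j; apply: sqintZ => //; exact: st_waves_sqint.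
- by move=> j; exact: st_waves_sqint.
by apply: lyapZ => j; exact: st_waves_sqint.
Qed.

Lemma formDl p (Z1 Z2 Z' : state R) : calH1 Z1 -> calH1 Z2 -> calH1 Z' ->
  form (st_waves p (Z1 + Z2)) (st_waves p Z') (st_scalars p (Z1 + Z2)) (st_scalars p Z') =
  form (st_waves p Z1) (st_waves p Z') (st_scalars p Z1) (st_scalars p Z') +
  form (st_waves p Z2) (st_waves p Z') (st_scalars p Z2) (st_scalars p Z').
Proof.
move=> h1 h2 hZ'; have [H W S] := coordsD p h1 h2; have mI := @measurable_I01 R.
rewrite (lyap_ae _ _ _ _ _ _ _ _ _ _ _ _ W S); last 3 first.
- by move=> j; exact: st_waves_sqint.
- by move=> j; apply: sqintD => //; exact: st_waves_sqint.
- by move=> j; exact: st_waves_sqint.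
by apply: lyapD => j; exact: st_waves_sqint.
Qed.

Hypothesis form_ge0 : forall w z, (forall j, sqint I01 (w j)) -> 0 <= form w w z z.

Lemma energy_semi_inner : semi_inner (@calH1 R) energy.
Proof.
split.
- exact: calH1_0.
- by move=> x y hx hy; have [] := coordsD true hx hy.
- by move=> r x hx; have [] := coordsZ true r hx.
- by move=> x y _ _; rewrite /energy !(lyapC _ _ _ _ _ _ _ _ (st_waves _ x)).
- by move=> x y z hx hy hz; rewrite /energy !formDl//; ring.
- by move=> r x z hx hz; rewrite /energy !formZl//; ring.
- by move=> x hx; rewrite /energy addr_ge0//; apply: form_ge0 => j; exact: st_waves_sqint.
Qed.

Lemma energy_dissipation (lam : R) :
  (forall w z w' z', (forall j, sqint I01 (w j)) -> (forall j, sqint I01 (w' j)) ->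
    system_op m a alpha beta gamma w z w' z' -> form w' w z' z <= - lam * form w w z z) ->
  forall Y W, calH1 Y -> calH1 W -> opL Y W -> energy W Y <= - lam * energy Y Y.
Proof.
move=> H Y W hY hW op; rewrite /energy mulrDr.
by apply: lerD; apply: H; do ?[by move=> j; exact: st_waves_sqint]; exact: opL_system.
Qed.

Lemma has_wderivB f (f1 : R -> C) g (g1 : R -> C) : H1 f -> has_wderiv f f1 -> H1 g -> has_wderiv g g1 ->
  H1 (f - g) /\ has_wderiv (f - g) (f1 - g1).
Proof.
move=> hf hf1 hg hg1; have := H1DZ (-1) hf hf1 hg hg1.
have E (u v : R -> C) : (fun x => u x + (-1)%:C%C * v x) = u - v.
  by apply/funext => x; rewrite rmorphN rmorph1 mulN1r.
by rewrite !E.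
Qed.

Lemma opLB (Y W Y' W' : state R) : opL Y W -> opL Y' W' -> opL (Y - Y') (W - W').
Proof.
case: Y => [[[[[f g] eta] phi] psi] h]; case: Y' => [[[[[f' g'] eta'] phi'] psi'] h'].
move=> [f1 [f2 [phi1 [phi2 [[[hf wf hf1 wf1] [_ f0] [hg g0] [hp wp hp1 wp1] hpsi] [[bc eE hE] ->]]]]]].
move=> [f1' [f2' [phi1' [phi2' [[[hf' wf' hf1' wf1'] [_ f0'] [hg' g0'] [hp' wp' hp1' wp1'] hpsi'] [[bc' eE' hE'] ->]]]]]].
have [F1 F2] := has_wderivB hf wf hf' wf'.
have [F3 F4] := has_wderivB hf1 wf1 hf1' wf1'.
have [P1 P2] := has_wderivB hp wp hp' wp'.
have [P3 P4] := has_wderivB hp1 wp1 hp1' wp1'.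
have [G1 _] := has_wderivB hg (wderivP hg) hg' (wderivP hg').
have [S1 _] := has_wderivB hpsi (wderivP hpsi) hpsi' (wderivP hpsi').
exists (f1 - f1'), (f2 - f2'), (phi1 - phi1'), (phi2 - phi2'); split; [|split].
- split => //; split => //; [change (f 0 - f' 0 = 0)|change (g 0 - g' 0 = 0)].
    by rewrite f0 f0' subrr.
  by rewrite g0 g0' subrr.
- split.
  + change (phi1 0 - phi1' 0 = gamma%:C%C * (psi 0 - psi' 0) + beta%:C%C * (phi 0 - phi' 0) + (f1 0 - f1' 0)).
    by rewrite bc bc'; ring.
  + change (eta - eta' = m%:C%C * (g 1 - g' 1) + a%:C%C * (phi1 1 - phi1' 1)).
    by rewrite eE eE'; ring.
  + change (h - h' = m%:C%C * (psi 1 - psi' 1) + a%:C%C * (phi1 1 - phi1' 1)).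
    by rewrite hE hE'; ring.
- have E (x y x' y' : C) : - x - alpha%:C%C * y - (- x' - alpha%:C%C * y') =
     - (x - x') - alpha%:C%C * (y - y') by ring.
  have E1 := E (f1 1) (psi 1) (f1' 1) (psi' 1).
  have E2 := E (phi1 1) (psi 1) (phi1' 1) (psi' 1).
  transitivity (((g - g'), (f2 - f2'), - f1 1 - alpha%:C%C * psi 1 - (- f1' 1 - alpha%:C%C * psi' 1),
     (psi - psi'), (phi2 - phi2'), - phi1 1 - alpha%:C%C * psi 1 - (- phi1' 1 - alpha%:C%C * psi' 1)) : state R) => //.
  by rewrite E1 E2.
Qed.

Lemma opL_calH1 (Y W : state R) : opL Y W -> calH1 W.
Proof.
case: Y => [[[[[f g] eta] phi] psi] h].
move=> [f1 [f2 [phi1 [phi2 [[[hf wf hf1 wf1] [_ f0] hg [hp wp hp1 wp1] hpsi] [_ ->]]]]]].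
by split => //; [case: wf1|case: wp1].
Qed.

Lemma H1_eq0 f : H1 f -> f 0 = 0 ->
  (forall p, {ae mu, forall x, I01 x -> part p (wderiv f x) = 0}) ->
  forall x, 0 <= x <= 1 -> f x = 0.
Proof.
move=> hf f0 H x x01; apply: part_inj => p; rewrite part0.
have W := wderivP hf; have [mF _] := has_wderiv_sqint W p.
have pr := primitive_01_ae mF (@measurable_cst _ _ _ _ I01 (0 : R)) (H p) (H1_primitive hf W p).
rewrite (pr x x01) f0 part0 Rintegral_cst ?mul0r ?addr0//; exact: measurable_itv.
Qed.

Lemma wderiv_eq0 f : H1 f -> (forall x, 0 <= x <= 1 -> f x = 0) ->
  forall p, {ae mu, forall x, I01 x -> part p (wderiv f x) = 0}.
Proof.
move=> hf f0 p; have mI := @measurable_I01 R; have fI := @finite_I01 R.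
have [_ W] : H1 f /\ has_wderiv f (fun=> 0).
  apply: primitive_H1 => [q|q x x01]; rewrite part0; first exact: sqint_cst.
  rewrite !f0 ?lexx ?ler01// part0 Rintegral_cst ?mul0r ?addr0//; exact: measurable_itv.
by apply: ae_sub (wderiv_ae hf W p) => x e Ix; rewrite e// part0.
Qed.

(** A function of H^1 vanishes when its slope and its value at 0 do; for the
    first component, the latter is the condition f(0) = 0. *)
Lemma normsq_eq0 (Z : state R) : calH1 Z -> normsq m a alpha beta Z = 0 <-> Heq Z 0.
Proof.
case: Z => [[[[[f g] eta] phi] psi] h] HZ; rewrite normsqE//.
have mI := @measurable_I01 R; have k0 : 0 < m + a * alpha by rewrite addr_gt0// mulr_gt0.
case: HZ => [[hf f0] /L2_sqint hg hphi /L2_sqint hpsi].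
have sF := has_wderiv_sqint (wderivP hf); have sG := has_wderiv_sqint (wderivP hphi).
have A0 p u : sqint I01 (fun x => part p (u x)) -> 0 <= \int[mu]_(x in I01) part p (u x) ^+ 2.
  by move=> _; apply: Rintegral_ge0 => x _; exact: sqr_ge0.
have E p : \int[mu]_(x in I01) (part p (wderiv f x) ^+ 2 + part p (g x) ^+ 2 +
      part p (wderiv phi x) ^+ 2 + part p (psi x) ^+ 2) =
  \int[mu]_(x in I01) part p (wderiv f x) ^+ 2 + \int[mu]_(x in I01) part p (g x) ^+ 2 +
  \int[mu]_(x in I01) part p (wderiv phi x) ^+ 2 + \int[mu]_(x in I01) part p (psi x) ^+ 2.
  have [i1 i2 i3 i4] := And4 (sqint_sqr mI (sF p)) (sqint_sqr mI (hg p)) (sqint_sqr mI (sG p)) (sqint_sqr mI (hpsi p)).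
  have i12 := integD mI i1 i2; have i123 := integD mI i12 i3.
  by rewrite (RintegralD_I01 i123 i4) (RintegralD_I01 i12 i3) (RintegralD_I01 i1 i2).
rewrite !E; split.
  move=> S0.
  have P p : [/\ \int[mu]_(x in I01) part p (wderiv f x) ^+ 2 = 0,
     \int[mu]_(x in I01) part p (g x) ^+ 2 = 0, \int[mu]_(x in I01) part p (wderiv phi x) ^+ 2 = 0 &
     \int[mu]_(x in I01) part p (psi x) ^+ 2 = 0] /\
     [/\ part p eta = 0, part p (phi 0) = 0 & part p h = 0].
    have [mV kV] : 0 < m^-1 /\ 0 < (m + a * alpha)^-1 by rewrite !invr_gt0.
    have B0 (c : R) q z : 0 < c -> 0 <= c * part q z ^+ 2 by move=> c0; rewrite mulr_ge0 ?sqr_ge0// ltW.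
    have B1 (c : R) z : 0 < c -> c * part p z ^+ 2 = 0 -> part p z = 0.
      by move=> c0 /eqP; rewrite mulf_eq0 gt_eqF//= sqrf_eq0 => /eqP.
    have sum7 (x1 x2 x3 x4 x5 x6 x7 : R) : 0 <= x1 -> 0 <= x2 -> 0 <= x3 -> 0 <= x4 -> 0 <= x5 ->
        0 <= x6 -> 0 <= x7 -> x1 + x2 + x3 + x4 + x5 + x6 + x7 = 0 ->
        [/\ x1 = 0, x2 = 0, x3 = 0 & x4 = 0] /\ [/\ x5 = 0, x6 = 0 & x7 = 0].
      by clear; move=> *; do !split; lra.
    pose N q := \int[mu]_(x in I01) part q (wderiv f x) ^+ 2 + \int[mu]_(x in I01) part q (g x) ^+ 2 +
      \int[mu]_(x in I01) part q (wderiv phi x) ^+ 2 + \int[mu]_(x in I01) part q (psi x) ^+ 2 +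
      m^-1 * part q eta ^+ 2 + beta * part q (phi 0) ^+ 2 + (m + a * alpha)^-1 * part q h ^+ 2.
    have N0 q : 0 <= N q.
      have [a1 a2 a3 a4] := And4 (A0 q _ (sF q)) (A0 q _ (hg q)) (A0 q _ (sG q)) (A0 q _ (hpsi q)).
      exact: (addr_ge0 (addr_ge0 (addr_ge0 (addr_ge0 (addr_ge0 (addr_ge0 a1 a2) a3) a4)
        (B0 _ q eta mV)) (B0 _ q (phi 0) beta0)) (B0 _ q h kV)).
    have Np : N p = 0.
      have /eqP := S0; rewrite -/(N true) -/(N false) paddr_eq0//.
      by case: p {B1} => /andP[/eqP h1 /eqP h2].
    have [H1 [H2 H3 H4]] := sum7 _ _ _ _ _ _ _ (A0 p _ (sF p)) (A0 p _ (hg p)) (A0 p _ (sG p)) (A0 p _ (hpsi p))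
      (B0 _ p eta mV) (B0 _ p (phi 0) beta0) (B0 _ p h kV) Np.
    by split => //; split; [exact: B1 mV H2|exact: B1 beta0 H3|exact: B1 kV H4].
  have ae0 p (u : R -> C) : sqint I01 (fun x => part p (u x)) -> \int[mu]_(x in I01) part p (u x) ^+ 2 = 0 ->
     {ae mu, forall x, I01 x -> part p (u x) = 0}.
    exact: Rintegral_sqr_eq0.
  have ae1 (u : R -> C) : (forall p, {ae mu, forall x, I01 x -> part p (u x) = 0}) ->
     {ae mu, forall x, 0 < x < 1 -> u x = 0}.
    move=> H; apply: ae_sub2 (H true) (H false) => x e1 e2 x01; apply: part_inj => -[]; rewrite part0;
      by [apply: e1; rewrite /Defs.I01/= in_itv|apply: e2; rewrite /Defs.I01/= in_itv].
  have Q1 p : \int[mu]_(x in I01) part p (wderiv f x) ^+ 2 = 0.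
    exact: (let: conj (And4 q _ _ _) _ := P p in q).
  have Q2 p : \int[mu]_(x in I01) part p (g x) ^+ 2 = 0.
    exact: (let: conj (And4 _ q _ _) _ := P p in q).
  have Q3 p : \int[mu]_(x in I01) part p (wderiv phi x) ^+ 2 = 0.
    exact: (let: conj (And4 _ _ q _) _ := P p in q).
  have Q4 p : \int[mu]_(x in I01) part p (psi x) ^+ 2 = 0.
    exact: (let: conj (And4 _ _ _ q) _ := P p in q).
  have phi00 : phi 0 = 0 by apply: part_inj => p; rewrite part0; exact: (let: conj _ (And3 _ q _) := P p in q).
  split; split.
  - exact: (H1_eq0 hf f0 (fun p => ae0 p _ (sF p) (Q1 p))).
  - exact: (ae1 g (fun p => ae0 p _ (hg p) (Q2 p))).
  - by apply: part_inj => p; rewrite part0; exact: (let: conj _ (And3 q _ _) := P p in q).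
  - exact: (H1_eq0 hphi phi00 (fun p => ae0 p _ (sG p) (Q3 p))).
  - exact: (ae1 psi (fun p => ae0 p _ (hpsi p) (Q4 p))).
  - by apply: part_inj => p; rewrite part0; exact: (let: conj _ (And3 _ _ q) := P p in q).
move=> [[f00 g00 ->] [p00 s00 ->]].
have ae0 p (u : R -> C) : sqint I01 (fun x => part p (u x)) -> {ae mu, forall x, I01 x -> part p (u x) = 0} ->
    \int[mu]_(x in I01) part p (u x) ^+ 2 = 0.
  move=> su H; rewrite (@ae_eq_Rintegral _ _ _ (fun=> 0))//.
  - by rewrite Rintegral_cst ?mul0r.
  - by apply: measurable_funX; case: su.
  - by apply: ae_sub H => x e Ix; rewrite e// expr0n.
have ae1 p (u : R -> C) : {ae mu, forall x, 0 < x < 1 -> u x = 0} -> {ae mu, forall x, I01 x -> part p (u x) = 0}.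
  by apply: ae_sub => x e; rewrite /Defs.I01/= in_itv/= => Ix; rewrite e// part0.
have Q1 p := ae0 p _ (sF p) (wderiv_eq0 hf f00 p).
have Q2 p := ae0 p _ (hg p) (ae1 p g g00).
have Q3 p := ae0 p _ (sG p) (wderiv_eq0 hphi p00 p).
have Q4 p := ae0 p _ (hpsi p) (ae1 p psi s00).
rewrite !Q1 !Q2 !Q3 !Q4.
by rewrite p00 ?lexx ?ler01// !part0 expr0n/= !mulr0 !addr0.
Qed.

Lemma Heq_subr (Z Z' : state R) : Heq Z Z' <-> Heq (Z - Z') 0.
Proof.
case: Z => [[[[[f g] eta] phi] psi] h]; case: Z' => [[[[[f' g'] eta'] phi'] psi'] h'].
have S (x y : C) : x - y = 0 <-> x = y.
  by split=> [/eqP|->]; rewrite ?subrr// subr_eq0 => /eqP.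
split=> -[[H1 H2 H3] [H4 H5 H6]].
  split; split; [|exact: ae_sub (fun x e x01 => (S _ _).2 (e x01)) H2|exact: (S _ _).2 H3|
    |exact: ae_sub (fun x e x01 => (S _ _).2 (e x01)) H5|exact: (S _ _).2 H6].
    by move=> x x01; exact: (S _ _).2 (H1 x x01).
  by move=> x x01; exact: (S _ _).2 (H4 x x01).
split; split; [|exact: ae_sub (fun x e x01 => (S _ _).1 (e x01)) H2|exact: (S _ _).1 H3|
  |exact: ae_sub (fun x e x01 => (S _ _).1 (e x01)) H5|exact: (S _ _).1 H6].
  by move=> x x01; exact: (S _ _).1 (H1 x x01).
by move=> x x01; exact: (S _ _).1 (H4 x x01).
Qed.

End Generator.

(** * States with prescribed coordinates *)
Section Realization.
Variable R : realType.
Local Notation C := R[i].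
Local Notation mu := (@lebesgue_measure R).
Local Notation I01 := (@I01 R).
Implicit Types (w : bool -> 'I_4 -> R -> R) (z : bool -> 'I_3 -> R).

(** Velocity and slope of the component whose two waves are w i and w j. *)
Definition vel w i j (x : R) : C := mkc (fun p => (w p i (1 - x) + w p j x) / 2).
Definition slope w i j (x : R) : C := mkc (fun p => (w p i (1 - x) - w p j x) / 2).

Local Notation o0 := (inord 0 : 'I_4).
Local Notation o1 := (inord 1 : 'I_4).
Local Notation o2 := (inord 2 : 'I_4).
Local Notation o3 := (inord 3 : 'I_4).

Lemma waves_vel w p j x : waves p (slope w o0 o1) (vel w o0 o1)
  (fun x => slope w o0 o1 x + slope w o2 o3 x) (fun x => vel w o0 o1 x + vel w o2 o3 x) j x = w p j x.
Proof.
have oE k (H : (k < 4)%N) : Ordinal H = inord k by apply: val_inj; rewrite /= inordK.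
by case: j => [[|[|[|[|//]]]] H]; rewrite /waves/= !(partD, partN) !part_mkc ?subKr oE; field.
Qed.

Lemma vel_sqint w i j : (forall p j, sqint I01 (w p j)) -> forall p, sqint I01 (fun x => part p (vel w i j x)).
Proof.
move=> hw p; have mI := @measurable_I01 R.
have := sqintZ 2^-1 mI (sqintD mI (sqint_I01_reflect (hw p i)) (hw p j)).
by congr sqint; apply/funext => x; rewrite part_mkc mulrC.
Qed.

Lemma slope_sqint w i j : (forall p j, sqint I01 (w p j)) -> forall p, sqint I01 (fun x => part p (slope w i j x)).
Proof.
move=> hw p; have mI := @measurable_I01 R.
have := sqintZ 2^-1 mI (sqintB mI (sqint_I01_reflect (hw p i)) (hw p j)).
by congr sqint; apply/funext => x; rewrite part_mkc mulrC.
Qed.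

Definition anti (c : C) (F : R -> C) (x : R) : C :=
  mkc (fun p => part p c + \int[mu]_(y in `[0, x]) part p (F y)).

Lemma anti0 c F : anti c F 0 = c.
Proof. by apply: part_inj => p; rewrite part_mkc set_itv1 Rintegral_set1 addr0. Qed.

Lemma anti_H1 c F : (forall p, sqint I01 (fun x => part p (F x))) ->
  H1 (anti c F) /\ has_wderiv (anti c F) F.
Proof. by move=> hF; apply: primitive_H1 => // p x x01; rewrite anti0 part_mkc. Qed.

(** A right inverse of the coordinates, up to null sets. *)
Definition realize w z : state R :=
  (anti 0 (slope w o0 o1), vel w o0 o1, mkc (fun p => z p (inord 0) - z p (inord 1)),
   anti (mkc (fun p => z p (inord 2))) (fun x => slope w o0 o1 x + slope w o2 o3 x),
   (fun x => vel w o0 o1 x + vel w o2 o3 x), mkc (fun p => z p (inord 0))).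

Lemma vel2_sqint w : (forall p j, sqint I01 (w p j)) ->
  forall p, sqint I01 (fun x => part p (vel w o0 o1 x + vel w o2 o3 x)).
Proof.
move=> hw p; have := sqintD (@measurable_I01 R) (vel_sqint o0 o1 hw p) (vel_sqint o2 o3 hw p).
by congr sqint; apply/funext => x; rewrite partD.
Qed.

Lemma slope2_sqint w : (forall p j, sqint I01 (w p j)) ->
  forall p, sqint I01 (fun x => part p (slope w o0 o1 x + slope w o2 o3 x)).
Proof.
move=> hw p; have := sqintD (@measurable_I01 R) (slope_sqint o0 o1 hw p) (slope_sqint o2 o3 hw p).
by congr sqint; apply/funext => x; rewrite partD.
Qed.

Lemma realizeP w z : (forall p j, sqint I01 (w p j)) ->
  [/\ calH1 (realize w z),
      forall p j, {ae mu, forall x, I01 x -> st_waves p (realize w z) j x = w p j x} &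
      forall p i, st_scalars p (realize w z) i = z p i].
Proof.
move=> hw; have [Hf Wf] := anti_H1 0 (slope_sqint o0 o1 hw).
have [Hp Wp] := anti_H1 (mkc (fun p => z p (inord 2))) (slope2_sqint hw).
split.
- split; [by split; [exact: Hf|exact: anti0]|exact/L2_sqint/vel_sqint|exact: Hp|exact/L2_sqint/vel2_sqint].
- move=> p j; apply: ae_sub (st_wavesE p (vel w o0 o1) (mkc (fun p => z p (inord 0) - z p (inord 1)))
    (fun x => vel w o0 o1 x + vel w o2 o3 x) (mkc (fun p => z p (inord 0))) Hf Wf Hp Wp j) => x e Ix.
  by rewrite (e Ix) waves_vel.
- have oE k (H : (k < 3)%N) : Ordinal H = inord k by apply: val_inj; rewrite /= inordK.
  move=> p [[|[|[|//]]] H]; rewrite /st_scalars /end_scalars/= oE ?partB ?anti0 !part_mkc//.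
  by ring.
Qed.

Variables m a alpha beta gamma : R.
Hypotheses (m0 : 0 < m) (a0 : 0 < a) (alpha0 : 0 < alpha) (beta0 : 0 < beta) (gamma0 : 0 < gamma).
Local Notation opL := (opL m a alpha beta gamma).
Local Notation system_op := (system_op m a alpha beta gamma).

(** Converse of waves_primitive. *)
Lemma vel_slope_H1 (v w' : bool -> 'I_4 -> R -> R) i j : (forall p j, sqint I01 (w' p j)) ->
  (forall p j, primitive_on 0 1 (fun x => - w' p j x) (v p j)) ->
  [/\ H1 (vel v i j), has_wderiv (vel v i j) (slope w' i j),
      H1 (slope v i j) & has_wderiv (slope v i j) (vel w' i j)].
Proof.
move=> hw pv; have mI := @measurable_I01 R; have fI := @finite_I01 R.
have iN p k : integ I01 (fun x => - w' p k x).
  have := integZ (-1) mI (sqint_integ mI fI (hw p k)).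
  by congr integ; apply/funext => x; rewrite mulN1r.
have iR p k : integ I01 (fun x => - - w' p k (1 - x)).
  have := sqint_integ mI fI (sqint_I01_reflect (hw p k)).
  by congr integ; apply/funext => x; rewrite opprK.
have pR p := primitive_reflect (iN p i) (pv p i).
have half (u U : R -> R) : integ I01 u -> primitive_on 0 1 u U ->
    primitive_on 0 1 (fun x => 0 + 2^-1 * u x) (fun x => 0 + 2^-1 * U x).
  move=> iu pu; apply: (@primitive_onDZ _ 2^-1 (fun=> 0) u (fun=> 0) U) => //.
    by apply: sqint_integ => //; exact: sqint_cst.
  by move=> x _; rewrite Rintegral_cst ?mul0r ?addr0//; exact: measurable_itv.
have iD p r : integ I01 (fun x => - - w' p i (1 - x) + r * - w' p j x).
  by apply: integD => //; exact: integZ.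
have [P1 W1] : H1 (vel v i j) /\ has_wderiv (vel v i j) (slope w' i j).
  apply: primitive_H1; first exact: slope_sqint.
  move=> p; have := half _ _ (iD p 1) (primitive_onDZ 1 (iR p i) (iN p j) (pR p) (pv p j)).
  by congr primitive_on; apply/funext => x; rewrite part_mkc; field.
have [P2 W2] : H1 (slope v i j) /\ has_wderiv (slope v i j) (vel w' i j).
  apply: primitive_H1; first exact: vel_sqint.
  move=> p; have := half _ _ (iD p (-1)) (primitive_onDZ (-1) (iR p i) (iN p j) (pR p) (pv p j)).
  by congr primitive_on; apply/funext => x; rewrite part_mkc; field.
by split.
Qed.

Lemma H1D f (f1 : R -> C) g (g1 : R -> C) : H1 f -> has_wderiv f f1 -> H1 g -> has_wderiv g g1 ->
  H1 (fun x => f x + g x) /\ has_wderiv (fun x => f x + g x) (fun x => f1 x + g1 x).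
Proof.
move=> hf hf1 hg hg1; have := H1DZ 1 hf hf1 hg hg1.
have E (u v : R -> C) : (fun x => u x + 1%:C%C * v x) = (fun x => u x + v x).
  by apply/funext => x; rewrite rmorph1 mul1r.
by rewrite !E.
Qed.

(** Take for Y the state built from the absolutely continuous representatives
    of the waves, which has the pointwise boundary values that membership in
    the domain requires, and read off the domain conditions from the
    reinjection rule. *)
Lemma realize_op w z w' z' :
  (forall p j, sqint I01 (w p j)) -> (forall p j, sqint I01 (w' p j)) ->
  (forall p, system_op (w p) (z p) (w' p) (z' p)) ->
  exists Y W, [/\ calH1 Y, opL Y W,
    forall p j, {ae mu, forall x, I01 x -> st_waves p Y j x = w p j x} &
    forall p i, st_scalars p Y i = z p i] /\
   [/\ forall p j, {ae mu, forall x, I01 x -> st_waves p W j x = w' p j x} &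
    forall p i, st_scalars p W i = z' p i].
Proof.
move=> hw hw' op; have [v1 [v1w v1p v10 v1z]] := op true; have [v2 [v2w v2p v20 v2z]] := op false.
pose v p := if p then v1 else v2.
have vw p j : {ae mu, forall x, I01 x -> w p j x = v p j x} by case: p; [exact: v1w|exact: v2w].
have vp p j : primitive_on 0 1 (fun x => - w' p j x) (v p j) by case: p; [exact: v1p|exact: v2p].
have v0 p j : v p j 0 = \sum_i cM m a gamma j i * v p i 1 + \sum_i cP m a beta gamma j i * z p i.
  by case: p; [exact: v10|exact: v20].
have vz p i : z' p i = cK m a alpha beta gamma i * z p i + \sum_j cJ m a alpha gamma i j * v p j 1.
  by case: p; [exact: v1z|exact: v2z].
clearbody v; clear v1 v2 v1w v2w v1p v2p v10 v20 v1z v2z.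
have hv p j : sqint I01 (v p j).
  apply: sqint_ae (vw p j) (hw p j); first exact: measurable_I01.
  have mI := @measurable_I01 R.
  have := integZ (-1) mI (sqint_integ mI (@finite_I01 R) (hw' p j)).
  rewrite (_ : (fun x => _) = (fun x => - w' p j x)); last by apply/funext => x; rewrite mulN1r.
  by move=> iN; have [] := primitive_sqint iN (vp p j).
have [hY wY sY] := realizeP z hv.
have [G1 Wg S1 Ws] := vel_slope_H1 o0 o1 hw' vp.
have [G2 Wg2 S2 Ws2] := vel_slope_H1 o2 o3 hw' vp.
have [GG WGG] := H1D G1 Wg G2 Wg2.
have [SS WSS] := H1D S1 Ws S2 Ws2.
have [Hf Wf] := anti_H1 0 (slope_sqint o0 o1 hv).
have [Hp Wp] := anti_H1 (mkc (fun p => z p (inord 2))) (slope2_sqint hv).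
have ma1 : m + a != 0 by rewrite gt_eqF ?addr_gt0.
have m1 : m != 0 by rewrite gt_eqF.
have g1 : 1 + gamma != 0 by rewrite gt_eqF ?addr_gt0.
pose F := slope v o0 o1; pose G := fun x : R => slope v o0 o1 x + slope v o2 o3 x.
pose psi := fun x : R => vel v o0 o1 x + vel v o2 o3 x.
pose W : state R := (vel v o0 o1, vel w' o0 o1, - F 1 - alpha%:C%C * psi 1,
   psi, (fun x => vel w' o0 o1 x + vel w' o2 o3 x), - G 1 - alpha%:C%C * psi 1).
exists (realize v z), W; split; split => //.
- exists F, (vel w' o0 o1), G, (fun x => vel w' o0 o1 x + vel w' o2 o3 x); split; [|split; [split|]].
  + split; [by split|by split; [|exact: anti0]|split => //|by split|exact: GG].
    apply: part_inj => p; rewrite part_mkc part0 subr0.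
    by rewrite (v0 p o1) big_ord4 big_ord3 /cM /cP /list_mx !inordK//=; field; rewrite ?ma1 ?m1.
  + apply: part_inj => p; rewrite anti0 !(partD, partN, partZ) !part_mkc subr0.
    by rewrite !v0 !big_ord4 !big_ord3 /cM /cP /list_mx !inordK//=; field; rewrite ?ma1 ?m1 ?g1.
  + apply: part_inj => p; rewrite !(partD, partN, partZ) !part_mkc subrr.
    by rewrite !v0 !big_ord4 !big_ord3 /cM /cP /list_mx !inordK//=; field; rewrite ?ma1 ?m1 ?g1.
  + apply: part_inj => p; rewrite !(partD, partN, partZ) !part_mkc subrr.
    by rewrite !v0 !big_ord4 !big_ord3 /cM /cP /list_mx !inordK//=; field; rewrite ?ma1 ?m1 ?g1.
  + by [].
- move=> p j; apply: ae_sub2 (wY p j) (vw p j) => x e1 e2 Ix.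
  by rewrite e1// e2.
- move=> p j; apply: ae_sub (st_wavesE p (vel w' o0 o1) (- F 1 - alpha%:C%C * psi 1)
    (fun x => vel w' o0 o1 x + vel w' o2 o3 x) (- G 1 - alpha%:C%C * psi 1) G1 Wg GG WGG j) => x e Ix.
  by rewrite (e Ix) waves_vel.
- have oE k (H : (k < 3)%N) : Ordinal H = inord k by apply: val_inj; rewrite /= inordK.
  move=> p [[|[|[|//]]] H]; rewrite oE vz big_ord4 /cK /cJ /list_mx /W /st_scalars /end_scalars.
  all: rewrite !inordK//= !(partD, partN, partZ) !part_mkc ?subrr ?subr0.
  all: by rewrite !v0 !big_ord4 !big_ord3 /cM /cP /list_mx !inordK//=; field; rewrite ?ma1 ?m1 ?g1.
Qed.

End Realization.

(** * Existence of mild solutions *)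
Section Existence.
Variable R : realType.
Local Notation C := R[i].
Local Notation mu := (@lebesgue_measure R).
Local Notation I01 := (@I01 R).

Lemma coords_sum p n (r : nat -> R) (F : nat -> state R) :
  (forall i, (i < n)%N -> calH1 (F i)) ->
  [/\ calH1 (\sum_(i < n) (r i)%:C%C *: F i),
    forall j, {ae mu, forall x, I01 x -> st_waves p (\sum_(i < n) (r i)%:C%C *: F i) j x =
      \sum_(i < n) r i * st_waves p (F i) j x} &
    forall k, st_scalars p (\sum_(i < n) (r i)%:C%C *: F i) k = \sum_(i < n) r i * st_scalars p (F i) k].
Proof.
elim: n => [|n IH] HF.
  rewrite big_ord0; have [W S] := coords0 R p; split; first exact: calH1_0.
    by move=> j; apply: ae_sub (W j) => x e Ix; rewrite big_ord0 e.
  by move=> k; rewrite big_ord0 S.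
have [H W S] := IH (fun i ni => HF i (ltnW ni)).
have [H' W' S'] := coordsDZ p (r n) H (HF n (ltnSn n)).
have -> : \sum_(i < n.+1) (r i)%:C%C *: F i = \sum_(i < n) (r i)%:C%C *: F i + rscale (r n) (F n).
  by rewrite big_ord_recr.
split; first exact: H'.
  move=> j; apply: ae_sub2 (W j) (W' j) => x e e' Ix.
  by apply: etrans (e' Ix) _; rewrite (e Ix) big_ord_recr.
by move=> k; apply: etrans (S' k) _; rewrite S big_ord_recr.
Qed.

Lemma st_sqnormE (X : state R) (u : bool -> 'I_4 -> R -> R) (v : bool -> 'I_3 -> R) :
  calH1 X -> (forall p j, sqint I01 (u p j)) ->
  (forall p j, {ae mu, forall x, I01 x -> st_waves p X j x = u p j x}) ->
  (forall p i, st_scalars p X i = v p i) ->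
  st_sqnorm X = sqnorm (u true) (v true) + sqnorm (u false) (v false).
Proof.
move=> HX hu hX hv; have E p : sqnorm (st_waves p X) (st_scalars p X) = sqnorm (u p) (v p).
  congr (_ + _); last by apply: eq_bigr => i _; rewrite hv.
  apply: eq_bigr => j _; apply: ae_eq_Rintegral => //; first exact: measurable_I01.
  - by apply: measurable_funX; have [] := st_waves_sqint p j HX.
  - by apply: measurable_funX; have [] := hu p j.
  - by apply: ae_sub (hX p j) => x e Ix; rewrite e.
by rewrite /st_sqnorm !E.
Qed.

Lemma tags_ge0 n (s xi : nat -> R) (P : nat -> Prop) : s 0%N = 0 ->
  (forall i, (i < n)%N -> s i <= xi i <= s i.+1 /\ P i) -> forall i, (i < n)%N -> 0 <= xi i.
Proof.
move=> s0 H; have s_ge0 i : (i <= n)%N -> 0 <= s i.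
  elim: i => [|i IH] ni; first by rewrite s0.
  by have [/andP[h1 h2] _] := H i ni; rewrite (le_trans (IH (ltnW ni)))// (le_trans h1).
by move=> i ni; have [/andP[h1 _] _] := H i ni; rewrite (le_trans (s_ge0 i (ltnW ni))).
Qed.

Variables m a alpha beta gamma : R.
Hypotheses (m0 : 0 < m) (a0 : 0 < a) (alpha0 : 0 < alpha) (beta0 : 0 < beta) (gamma0 : 0 < gamma).
Local Notation opL := (opL m a alpha beta gamma).
Local Notation system_op := (system_op m a alpha beta gamma).
Local Notation Hnorm := (Hnorm m a alpha beta).

Lemma Hnorm_small (eps : R) : 0 < eps -> exists2 e : R, 0 < e &
  forall (X : state R) (u : bool -> 'I_4 -> R -> R) (v : bool -> 'I_3 -> R),
  calH1 X -> (forall p j, sqint I01 (u p j)) ->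
  (forall p j, {ae mu, forall x, I01 x -> st_waves p X j x = u p j x}) ->
  (forall p i, st_scalars p X i = v p i) ->
  (forall p j, \int[mu]_(x in I01) u p j x ^+ 2 < e) -> (forall p i, v p i ^+ 2 < e) ->
  Hnorm X < eps.
Proof.
move=> eps0; have [K K0 HK] := sqnorm_normsq m0 a0 alpha0 beta0.
exists (eps ^+ 2 / (14 * K)); first by rewrite divr_gt0 ?exprn_gt0// mulr_gt0.
move=> X u v HX hu hX hv; set e := _ / _ => ue ve.
have {}HK := (HK X HX).1; rewrite (st_sqnormE HX hu hX hv) in HK.
have Sp p : sqnorm (u p) (v p) < 7 * e.
  rewrite /sqnorm big_ord4 big_ord3.
  have [h1 h2 h3 h4] := And4 (ue p (inord 0)) (ue p (inord 1)) (ue p (inord 2)) (ue p (inord 3)).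
  by have [h5 h6 h7] := And3 (ve p (inord 0)) (ve p (inord 1)) (ve p (inord 2)); lra.
have e2 : 0 < eps ^+ 2 by rewrite exprn_gt0.
rewrite /Defs.Hnorm -(gtr0_norm eps0) -sqrtr_sqr ltr_sqrt//.
apply: le_lt_trans HK _; rewrite mulrC -ltr_pdivlMr//.
apply: lt_le_trans (ltrD (Sp true) (Sp false)) _.
by rewrite le_eqVlt; apply/orP; left; apply/eqP; rewrite /e; field; rewrite gt_eqF.
Qed.

Lemma normsq_ge0 X : calH1 X -> 0 <= normsq m a alpha beta X.
Proof.
move=> HX; have [K K0 HK] := sqnorm_normsq m0 a0 alpha0 beta0.
rewrite -(pmulr_rge0 _ K0); apply: le_trans (HK X HX).2.
have S0 w z : 0 <= @sqnorm R w z.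
  by apply: addr_ge0; apply: sumr_ge0 => i _; [apply: Rintegral_ge0 => x _|]; exact: sqr_ge0.
exact: addr_ge0.
Qed.

(** The coordinates determine the element of the state space. *)
Lemma Heq_coords (Z Z' : state R) : calH1 Z -> calH1 Z' ->
  (forall p j, {ae mu, forall x, I01 x -> st_waves p Z j x = st_waves p Z' j x}) ->
  (forall p i, st_scalars p Z i = st_scalars p Z' i) -> Heq Z Z'.
Proof.
move=> HZ HZ' EW ES; apply/Heq_subr.
have HD := let: And3 q _ _ := coordsB true HZ HZ' in q.
apply/(normsq_eq0 m0 a0 alpha0 beta0 HD).
have [K K0 HK] := sqnorm_normsq m0 a0 alpha0 beta0.
apply/eqP; rewrite eq_le normsq_ge0// andbT; apply: le_trans (HK _ HD).1 _.
rewrite (st_sqnormE (u := fun _ _ _ => 0) (v := fun _ _ => 0) HD).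
- rewrite /sqnorm big1 ?big1 ?addr0 ?mulr0// => *; rewrite ?expr0n//.
  by rewrite Rintegral_cst ?mulr0n ?mul0r//; exact: measurable_I01.
- by move=> p j; apply: sqint_cst; [exact: measurable_I01|exact: finite_I01].
- move=> p j; have [_ W _] := coordsB p HZ HZ'.
  by apply: ae_sub2 (W j) (EW p j) => x e e' Ix; rewrite e// e'// subrr.
- by move=> p i; have [_ _ S] := coordsB p HZ HZ'; rewrite S ES subrr.
Qed.

(** The real and imaginary parts of the coordinates of Z0 are propagated by the
    delay equations, and the states are rebuilt from them at each time. *)
Lemma mild_existence (Z0 : state R) : calH1 Z0 ->
  exists Z, mild_solution m a alpha beta gamma Z /\ Heq (Z 0) Z0.
Proof.
move=> HZ0; have mI := @measurable_I01 R.
pose M := cM m a gamma; pose P := cP m a beta gamma; pose K := cK m a alpha beta gamma; pose J := cJ m a alpha gamma.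
pose om p := signal M P K J (st_waves p Z0) (st_scalars p Z0).
pose ze p i t := scalars K J (st_scalars p Z0) (om p) i t.
have hw0 p j : sqint I01 (st_waves p Z0 j) by exact: st_waves_sqint.
have hom p j : loc_sqint (om p j) by apply: signal_sqint => //; exact: hw0.
have prz p i T : 0 <= T -> primitive_on 0 T (fun r => K i * ze p i r + \sum_j J i j * om p j (r - 1)) (ze p i).
  by move=> T0; apply: scalars_primitive => // j; exact: hom.
have dl p j t : 0 <= t -> om p j t = \sum_i M j i * om p i (t - 1) + \sum_i P j i * ze p i t.
  by move=> t0; exact: signal_delay.
have sz p i T : 0 <= T -> sqint `[0, T] (ze p i).
  by move=> T0; apply: scalars_sqint => // j; exact: hom.
pose wt (t : R) (p : bool) (j : 'I_4) (x : R) := om p j (t - x).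
pose zt (t : R) (p : bool) (i : 'I_3) := ze p i t.
have hwt t p j : 0 <= t -> sqint I01 (wt t p j) by move=> t0; exact: (orbit_sqint (hom p)).
pose Z t := realize (wt t) (zt t).
have HZ t : 0 <= t -> [/\ calH1 (Z t),
    forall p j, {ae mu, forall x, I01 x -> st_waves p (Z t) j x = wt t p j x} &
    forall p i, st_scalars p (Z t) i = zt t p i].
  by move=> t0; apply: realizeP => p j; exact: hwt.
have Zdiff s t p : 0 <= s -> 0 <= t -> [/\ calH1 (Z s - Z t),
    forall j, {ae mu, forall x, I01 x -> st_waves p (Z s - Z t) j x = wt s p j x - wt t p j x} &
    forall i, st_scalars p (Z s - Z t) i = zt s p i - zt t p i].
  move=> s0 t0; have [Hs Ws Ss] := HZ s s0; have [Ht Wt St] := HZ t t0.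
  have [H W S] := coordsB p Hs Ht; split => //.
    by move=> j; apply: ae_sub2 (W j) (ae_sub2 (fun _ a b => conj a b) (Ws p j) (Wt p j)) => x e [e1 e2] Ix; rewrite e// e1// e2.
  by move=> i; rewrite S Ss St.
have Z00 : Heq (Z 0) Z0.
  have [H W S] := HZ 0 (lexx 0).
  apply: Heq_coords => // [p j|p i]; last by rewrite S /zt /ze scalars0.
  apply: ae_sub (W p j) => x e Ix.
  by rewrite e// /wt /om sub0r signal_past.
exists Z; split => //; split.
- move=> t t0; split; first by case: (HZ t t0).
  apply/cvgrPdist_lt => eps eps0; have [e e0 He] := Hnorm_small eps0.
  have T0 : 0 <= t + 1 by rewrite addr_ge0.
  have U p := orbit_unif_continuous (hom p) (prz p) (sz p) T0 e0.
  have [d1 d10 H1] := U true; have [d2 d20 H2] := U false.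
  pose d := Num.min 1 (Num.min d1 d2).
  have d0 : 0 < d by rewrite !lt_min ltr01 d10.
  apply/nbhs_ballP; exists d => //= s ts; rewrite in_itv/= andbT => s0.
  move: ts; rewrite /ball/= distrC !lt_min => /and3P[l1 l2 l3].
  have sT : 0 <= s <= t + 1 by rewrite s0; move: l1; rewrite ltr_norml => /andP[_]; lra.
  have tT : 0 <= t <= t + 1 by rewrite t0/= lerDl.
  rewrite sub0r normrN ger0_norm ?sqrtr_ge0//.
  have [HA HB] := H1 s t sT tT l2; have [HA' HB'] := H2 s t sT tT l3.
  apply: (He _ (fun p j x => wt s p j x - wt t p j x) (fun p i => zt s p i - zt t p i)).
  + by case: (Zdiff s t true s0 t0).
  + by move=> p j; apply: sqintB => //; exact: hwt.
  + by move=> p; case: (Zdiff s t p s0 t0).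
  + by move=> p; case: (Zdiff s t p s0 t0).
  + by case; [exact: HA|exact: HA'].
  + by case; [exact: HB|exact: HB'].
- move=> t t0.
  have ops p := orbit_op (hom p) (prz p) (dl p) (sz p) t0.
  have hI p j := orbit_integral_sqint (hom p) j t0.
  have hD p j : sqint I01 (fun x => om p j (t - x) - om p j (0 - x)).
    by apply: sqintB => //; [exact: (hwt t p j t0)|exact: (hwt 0 p j (lexx 0))].
  have [Y [W [[HY opYW WY SY] [WW SW]]]] := realize_op m0 a0 gamma0 hI hD ops.
  have HW := opL_calH1 opYW.
  exists Y, W; split => //.
  + split => // eps eps0; have [e e0 He] := Hnorm_small eps0.
    have U p := orbit_integral (hom p) (prz p) (sz p) t0 e0.
    have [d1 d10 H1] := U true; have [d2 d20 H2] := U false.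
    exists (Num.min d1 d2); first by rewrite lt_min d10.
    move=> n s xi s0 sn H.
    have ge_min1 (x y : R) : Num.min x y <= x by rewrite ge_min lexx.
    have ge_min2 (x y : R) : Num.min x y <= y by rewrite ge_min lexx orbT.
    have xi0 := tags_ge0 s0 H.
    have [HA HB] : _ /\ _ := H1 n s xi s0 sn (fun i ni => conj (H i ni).1
      (lt_le_trans (H i ni).2 (ge_min1 _ _))).
    have [HA' HB'] : _ /\ _ := H2 n s xi s0 sn (fun i ni => conj (H i ni).1
      (lt_le_trans (H i ni).2 (ge_min2 _ _))).
    have HZxi i : (i < n)%N -> calH1 (Z (xi i)) by move=> /xi0 /HZ[].
    have HX p := coords_sum p (fun i => s i.+1 - s i) HZxi.
    have HC p := coordsB p (let: And3 q _ _ := HX p in q) HY.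
    pose u p j x := \sum_(i < n) (s i.+1 - s i) * wt (xi i) p j x - \int[mu]_(r in `[0, t]) om p j (r - x).
    pose v p i' := \sum_(i < n) (s i.+1 - s i) * zt (xi i) p i' - \int[mu]_(r in `[0, t]) ze p i' r.
    have aeS p j k : (k <= n)%N -> {ae mu, forall x, I01 x ->
        \sum_(i < k) (s i.+1 - s i) * st_waves p (Z (xi i)) j x = \sum_(i < k) (s i.+1 - s i) * wt (xi i) p j x}.
      elim: k => [|k IH] kn; first by apply: aeW => x _; rewrite !big_ord0.
      have [_ Wk _] := HZ _ (xi0 k kn).
      by apply: ae_sub2 (IH (ltnW kn)) (Wk p j) => x e1 e2 Ix; rewrite !big_ord_recr; congr (_ + _);
        [exact: e1|exact: (congr1 _ (e2 Ix))].
    apply: (He _ u v).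
    + by case: (HC true).
    + move=> p j; apply: sqintB => //.
      apply: sqint_sum => //; first exact: finite_I01.
      by move=> i; apply: sqintZ => //; exact: (hwt _ p j (xi0 i (ltn_ord i))).
    + move=> p j; have [_ W1 _] := HC p; have [_ W2 _] := HX p.
      apply: ae_sub2 (ae_sub2 (fun _ a b => conj a b) (W1 j) (W2 j)) (ae_sub2 (fun _ a b => conj a b) (WY p j) (aeS p j n (leqnn n))) => x [e1 e2] [e3 e4] Ix.
      by rewrite (e1 Ix) (e2 Ix) (e3 Ix) (e4 Ix).
    + move=> p i'; have [_ _ S1] := HC p; have [_ _ S2] := HX p.
      rewrite S1 S2 SY /v; congr (_ - _); apply: eq_bigr => i _.
      by have [_ _ ->] := HZ _ (xi0 i (ltn_ord i)).
    + by case; [exact: HA|exact: HA'].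
    + by case; [exact: HB|exact: HB'].
  + have [H0 W0 S0] := HZ 0 (lexx 0); have [Ht Wt St] := HZ t t0.
    have HD p := coordsD p H0 HW.
    apply: Heq_coords; [exact: Ht|by case: (HD true)| |].
      move=> p j; have [_ W1 _] := HD p.
      apply: ae_sub2 (ae_sub2 (fun _ a b => conj a b) (W1 j) (WW p j)) (ae_sub2 (fun _ a b => conj a b) (W0 p j) (Wt p j)) => x [e1 e2] [e3 e4] Ix.
      apply: etrans (e4 Ix) _; apply/esym; apply: etrans (e1 Ix) _.
      by apply: etrans (congr2 +%R (e3 Ix) (e2 Ix)) _; rewrite addrC; exact: subrK.
    move=> p i; have [_ _ S1] := HD p; apply: etrans (St p i) _; apply/esym; apply: etrans (S1 i) _.
    by apply: etrans (congr2 +%R (S0 p i) (SW p i)) _; rewrite addrC; exact: subrK.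
Qed.

End Existence.

(** * Uniqueness and decay *)
Section WellPosedness.
Variables (R : realType) (m a alpha beta gamma : R).
Local Notation I01 := (@I01 R).
Hypotheses (m0 : 0 < m) (a0 : 0 < a) (alpha0 : 0 < alpha) (beta0 : 0 < beta) (gamma0 : 0 < gamma).
Local Notation opL := (opL m a alpha beta gamma).
Local Notation Hnorm := (Hnorm m a alpha beta).
Local Notation normsq := (normsq m a alpha beta).

Variables (b : state R -> state R -> R) (k K : R).
Hypotheses (hb : semi_inner (@calH1 R) b) (k0 : 0 < k) (K0 : 0 < K).
Hypothesis b_normsq : forall X, calH1 X -> b X X <= k ^+ 2 * normsq X.
Hypothesis normsq_b : forall X, calH1 X -> normsq X <= K * b X X.

Lemma nrm_Hnorm X : calH1 X -> nrm b X <= k * Hnorm X.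
Proof.
move=> HX; rewrite /nrm /Defs.Hnorm -{1}(gtr0_norm k0) -sqrtr_sqr -sqrtrM ?sqr_ge0//.
by rewrite ler_sqrt ?b_normsq// mulr_ge0 ?sqr_ge0// normsq_ge0.
Qed.

Lemma Heq_nrm (Z Z' : state R) : calH1 Z -> calH1 Z' -> Heq Z Z' <-> nrm b (Z - Z') = 0.
Proof.
move=> HZ HZ'; have HD := si_HB hb HZ HZ'.
split=> [/Heq_subr /(normsq_eq0 m0 a0 alpha0 beta0 HD) N0|N0].
  apply/eqP; rewrite eq_le nrm_ge0 andbT; apply: le_trans (nrm_Hnorm HD) _.
  by rewrite /Defs.Hnorm N0 sqrtr0 mulr0.
apply/Heq_subr; apply/(normsq_eq0 m0 a0 alpha0 beta0 HD).
apply/eqP; rewrite eq_le normsq_ge0// andbT; apply: le_trans (normsq_b HD) _.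
by rewrite -(sqr_nrm hb HD) N0 expr0n mulr0.
Qed.

(** By the equivalence of the norms, a mild solution for the norm of the state
    space is one for the seminorm of b. *)
Lemma mild_solution_mildsol Z : mild_solution m a alpha beta gamma Z ->
  mildsol (@calH1 R) (nrm b) opL Z.
Proof.
move=> [cZ iZ]; have HZ t : 0 <= t -> calH1 (Z t) by move=> /cZ[].
split => //.
- move=> t t0 e e0; have [_ /cvgrPdist_lt/(_ _ (divr_gt0 e0 k0))] := cZ t t0.
  move/nbhs_ballP => [d /= d0 Hd]; exists d => // s s0 st.
  have := Hd s; rewrite /ball/= in_itv/= distrC andbT => /(_ st s0).
  rewrite sub0r normrN ger0_norm ?sqrtr_ge0// ltr_pdivlMr// mulrC.
  by apply: le_lt_trans; apply: nrm_Hnorm; apply: (si_HB hb); exact: HZ.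
- move=> t t0; have [Y [W [[HY IY] op E]]] := iZ t t0; have HW := opL_calH1 op.
  exists Y, W; split; last first.
    by apply/(Heq_nrm (HZ t t0)) => //; apply: (si_HD hb) => //; exact: HZ.
  split => // eps eps0; have [d d0 Hd] := IY _ (divr_gt0 eps0 k0).
  exists d => // n s xi s0 sn H; have := Hd n s xi s0 sn H.
  rewrite ltr_pdivlMr// mulrC; apply: le_lt_trans; apply: nrm_Hnorm.
  have [HS _ _] := coords_sum true (fun i => s i.+1 - s i) (fun i ni => HZ _ (tags_ge0 s0 H ni)).
  exact: (si_HB hb).
Qed.

Variable lam : R.
Hypotheses (lam0 : 0 <= lam) (b_diss : forall Y W, calH1 Y -> calH1 W -> opL Y W -> b W Y <= - lam * b Y Y).

Lemma mild_unique Z Z' : mild_solution m a alpha beta gamma Z ->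
  mild_solution m a alpha beta gamma Z' -> Heq (Z' 0) (Z 0) ->
  forall t, 0 <= t -> Heq (Z' t) (Z t).
Proof.
move=> /mild_solution_mildsol mZ /mild_solution_mildsol mZ' E0 t t0.
have mD := mildsolB hb (@opLB R m a alpha beta gamma) mZ' mZ.
have HZ s : 0 <= s -> calH1 (Z s) := ms_H mZ (t := s).
have HZ' s : 0 <= s -> calH1 (Z' s) := ms_H mZ' (t := s).
have := mild_decay hb (@opLB R m a alpha beta gamma) b_diss lam0 mD t0.
have /(Heq_nrm (HZ' 0 (lexx 0)) (HZ 0 (lexx 0))) -> := E0.
rewrite mulr0 => h; apply/(Heq_nrm (HZ' t t0) (HZ t t0)).
by apply/eqP; rewrite eq_le h nrm_ge0.
Qed.

Lemma mild_normsq_decay Z : mild_solution m a alpha beta gamma Z -> forall t, 0 <= t ->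
  normsq (Z t) <= K * b (Z 0) (Z 0) * expR (- (2 * lam * t)).
Proof.
move=> /mild_solution_mildsol mZ t t0; have HZ s : 0 <= s -> calH1 (Z s) := ms_H mZ (t := s).
have Ht := HZ t t0; have H0 := HZ 0 (lexx 0).
apply: le_trans (normsq_b Ht) _; rewrite -mulrA ler_pM2l//.
rewrite -(sqr_nrm hb Ht) -(sqr_nrm hb H0).
rewrite (_ : expR _ = expR (- lam * t) ^+ 2); last first.
  by rewrite expr2 -expRD; congr expR; ring.
rewrite -exprMn mulrC ler_pXn2r ?nnegrE ?mulr_ge0 ?expR_ge0 ?nrm_ge0//.
exact: (mild_decay hb (@opLB R m a alpha beta gamma) b_diss lam0 mZ t0).
Qed.

End WellPosedness.

Lemma Heq_trans_sym (R : realType) (X Y Z : state R) : Heq X Z -> Heq Y Z -> Heq X Y.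
Proof.
move: X Y Z => [[[[[f g] eta] phi] psi] h] [[[[[f' g'] eta'] phi'] psi'] h'] [[[[[k l] e] q] p] n].
move=> [[A1 A2 ->] [A3 A4 ->]] [[B1 B2 ->] [B3 B4 ->]]; split; split => //.
- by move=> x x01; rewrite A1// B1.
- by apply: ae_sub2 A2 B2 => x e1 e2 x01; rewrite e1// e2.
- by move=> x x01; rewrite A3// B3.
- by apply: ae_sub2 A4 B4 => x e1 e2 x01; rewrite e1// e2.
Qed.

Theorem theorem6 (R : realType) (m a alpha beta gamma : R)
    (hm : 0 < m) (ha : 0 < a) (halpha : 0 < alpha) (hbeta : 0 < beta)
    (hgamma : 0 < gamma) :
  exists2 gamma1 : R, 0 < gamma1 &
  forall Z0 : state R, calH1 Z0 ->
  exists Z : R -> state R,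
    [/\ mild_solution m a alpha beta gamma Z,
        Heq (Z 0) Z0,
        (forall Z' : R -> state R,
           mild_solution m a alpha beta gamma Z' -> Heq (Z' 0) Z0 ->
           forall t : R, 0 <= t -> Heq (Z' t) (Z t)) &
        exists2 M1 : R, 0 < M1 &
          forall t : R, 0 <= t ->
            normsq m a alpha beta (Z t) <= M1 * expR (- (gamma1 * t))].
Proof.
have [delta [d [B [lam [c [C [[lam0 c0 C0] [diss bnd]]]]]]]] :=
  lyapunov_form hm ha halpha hbeta hgamma.
have [K K0 HK] := sqnorm_normsq hm ha halpha hbeta.
pose b := energy m a alpha beta gamma delta d B.
have hb : semi_inner (@calH1 R) b.
  apply: energy_semi_inner => w z hw; have /andP[h _] := bnd w z hw.
  apply: le_trans h; apply: mulr_ge0 (ltW c0) _.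
  by apply: addr_ge0; apply: sumr_ge0 => i _; [apply: Rintegral_ge0 => x _|]; exact: sqr_ge0.
have b_st X : calH1 X -> c * st_sqnorm X <= b X X <= C * st_sqnorm X.
  move=> HX; have hX p j : sqint (@I01 R) (st_waves p X j) by exact: st_waves_sqint.
  have /andP[l1 u1] := bnd _ (st_scalars true X) (hX true).
  have /andP[l2 u2] := bnd _ (st_scalars false X) (hX false).
  by rewrite /st_sqnorm (mulrDr c) (mulrDr C); apply/andP; split; apply: lerD.
have CK0 : 0 < C * K by rewrite mulr_gt0.
have k0 : 0 < Num.sqrt (C * K) by rewrite sqrtr_gt0.
have b1 X : calH1 X -> b X X <= Num.sqrt (C * K) ^+ 2 * normsq m a alpha beta X.
  move=> HX; have /andP[_ h] := b_st X HX; rewrite (sqr_sqrtr (ltW CK0)).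
  by apply: le_trans h _; rewrite -mulrA ler_pM2l//; case: (HK X HX).
have Kc0 : 0 < K / c by rewrite divr_gt0.
have b2 X : calH1 X -> normsq m a alpha beta X <= K / c * b X X.
  move=> HX; have /andP[h _] := b_st X HX; apply: le_trans (HK X HX).1 _.
  by rewrite -mulrA ler_pM2l// ler_pdivlMl.
have b_diss := energy_dissipation hm ha hgamma diss.
exists (2 * lam); first by rewrite mulr_gt0.
move=> Z0 HZ0; have [Z [mZ Z00]] := mild_existence hm ha halpha hbeta hgamma HZ0.
have H0 : calH1 (Z 0) by case: (mZ.1 0 (lexx 0)).
exists Z; split => //.
  move=> Z' mZ' Z'0.
  exact: (mild_unique hm ha halpha hbeta hb k0 b1 b2 (ltW lam0) b_diss mZ mZ'
    (Heq_trans_sym Z'0 Z00)).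
have b00 : 0 <= b (Z 0) (Z 0) := si_ge0 hb H0.
exists (K / c * b (Z 0) (Z 0) + 1).
  by rewrite ltr_wpDl// mulr_ge0// ltW.
move=> t t0.
apply: le_trans (mild_normsq_decay hm ha halpha hbeta hb k0 Kc0 b1 b2 (ltW lam0) b_diss mZ t0) _.
by rewrite ler_wpM2r ?expR_ge0// lerDl.
Qed.
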